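(* Let $0\le\beta<1/2$, let $m\ge1$ be an integer, and let $\nu_m^\dag$ be the law on $l^2$ of $\mathfrak{J}_\beta B_m^\dag$, where $B_m^\dag$ is the linear interpolation with mesh $1/m$ of a standard Brownian motion $B^\dag$ on $[0,1]$. Let $m_\beta$ be the centered Gaussian measure on $l^2$ with covariance operator $S_\beta$. For every integer $s\ge0$ and every $F\in\mathcal{C}^{2s+2}_b(l^2;\mathbf{R})$, we have the expansion $$\int_{l^2}F\,d\nu_m^\dag=\sum_{j=0}^s\frac1{2^j\,j!}\int_{l^2}\left\langle\nabla^{(2j)}F(u),\ (S_m^\dag-S_\beta)^{\otimes j}\right\rangle_{(l^2)^{\otimes 2j}}dm_\beta(u)+\operatorname{Rem}^\dag(s,F,m),$$ where the remainder (defined by this identity) satisfies $$\left|\operatorname{Rem}^\dag(s,F,m)\right|\le\frac{(\gamma^\dag_{m,\beta})^{s+1}}{2^{s+1}}\,\|F\|_{\mathcal{C}^{2s+2}_b(l^2;\mathbf{R})} .$$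
   Context: Spaces. $l^2=l^2(\mathbf{N})$ is the Hilbert space of square-summable real sequences indexed by the positive integers, with complete orthonormal basis $(x_n,\,n\ge1)$. For a Hilbert space $X$, $\mathcal{C}^k_b(l^2;X)$ is the space of $k$-times Fréchet differentiable functions $F:l^2\to X$ with bounded derivatives, i.e. with $$\|F\|_{\mathcal{C}^k_b(l^2;X)}:=\sup_{j=1,\dots,k}\ \sup_{x\in l^2}\|\nabla^{(j)}F(x)\|_{X\otimes(l^2)^{\otimes j}}<\infty .$$ For $x,y\in l^2$, $x\otimes y$ is regarded either as an element of $l^2\otimes l^2$ or as the operator $f\mapsto (y.f)\,x$, where a dot denotes the scalar product of $l^2$; in this way Hilbert–Schmidt operators on $l^2$ are identified with elements of $l^2\otimes l^2$. The $j=0$ term in the expansion is $\int_{l^2} F\,dm_\beta$. Fractional integrals. $\mathbf{L}^2=L^2([0,1];dt)$. For $\alpha>0$ and $f\in \mathbf{L}^2$, $(I^\alpha_{0^+}f)(x)=\frac1{\Gamma(\alpha)}\int_0^x f(t)(x-t)^{\alpha-1}dt$ and $(I^\alpha_{1^-}f)(x)=\frac1{\Gamma(\alpha)}\int_x^1 f(t)(t-x)^{\alpha-1}dt$; $I^0_{0^+}=I^0_{1^-}=\mathrm{Id}$. Let $\mathcal{I}_{\beta,2}=I^\beta_{0^+}(\mathbf{L}^2)$, and for $f\in\mathcal{I}_{\beta,2}$ let $\partial_\beta f$ be the unique element of $\mathbf{L}^2$ with $f=I^\beta_{0^+}\partial_\beta f$. Let $(e_n,\,n\ge1)$ be a complete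 orthonormal basis of $\mathbf{L}^2$, and put $k_n^{1-\beta}=I^{1-\beta}_{1^-}e_n$. The isometry $\mathfrak{J}_\beta:\mathcal{I}_{\beta,2}\to l^2$ is $\mathfrak{J}_\beta f=\sum_{n\ge1}\left(\int_0^1\partial_\beta f(s)e_n(s)\,ds\right)x_n$. Gaussian measure. $m_\beta$ is the centered Gaussian measure on $l^2$ with covariance operator $$S_\beta=\sum_{n,l\ge1}\left(\int_0^1k_n^{1-\beta}(s)k_l^{1-\beta}(s)\,ds\right)x_n\otimes x_l ,$$ i.e. $\int_{l^2} e^{i\eta.u}\,dm_\beta(u)=\exp(-\frac12\, (S_\beta\eta).\eta)$ for $\eta\in l^2$ (it is the image by $\mathfrak{J}_\beta$ of the Wiener measure on $\mathcal{I}_{\beta,2}$). Linear interpolation. $B_m^\dag(0)=0$ and $$dB_m^\dag(t)=m\sum_{i=0}^{m-1}\left(B^\dag((i+1)/m)-B^\dag(i/m)\right)\mathbf{1}_{[i/m,(i+1)/m)}(t)\,dt ,$$ so that $$\mathfrak{J}_\beta B_m^\dag=\sum_{n\ge1}\left(m\sum_{i=0}^{m-1}\left(B^\dag((i+1)/m)-B^\dag(i/m)\right)\int_{i/m}^{(i+1)/m}k_n^{1-\beta}(t)\,dt\right)x_n .$$ Operator $S_m^\dag$. Let $e_j^m=\sqrt m\,\mathbf{1}_{[j/m,(j+1)/m)}$ for $j=0,\dots,m-1$, let $F_m^\dag=\mathrm{span}(e_j^m,\ j=0,\dots,m-1)\subset\mathbf{L}^2$, and let $p_{F_m^\dag}$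 be the orthogonal projection of $\mathbf{L}^2$ onto $F_m^\dag$. With $K_m^\dag=\sum_{n\ge1}(p_{F_m^\dag}k_n^{1-\beta})\otimes x_n\in \mathbf{L}^2\otimes l^2$, set $S_m^\dag=\operatorname{trace}_{\mathbf{L}^2}(K_m^\dag\otimes K_m^\dag)$ (partial trace over the two $\mathbf{L}^2$ factors), that is $$S_m^\dag=\sum_{n,l\ge1}\left(\int_0^1 (p_{F_m^\dag}k_n^{1-\beta})(s)\,(p_{F_m^\dag}k_l^{1-\beta})(s)\,ds\right)x_n\otimes x_l .$$ Constant. $\gamma^\dag_{m,\beta}=|\operatorname{trace}(S_m^\dag-S_\beta)|$, the operator $S_\beta-S_m^\dag$ being non-negative and trace-class on $l^2$. *)

(* Defs.v *)
From HB Require Import structures.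
From mathcomp Require Import all_boot all_order all_algebra.
From mathcomp Require Import all_classical all_reals all_analysis.
From mathcomp Require Import ring lra.

Set Implicit Arguments.
Unset Strict Implicit.
Unset Printing Implicit Defensive.

Import Order.TTheory GRing.Theory Num.Theory.
Import numFieldNormedType.Exports.

Local Open Scope classical_set_scope.
Local Open Scope ring_scope.

Section square_summable.
Context {R : realType} {I : choiceType}.
Implicit Types u v : I -> R.

Definition sqsum u : \bar R := \esum_(i in [set: I]) ((u i) ^+ 2)%:E.

Definition sqsummable : {pred I -> R} := mem [set u | (sqsum u < +oo)%E].

Lemma sqsum_ge0 u : (0 <= sqsum u)%E.
Proof. by apply: esum_ge0 => i _; rewrite lee_fin sqr_ge0. Qed.

Lemma sqsum_ge u i : (((u i) ^+ 2)%:E <= sqsum u)%E.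
Proof.
rewrite /sqsum -(@esum_set1 R I i (fun i => ((u i) ^+ 2)%:E)) ?lee_fin ?sqr_ge0//.
rewrite [leLHS]esum_mkcond; apply: le_esum => j _.
by case: ifP => // _; rewrite lee_fin sqr_ge0.
Qed.

Lemma esumZ_le (c : R) (a : I -> R) : 0 <= c -> (forall i, 0 <= a i) ->
  (\esum_(i in [set: I]) (c * a i)%:E <= c%:E * \esum_(i in [set: I]) (a i)%:E)%E.
Proof.
move=> c0 a0; apply: ge_ereal_sup => _ [A [finA _]] <-.
under eq_fsbigr do rewrite EFinM.
rewrite -ge0_mule_fsumr; last by move=> i; rewrite lee_fin.
by rewrite lee_wpmul2l ?lee_fin//; apply: esum_ge; exists A.
Qed.

Lemma sqsumZ_le (c : R) u : (sqsum (c *: u) <= (c ^+ 2)%:E * sqsum u)%E.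
Proof.
apply: le_trans (esumZ_le (sqr_ge0 c) (fun i => sqr_ge0 (u i))).
by apply: le_esum => i _; rewrite lee_fin -exprMn.
Qed.

Lemma sqsumD_le (t : R) u v : 0 < t ->
  (sqsum (u + v)%R <= (1 + t)%:E * sqsum u + (1 + t^-1)%:E * sqsum v)%E.
Proof.
move=> t0; have ti0 : 0 < t^-1 by rewrite invr_gt0.
have h1 : 0 <= 1 + t by lra.
have h2 : 0 <= 1 + t^-1 by lra.
apply: le_trans (leeD (esumZ_le h1 (fun i => sqr_ge0 (u i)))
                      (esumZ_le h2 (fun i => sqr_ge0 (v i)))).
rewrite -esumD; last 2 first.
- by move=> i _; rewrite lee_fin mulr_ge0// sqr_ge0.
- by move=> i _; rewrite lee_fin mulr_ge0// sqr_ge0.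
apply: le_esum => i _; rewrite -EFinD lee_fin.
have -> : (u + v) i = u i + v i by [].
rewrite -subr_ge0.
have -> : (1 + t) * u i ^+ 2 + (1 + t^-1) * v i ^+ 2 - (u i + v i) ^+ 2
    = t^-1 * (t * u i - v i) ^+ 2.
  by field; rewrite gt_eqF.
by rewrite mulr_ge0 ?sqr_ge0// ltW.
Qed.

Lemma sqsummable_submod_closed : submod_closed sqsummable.
Proof.
split.
  rewrite inE/= /sqsum esum1 ?ltry// => i _.
  by rewrite (_ : (0 : I -> R) i = 0)// expr0n.
move=> a u v; rewrite !inE/= => su sv.
apply: le_lt_trans (sqsumD_le _ _ (@ltr01 R)) _.
rewrite lte_add_pinfty//; last by rewrite lte_mul_pinfty// lee_fin addr_ge0.
rewrite lte_mul_pinfty ?lee_fin ?addr_ge0//.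
by apply: le_lt_trans (sqsumZ_le _ _) _; rewrite lte_mul_pinfty ?lee_fin ?sqr_ge0.
Qed.

HB.instance Definition _ :=
  GRing.isSubmodClosed.Build R (I -> R) sqsummable sqsummable_submod_closed.

End square_summable.

Section ell2.
Context (R : realType) (I : choiceType).

Record ell2 : Type := Ell2 {
  ell2_val :> I -> R ;
  ell2P : ell2_val \in @sqsummable R I }.

HB.instance Definition _ := [isSub for ell2_val].
HB.instance Definition _ := [Choice of ell2 by <:].
HB.instance Definition _ := [SubChoice_isSubLmodule of ell2 by <:].

Implicit Types u v : ell2.

Definition ell2_norm u : R := Num.sqrt (fine (sqsum u)).

Lemma sqsum_fin u : sqsum u \is a fin_num.
Proof. by rewrite ge0_fin_numE ?sqsum_ge0//; have := ell2P u; rewrite inE. Qed.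

Lemma ell2_norm_sqr u : (ell2_norm u ^+ 2)%:E = sqsum u.
Proof.
by rewrite sqr_sqrtr ?fine_ge0 ?sqsum_ge0// fineK ?sqsum_fin.
Qed.

Lemma ell2_norm_ge0 u : 0 <= ell2_norm u. Proof. exact: sqrtr_ge0. Qed.

Lemma ell2_normr0_eq0 u : ell2_norm u = 0 -> u = 0.
Proof.
move=> u0; apply/val_inj/funext => i; apply/eqP.
rewrite /= -[X in _ == X]/(0 : R) -sqrf_eq0 eq_le sqr_ge0 andbT -lee_fin.
by rewrite (le_trans (sqsum_ge u i))// -ell2_norm_sqr u0 expr0n.
Qed.

Lemma ell2_le_norm u (M : R) : 0 <= M ->
  (sqsum u <= (M ^+ 2)%:E)%E -> ell2_norm u <= M.
Proof.
move=> M0; rewrite -ell2_norm_sqr lee_fin ler_sqr ?nnegrE//.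
exact: ell2_norm_ge0.
Qed.

Lemma ell2_ler_normD u v : ell2_norm (u + v) <= ell2_norm u + ell2_norm v.
Proof.
have [u0|u0] := eqVneq (ell2_norm u) 0.
  by rewrite (ell2_normr0_eq0 u0) add0r lerDr ell2_norm_ge0.
have [v0|v0] := eqVneq (ell2_norm v) 0.
  by rewrite (ell2_normr0_eq0 v0) addr0 lerDl ell2_norm_ge0.
have a0 : 0 < ell2_norm u by rewrite lt0r u0 ell2_norm_ge0.
have b0 : 0 < ell2_norm v by rewrite lt0r v0 ell2_norm_ge0.
apply: ell2_le_norm; first by rewrite addr_ge0 ?ell2_norm_ge0.
apply: le_trans (sqsumD_le _ _ (divr_gt0 b0 a0)) _.
rewrite -!ell2_norm_sqr -!EFinM -EFinD lee_fin le_eqVlt; apply/orP; left.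
by apply/eqP; field; rewrite u0 v0.
Qed.

Lemma ell2_normrZ_le (l : R) u : ell2_norm (l *: u) <= `|l| * ell2_norm u.
Proof.
apply: ell2_le_norm; first by rewrite mulr_ge0 ?ell2_norm_ge0.
apply: le_trans (sqsumZ_le _ _) _.
by rewrite -ell2_norm_sqr -EFinM lee_fin exprMn real_normK ?num_real.
Qed.

Lemma ell2_normrZ (l : R) u : ell2_norm (l *: u) = `|l| * ell2_norm u.
Proof.
have [->|l0] := eqVneq l 0.
  apply/eqP; rewrite normr0 mul0r eq_le ell2_norm_ge0 andbT.
  by rewrite (le_trans (ell2_normrZ_le _ _))// normr0 mul0r.
apply/eqP; rewrite eq_le ell2_normrZ_le/=.
rewrite -ler_pdivlMl ?normr_gt0// -normfV.
by rewrite -[in leLHS](scalerK l0 u) ell2_normrZ_le.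
Qed.

HB.instance Definition _ := Lmodule_isNormed.Build R ell2
  ell2_ler_normD ell2_normrZ ell2_normr0_eq0.

HB.instance Definition _ := @isMeasurable.Build (sigma_display (@open ell2)) ell2
  <<s @open ell2 >> (@sigma_algebra0 _ setT open) (@sigma_algebraC ell2 open)
  (@sigma_algebra_bigcup _ setT open).

End ell2.


Section bounded_operators.
Context {R : realType} (V W : normedModType R).

Definition bounded_linear : {pred V -> W} :=
  mem [set f : V -> W | linear f /\ exists M : R, forall v, `|f v| <= M * `|v|].

Lemma bounded_linear_submod_closed : submod_closed bounded_linear.
Proof.
split.
  rewrite inE/=; split=> [a u v|].
    by rewrite (_ : (0 : V -> W) = cst 0)//= scaler0 addr0.
  by exists 0 => v; rewrite (_ : (0 : V -> W) = cst 0)//= normr0 mul0r.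
move=> a f g; rewrite !inE/= => -[lf [M fM]] [lg [N gN]]; split.
  move=> b u v; rewrite /= -[LHS]/(a *: f _ + g _) lf lg.
  rewrite -[RHS]/(b *: (a *: f u + g u) + (a *: f v + g v)).
  by rewrite !scalerDr !scalerA (mulrC a b) addrACA.
exists (`|a| * M + N) => v; rewrite -[X in `|X|]/(a *: f v + g v).
rewrite (le_trans (ler_normD _ _))// mulrDl lerD// normrZ -mulrA.
by rewrite ler_wpM2l.
Qed.

HB.instance Definition _ :=
  GRing.isSubmodClosed.Build R (V -> W) bounded_linear
    bounded_linear_submod_closed.

Record bop : Type := Bop { bop_val :> V -> W ; bopP : bop_val \in bounded_linear }.

HB.instance Definition _ := [isSub for bop_val].
HB.instance Definition _ := [Choice of bop by <:].
HB.instance Definition _ := [SubChoice_isSubLmodule of bop by <:].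

Implicit Types f g : bop.

Definition bop_norm f : R := sup [set `|f v| | v in [set v : V | `|v| <= 1]].

Let bop_linear f : linear f.
Proof. by have := bopP f; rewrite inE => -[]. Qed.

Let bop0 f : f 0 = 0.
Proof.
have := bop_linear f 1 0 0; rewrite !scale1r addr0 => /esym/eqP.
by rewrite -subr_eq0 addrK => /eqP.
Qed.

Let bopZ f a v : f (a *: v) = a *: f v.
Proof. by have := bop_linear f a v 0; rewrite !addr0 bop0 addr0. Qed.

Let bop_has_sup f : has_sup [set `|f v| | v in [set v : V | `|v| <= 1]].
Proof.
split; first by exists `|f 0|, 0 => //=; rewrite normr0.
have := bopP f; rewrite inE => -[_ [M fM]].
exists `|M| => _ [v /= v1 <-]; rewrite (le_trans (fM v))//.
rewrite (le_trans (ler_wpM2r (normr_ge0 v) (ler_norm M)))//.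
by rewrite ler_piMr.
Qed.

Let le_bop_norm f v : `|v| <= 1 -> `|f v| <= bop_norm f.
Proof. by move=> v1; apply: ub_le_sup; [case: (bop_has_sup f)|exists v]. Qed.

Let bop_norm_le f M : (forall v, `|v| <= 1 -> `|f v| <= M) -> bop_norm f <= M.
Proof.
move=> fM; apply: ge_sup; first by case: (bop_has_sup f).
by move=> _ [v v1 <-]; exact: fM.
Qed.

Let bop_norm_ge0 f : 0 <= bop_norm f.
Proof. by apply: le_trans (@le_bop_norm f 0 _); rewrite ?bop0 normr0. Qed.

Lemma bop_ler_normD f g : bop_norm (f + g) <= bop_norm f + bop_norm g.
Proof.
apply: bop_norm_le => v v1; rewrite -[X in `|X|]/(f v + g v).
by rewrite (le_trans (ler_normD _ _))// lerD// le_bop_norm.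
Qed.

Let bop_normrZ_le (l : R) f : bop_norm (l *: f) <= `|l| * bop_norm f.
Proof.
apply: bop_norm_le => v v1; rewrite -[X in `|X|]/(l *: f v).
by rewrite normrZ ler_wpM2l// le_bop_norm.
Qed.

Lemma bop_normrZ (l : R) f : bop_norm (l *: f) = `|l| * bop_norm f.
Proof.
have [->|l0] := eqVneq l 0.
  apply/eqP; rewrite normr0 mul0r eq_le bop_norm_ge0 andbT.
  by rewrite (le_trans (bop_normrZ_le _ _))// normr0 mul0r.
apply/eqP; rewrite eq_le bop_normrZ_le/=.
rewrite -ler_pdivlMl ?normr_gt0// -normfV.
by rewrite -[in leLHS](scalerK l0 f) bop_normrZ_le.
Qed.

Lemma bop_normr0_eq0 f : bop_norm f = 0 -> f = 0.
Proof.
move=> f0; apply/val_inj/funext => v /=; rewrite -[RHS]/(0 : W).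
have [->|v0] := eqVneq v 0; first exact: bop0.
apply/eqP; rewrite -normr_eq0 eq_le normr_ge0 andbT.
have nv0 : 0 < `|v| by rewrite normr_gt0.
have : `|f (`|v|^-1 *: v)| <= 0.
  rewrite -f0; apply: le_bop_norm.
  by rewrite normrZ normfV normr_id mulVf ?gt_eqF.
by rewrite bopZ normrZ normfV normr_id pmulr_rle0// invr_gt0.
Qed.

HB.instance Definition _ := Lmodule_isNormed.Build R bop
  bop_ler_normD bop_normrZ bop_normr0_eq0.

End bounded_operators.

Section tensors.
Context {R : realType}.

Local Notation l2 := (ell2 R nat).

(* Meaningful for absolutely summable families only. *)
Definition usum (I : choiceType) (a : I -> R) : R :=
  fine (\esum_(i in [set: I]) (Num.max (a i) 0)%:E) -
  fine (\esum_(i in [set: I]) (Num.max (- a i) 0)%:E).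

Definition dotp (I : choiceType) (u v : I -> R) : R := usum (fun i => u i * v i).

Lemma delta_subproof (n : nat) :
  (fun i => (i == n)%:R) \in @sqsummable R nat.
Proof.
rewrite inE/= /sqsum (_ : \esum_(i in _) _ =
    \esum_(i in [set n]) (1 : R)%:E)%E; last first.
  rewrite [RHS]esum_mkcond; apply: eq_esum => i _.
  have [->|ne] := eqVneq; first by rewrite mem_set//= expr1n.
  by rewrite memNset//=; [rewrite expr0n|exact/eqP].
by rewrite esum_set1 ?ltry// lee_fin.
Qed.

Definition delta (n : nat) : l2 := Ell2 (delta_subproof n).

Lemma tensor_subproof (x y : l2) :
  (fun p : nat * nat => x p.1 * y p.2) \in @sqsummable R (nat * nat)%type.
Proof.
rewrite inE/= /sqsum.
have -> : [set: nat * nat] = setT `*`` (fun=> setT) by apply/seteqP; split.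
rewrite (eq_esum (b := fun p => ((x p.1 * y p.2) ^+ 2)%:E))//.
rewrite -(@esum_esum R nat nat setT (fun=> setT)
  (fun i j => ((x i * y j) ^+ 2)%:E)); last first.
  by move=> i j; rewrite lee_fin sqr_ge0.
have h i : (\esum_(j in [set: nat]) ((x i * y j) ^+ 2)%:E <=
    (`|y| ^+ 2 * x i ^+ 2)%:E)%E.
  apply: le_trans (_ : (x i ^+ 2)%:E * sqsum y <= _)%E.
    apply: le_trans (esumZ_le (sqr_ge0 _) (fun j => sqr_ge0 (y j))).
    by apply: le_esum => j _; rewrite exprMn.
  by rewrite -ell2_norm_sqr -EFinM lee_fin mulrC.
apply: le_lt_trans (le_esum (fun i _ => h i)) _.
apply: le_lt_trans (esumZ_le (sqr_ge0 _) (fun j => sqr_ge0 (x j))) _.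
by rewrite -/(sqsum x) -ell2_norm_sqr -EFinM ltry.
Qed.

(* The Hilbert tensor powers of l^2 are identified with spaces of
   square-summable arrays: l^2 (x) l^2 with ell2 R (nat * nat), and the j-th
   power with the arrays indexed by j.-tuple nat. *)
Definition tensor (x y : l2) : ell2 R (nat * nat)%type := Ell2 (tensor_subproof x y).

Definition tpow (T : ell2 R (nat * nat)%type) (j : nat) :
    (2 * j)%N.-tuple nat -> R :=
  fun i => \prod_(k < j) T (nth 0%N i k.*2, nth 0%N i k.*2.+1).

(* (T eta) . eta, where x (x) y acts by f |-> (y . f) x. *)
Definition qform (T : ell2 R (nat * nat)%type) (eta : l2) : R :=
  dotp (fun p => dotp (fun q => T (p, q)) eta) eta.

(* For trace-class T, computed in the canonical basis. *)
Definition trace (T : ell2 R (nat * nat)%type) : R :=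
  limn (series (fun p => T (p, p))).

Definition orthonormal_basis (x : nat -> l2) : Prop :=
  (forall n l, dotp (x n) (x l) = (n == l)%:R) /\
  (forall u : l2, series (fun n => dotp u (x n) *: x n) @ \oo --> u).

(* \sum_(n, l) a n l *: (x n (x) x l), summed along squares; the limit exists
   when a is square-summable and x is an orthonormal basis. *)
Definition opsum (x : nat -> l2) (a : nat -> nat -> R) :
    ell2 R (nat * nat)%type :=
  limn (fun N : nat => \sum_(n < N) \sum_(l < N) a n l *: tensor (x n) (x l)).

End tensors.
Arguments tpow {R} T j.

Section frechet_derivatives.
Context {R : realType}.

Local Notation l2 := (ell2 R nat).

(* L(l^2, L(l^2, ... , L(l^2, R))), normed by the operator norms. *)
Fixpoint multilin (j : nat) : normedModType R :=
  if j is j'.+1 then bop l2 (multilin j') else R.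

Definition to_bop (V W : normedModType R) (f : V -> W) : bop V W := insubd 0 f.

(* When 'd is bounded, i.e. at points of differentiability, to_bop is the mere
   coercion. *)
Fixpoint frechet (F : l2 -> R) (j : nat) : l2 -> multilin j :=
  match j with
  | 0 => F
  | j'.+1 => fun x => to_bop ('d (frechet F j') x)
  end.

Definition k_differentiable (k : nat) (F : l2 -> R) : Prop :=
  forall j, (j < k)%N -> forall x, differentiable (frechet F j) x.

Fixpoint multilin_app (j : nat) : multilin j -> seq l2 -> R :=
  match j with
  | 0 => fun c _ => c
  | j'.+1 => fun (D : bop l2 (multilin j')) s =>
      @multilin_app j' (D (head 0 s)) (behead s)
  end.

(* Coordinates in the canonical basis, so that sqsum (nabla j F x) is the
   squared norm of the j-th derivative in the j-th tensor power of l^2. *)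
Definition nabla (j : nat) (F : l2 -> R) (x : l2) : j.-tuple nat -> R :=
  fun i => multilin_app (frechet F j x) (map delta i).
#[local] Arguments nabla : clear implicits.

Definition Cb_norm (k : nat) (F : l2 -> R) : \bar R :=
  ereal_sup [set r | exists j x, (1 <= j <= k)%N /\
    r = (sqsum (nabla j F x) `^ 2^-1)%E].

Definition Cb (k : nat) (F : l2 -> R) : Prop :=
  k_differentiable k F /\ (Cb_norm k F < +oo)%E.

End frechet_derivatives.
Arguments nabla {R} j F x.

Section fractional_integrals.
Context {R : realType}.

Local Notation l2 := (ell2 R nat).
Local Notation mu := (@lebesgue_measure R).

Definition Gamma (a : R) : R :=
  \int[mu]_(t in `]0, +oo[) (t `^ (a - 1) * expR (- t)).

(* I^alpha_{0+}, the identity for alpha = 0. *)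
Definition frac_left (alpha : R) (f : R -> R) (x : R) : R :=
  if alpha == 0 then f x else
  (Gamma alpha)^-1 * \int[mu]_(t in `[0, x]) (f t * (x - t) `^ (alpha - 1)).

(* I^alpha_{1-}, the identity for alpha = 0. *)
Definition frac_right (alpha : R) (f : R -> R) (x : R) : R :=
  if alpha == 0 then f x else
  (Gamma alpha)^-1 * \int[mu]_(t in `[x, 1]) (f t * (t - x) `^ (alpha - 1)).

(* L^2([0,1]), as functions whose values off [0,1] are irrelevant. *)
Definition square_integrable (f : R -> R) : Prop :=
  measurable_fun (`[0, 1] : set R) f /\
  mu.-integrable `[0, 1] (fun t => (f t ^+ 2)%:E).

Definition dotL2 (f g : R -> R) : R := \int[mu]_(t in `[0, 1]) (f t * g t).

Definition orthonormal_basis_L2 (e : nat -> R -> R) : Prop :=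
  [/\ forall n, square_integrable (e n),
      forall n l, dotL2 (e n) (e l) = (n == l)%:R &
      forall f, square_integrable f ->
        (fun N : nat => let r t := f t - \sum_(n < N) dotL2 f (e n) * e n t in
           dotL2 r r) @ \oo --> (0 : R)].

Definition is_frac_derivative (beta : R) (f g : R -> R) : Prop :=
  square_integrable g /\
  {ae mu, forall t, `[0, 1]%classic t -> f t = frac_left beta g t}.

(* Meaningful when f belongs to I^beta_{0+}(L^2); unique up to null sets. *)
Definition frac_derivative (beta : R) (f : R -> R) : R -> R :=
  get [set g | is_frac_derivative beta f g].

Definition J_iso (e : nat -> R -> R) (x : nat -> l2) (beta : R) (f : R -> R) :
    l2 :=
  limn (series (fun n => dotL2 (frac_derivative beta f) (e n) *: x n)).

Definition kfun (e : nat -> R -> R) (beta : R) (n : nat) : R -> R :=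
  frac_right (1 - beta) (e n).

Definition S_beta (e : nat -> R -> R) (x : nat -> l2) (beta : R) :
    ell2 R (nat * nat)%type :=
  opsum x (fun n l => dotL2 (kfun e beta n) (kfun e beta l)).

Definition step (m j : nat) : R -> R :=
  fun t => Num.sqrt m%:R * \1_(`[j%:R / m%:R, j.+1%:R / m%:R[%classic) t.

(* Orthogonal projection onto the span of the orthonormal family (step m j)_j. *)
Definition proj_step (m : nat) (f : R -> R) : R -> R :=
  fun t => \sum_(j < m) dotL2 f (step m j) * step m j t.

Definition S_dag (e : nat -> R -> R) (x : nat -> l2) (beta : R) (m : nat) :
    ell2 R (nat * nat)%type :=
  opsum x (fun n l => dotL2 (proj_step m (kfun e beta n))
                            (proj_step m (kfun e beta l))).

Definition gamma_dag (e : nat -> R -> R) (x : nat -> l2) (beta : R) (m : nat) :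
    R :=
  `|trace (S_dag e x beta m - S_beta e x beta)|.

Definition interpolation (m : nat) (b : R -> R) : R -> R :=
  fun t => \int[mu]_(s in `[0, t])
    (m%:R * \sum_(i < m) (b (i.+1%:R / m%:R) - b (i%:R / m%:R)) *
             \1_(`[i%:R / m%:R, i.+1%:R / m%:R[%classic) s).

End fractional_integrals.

Section probability_notions.
Context {R : realType}.

Definition brownian_motion d (Omega : measurableType d) (P : probability Omega R)
    (B : R -> Omega -> R) : Prop :=
  [/\ forall t, 0 <= t <= 1 -> measurable_fun setT (B t),
      {ae P, forall w, B 0 w = 0},
      forall (n : nat) (t : nat -> R) (A : nat -> set R),
        0 <= t 0%N -> (forall i, (i < n)%N -> t i <= t i.+1) -> t n <= 1 ->
        (forall i, measurable (A i)) ->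
        fine (P [set w | forall i, (i < n)%N -> A i (B (t i.+1) w - B (t i) w)]) =
        \prod_(i < n) fine (P [set w | A i (B (t i.+1) w - B (t i) w)]),
      forall s t, 0 <= s -> s < t -> t <= 1 -> forall A, measurable A ->
        P [set w | A (B t w - B s w)] = normal_prob 0 (Num.sqrt (t - s)) A &
      {ae P, forall w, {within (`[0, 1] : set R), continuous (fun t => B t w)}}].

(* Real and imaginary parts of the characteristic functional of N(0, S). *)
Definition centered_gaussian (m : probability (ell2 R nat) R)
    (S : ell2 R (nat * nat)%type) : Prop :=
  forall eta : ell2 R nat,
    \int[m]_u cos (dotp eta u) = expR (- 2^-1 * qform S eta) /\
    \int[m]_u sin (dotp eta u) = 0.

Definition is_law d (Omega : measurableType d) (P : probability Omega R)
    (Y : Omega -> ell2 R nat) (nu : probability (ell2 R nat) R) : Prop :=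
  forall A, measurable A -> nu A = P (Y @^-1` A).

End probability_notions.

(* Main.v *)
Require Import Defs.
From mathcomp Require Import all_boot all_order all_algebra.
From mathcomp Require Import all_classical all_reals all_analysis.
From mathcomp Require Import measurable_realfun.
From mathcomp Require Import ring lra.

Set Implicit Arguments.
Unset Strict Implicit.
Unset Printing Implicit Defensive.

Import Order.TTheory GRing.Theory Num.Theory.
Import numFieldNormedType.Exports.

Local Open Scope classical_set_scope.
Local Open Scope ring_scope.

(** Both laws are centered Gaussian: [nu] has covariance S_dag and [m_beta] has
    covariance S_beta, and T = S_beta - S_dag is nonnegative. Move from one law to
    the other along the Gaussian laws mu_t of covariance S_dag + t T, 0 <= t <= 1.
    By the heat equation, the derivative in t of the mu_t-mean of G is half the
    mu_t-mean of the contraction of the second derivative of G with T. Applied to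
    G = F and then to the successive contractions of the derivatives of F with
    T, T (x) T, and so on, Taylor's formula from t = 1 back to t = 0 is the
    announced expansion, the sign (t - 1)^j at t = 0 being absorbed by
    S_dag - S_beta = - T. The remainder involves the contraction of order 2 s + 2,
    which Cauchy-Schwarz bounds by the norm of F times the (s + 1)-st power of the
    Hilbert-Schmidt norm of T; the latter is at most the trace of T.

    That [nu] is Gaussian with the stated covariance rests on
    [J_iso_interpolation]: the coordinates of the interpolation are combinations
    of the increments of the Brownian path, because the fractional derivative of a
    piecewise linear function is I^(1-beta) of its derivative
    ([frac_derivative_primitive], [frac_derivative_unique], both from the beta
    integral [powker_conv]) and because I^(1-beta) can be moved onto the basis
    functions ([frac_left_right_dotL2]). That T is nonnegative is Bessel's
    inequality for the projection on step functions ([S_diff_psd]), and beta < 1/2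
    makes the kernel square integrable, hence the trace finite
    ([S_beta_trace_le]).

    The path is followed first on the first M coordinates, where T is a finite sum
    of squares w_r (x) w_r ([psd_factorization]). Adding the covariance t T to a
    law then amounts to averaging functions over sqrt(t) x w_r, with x standard
    normal, for each r in turn ([avg], [heat]); laws on l^2 only enter as
    functionals on Lipschitz functions ([expectation]). Two such functionals agree
    on functions of finitely many coordinates when they agree on cosines of linear
    forms ([expectation_unique]); this yields the semigroup property in t and
    identifies the law at t = 1. The derivative in t is read off from a Taylor
    expansion of one small step. It requires three derivatives beyond the current
    order, which F has except at the last order, where a bound on the increments
    from two derivatives suffices ([steps_first_order]); the integration in t is
    therefore done on right differences ([right_difference_taylor]), giving
    [covariance_path_expansion]. Letting M tend to infinity
    ([gaussian_comparison_expansion]) uses dominated convergence and the weak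
    convergence of the derivatives at the projected points ([contr_cvg]). *)

(** * Unordered sums, square-summable families and orthonormal expansions *)

Section unordered_sums.
Context {R : realType} {I : choiceType}.
Implicit Types (a b : I -> R) (s : seq I).

Lemma sum_le_subset a (t1 t2 : seq I) : (forall i, 0 <= a i) ->
  uniq t1 -> uniq t2 -> {subset t1 <= t2} ->
  \sum_(i <- t1) a i <= \sum_(i <- t2) a i.
Proof.
move=> a0 u1 u2 sub.
rewrite [leRHS](bigID [in t1])/= -[leLHS]addr0 lerD ?sumr_ge0//.
rewrite -[leRHS]big_filter.
have P : perm_eq t1 [seq i <- t2 | i \in t1].
  apply: uniq_perm => //; first exact: filter_uniq.
  move=> i; rewrite mem_filter; apply/idP/andP => [it1|[]//]; split=> //.
  exact: sub.
by rewrite (perm_big _ P).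
Qed.

Lemma esum_ge_sum a s : (forall i, 0 <= a i) -> uniq s ->
  ((\sum_(i <- s) a i)%:E <= \esum_(i in [set: I]) (a i)%:E)%E.
Proof.
move=> a0 us; apply: esum_ge; exists [set` s]; first by split.
by rewrite -fsbig_seq//= sumEFin.
Qed.

Lemma esum_le_sum a (M : R) :
  (forall s, uniq s -> \sum_(i <- s) a i <= M) ->
  (\esum_(i in [set: I]) (a i)%:E <= M%:E)%E.
Proof.
move=> h; apply: ge_ereal_sup => _ [A [finA _]] <-.
rewrite fsbig_finite//= sumEFin lee_fin; apply: h; exact: finmap.fset_uniq.
Qed.

Lemma sum_exhaustion_cvg (s : nat -> seq I) a (M : R) :
  (forall N, uniq (s N)) -> (forall N, {subset s N <= s N.+1}) ->
  (forall i, exists N, i \in s N) -> (forall i, 0 <= a i) ->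
  (forall t, uniq t -> \sum_(i <- t) a i <= M) ->
  \sum_(i <- s N) a i @[N --> \oo] --> fine (\esum_(i in [set: I]) (a i)%:E).
Proof.
move=> us ss es a0 aM.
have smono N K : (N <= K)%N -> {subset s N <= s K}.
  move=> /subnK <-; elim: (K - N)%N => [|k ih] //.
  by rewrite addSn => i /ih; exact: ss.
have esumM := esum_le_sum aM.
have fin : \esum_(i in [set: I]) (a i)%:E \is a fin_num.
  rewrite ge0_fin_numE; first exact: le_lt_trans esumM (ltry _).
  by apply: esum_ge0 => i _; rewrite lee_fin.
set L := fine _.
have LE : L%:E = \esum_(i in [set: I]) (a i)%:E by rewrite fineK.
have leL t : uniq t -> \sum_(i <- t) a i <= L.
  by move=> ut; rewrite -lee_fin LE; exact: esum_ge_sum.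
apply/cvgrPdist_le => e e0.
have [A [finA _] AL] : exists2 A : set I, fsets [set: I] A &
    (L%:E - e%:E <= \sum_(i \in A) (a i)%:E)%E.
  have : (L%:E - e%:E < \esum_(i in [set: I]) (a i)%:E)%E.
    by rewrite -LE -EFinB lte_fin ltrBlDr ltrDl.
  by rewrite /esum => /ereal_sup_gt[_ [A fA <-] /ltW]; exists A.
pose t : seq I := finmap.enum_fset (fset_set A).
have ut : uniq t by exact: finmap.fset_uniq.
move: AL; rewrite fsbig_finite//= sumEFin -EFinB lee_fin => AL.
have [N0 tN] : exists N, {subset t <= s N}.
  elim: (t) => [|i t' [N ih]]; first by exists 0%N.
  have [N' iN'] := es i; exists (maxn N N') => j; rewrite inE => /orP[/eqP ->|/ih].
    exact: (smono _ _ (leq_maxr _ _)).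
  exact: (smono _ _ (leq_maxl _ _)).
near=> N.
have : \sum_(i <- t) a i <= \sum_(i <- s N) a i.
  apply: sum_le_subset => // i /tN; apply: smono; near: N; exact: nbhs_infty_ge.
have := leL _ (us N) => h1 h2.
rewrite ger0_norm ?subr_ge0//; lra.
Unshelve. all: by end_near. Qed.

(** Absolute summability makes the positive and the negative parts converge
    separately, so every exhaustion computes the sum. *)
Lemma usum_cvg (s : nat -> seq I) a (M : R) :
  (forall N, uniq (s N)) -> (forall N, {subset s N <= s N.+1}) ->
  (forall i, exists N, i \in s N) ->
  (forall t, uniq t -> \sum_(i <- t) `|a i| <= M) ->
  \sum_(i <- s N) a i @[N --> \oo] --> usum a.
Proof.
move=> us ss es aM.
have -> : (fun N => \sum_(i <- s N) a i) =
    (fun N => \sum_(i <- s N) Num.max (a i) 0 - \sum_(i <- s N) Num.max (- a i) 0).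
  apply/funext => N; rewrite -sumrB; apply: eq_bigr => i _.
  by case: (ltrgt0P (a i)) => h; rewrite /Num.max; do 2 case: ltrP; lra.
have h b : (forall i, 0 <= b i <= `|a i|) ->
    \sum_(i <- s N) b i @[N --> \oo] --> fine (\esum_(i in [set: I]) (b i)%:E).
  move=> bh; apply: (@sum_exhaustion_cvg s b M) => //.
    by move=> i; have /andP[] := bh i.
  move=> t ut; apply: le_trans (aM _ ut); apply: ler_sum => i _.
  by have /andP[] := bh i.
apply: cvgB; apply: h => i; rewrite le_max lexx orbT/= ge_max normr_ge0 andbT.
  exact: ler_norm.
by rewrite -normrN ler_norm.
Qed.

End unordered_sums.

Section nat_sums.
Context {R : realType}.
Implicit Types (a b u v : nat -> R).

Lemma sum_uniq_le a (s : seq nat) : (forall i, 0 <= a i) -> uniq s ->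
  exists N, \sum_(i <- s) a i <= \sum_(i < N) a i.
Proof.
move=> a0 us; exists (\max_(i <- s) i.+1)%N.
rewrite -(big_mkord xpredT a).
apply: sum_le_subset => //; first exact: iota_uniq.
move=> i it.
rewrite mem_index_iota leq0n/=.
by rewrite (big_rem i it)/= leq_max leqnn.
Qed.

Lemma usum_nat_cvg a (M : R) : (forall N, \sum_(i < N) `|a i| <= M) ->
  \sum_(i < N) a i @[N --> \oo] --> usum a.
Proof.
move=> aM; under eq_fun do rewrite -(big_mkord xpredT a).
apply: (@usum_cvg _ _ (fun N => index_iota 0 N) a M).
- by move=> N; exact: iota_uniq.
- move=> N i; rewrite !mem_index_iota !leq0n/=; exact: ltnW.
- by move=> i; exists i.+1; rewrite mem_index_iota leq0n/=.
- move=> t /(@sum_uniq_le (fun i => `|a i|)) [//|N tN].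
  exact: le_trans tN (aM N).
Qed.

Lemma sqsum_nat_le u (M : R) : (forall N, \sum_(i < N) (u i) ^+ 2 <= M) ->
  (sqsum u <= M%:E)%E.
Proof.
move=> uM; apply: esum_le_sum => s us.
have [N sN] := sum_uniq_le (fun i => sqr_ge0 (u i)) us.
exact: le_trans sN (uM N).
Qed.

Lemma usum_finsupp a M : (forall i, (M <= i)%N -> a i = 0) ->
  usum a = \sum_(i < M) a i.
Proof.
move=> a0.
have h (b : nat -> R) : (forall i, (M <= i)%N -> b i = 0) -> forall N, (M <= N)%N ->
    \sum_(i < N) b i = \sum_(i < M) b i.
  move=> b0 N MN; rewrite -!(big_mkord xpredT b) (@big_cat_nat _ _ _ M)//=.
  rewrite [X in _ + X]big_nat_cond [X in _ + X]big1 ?addr0// => i.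
  by rewrite andbT => /andP[/b0].
have cv : \sum_(i < N) a i @[N --> \oo] --> usum a.
  apply: (@usum_nat_cvg _ (\sum_(i < M) `|a i|)) => N.
  have [NM|/ltnW MN] := leqP N M.
    rewrite -!(big_mkord xpredT (fun i => `|a i|)) [leRHS](@big_cat_nat _ _ _ N)//=.
    by rewrite lerDl sumr_ge0.
  by rewrite (h (fun i => `|a i|))// => i /a0 ->; rewrite normr0.
apply: (cvg_unique _ cv) => //.
apply: cvg_near_cst; near=> N; rewrite h//; near: N; exact: nbhs_infty_ge.
Unshelve. all: by end_near. Qed.

End nat_sums.

Lemma lipschitz_fun_continuous (R : realType) (V W : normedModType R)
    (f : V -> W) (K : R) :
  (forall x y, `|f x - f y| <= K * `|x - y|) -> continuous f.
Proof.
move=> fK x; apply/cvgrPdist_le => e e0.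
have K0 : 0 < `|K| + 1 by rewrite ltr_wpDl.
have /cvgrPdist_le/(_ _ (divr_gt0 e0 K0)) : (y @[y --> x] --> x) by exact: cvg_id.
apply: filterS => y xy; apply: le_trans (fK _ _) _.
apply: le_trans (_ : (`|K| + 1) * `|x - y| <= _).
  by rewrite ler_wpM2r// (le_trans (ler_norm K))// lerDl.
by rewrite mulrC -ler_pdivlMr.
Qed.

Lemma continuous_cvg_seq (T U : topologicalType) (f : T -> U) (u : nat -> T) (l : T) :
  continuous f -> u @ \oo --> l -> f (u n) @[n --> \oo] --> f l.
Proof. by move=> cf ul; exact: (cvg_comp _ _ ul (cf l)). Qed.

Lemma cvg_le_bound (R : realType) (u : nat -> R) (l M : R) N :
  u @ \oo --> l -> (forall n, (N <= n)%N -> u n <= M) -> l <= M.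
Proof.
move=> ul uM; rewrite -(cvg_lim _ ul)//; apply: limr_le; first exact: cvgP ul.
by exists N.
Qed.

Lemma cvg_ge_bound (R : realType) (u : nat -> R) (l M : R) N :
  u @ \oo --> l -> (forall n, (N <= n)%N -> M <= u n) -> M <= l.
Proof.
move=> ul uM; rewrite -(cvg_lim _ ul)//; apply: limr_ge; first exact: cvgP ul.
by exists N.
Qed.

Section ell2_theory.
Context {R : realType} {I : choiceType}.
Implicit Types (u v : ell2 R I).

Lemma ell2_normE u : `|u| = ell2_norm u. Proof. by []. Qed.

Lemma ell2_sum_le u (s : seq I) : uniq s ->
  \sum_(i <- s) u i ^+ 2 <= `|u| ^+ 2.
Proof.
move=> us; rewrite -lee_fin ell2_norm_sqr.
by apply: (@esum_ge_sum _ _ (fun i => u i ^+ 2)) => // i; exact: sqr_ge0.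
Qed.

Lemma ell2_le_normP u (M : R) : 0 <= M ->
  (forall s, uniq s -> \sum_(i <- s) u i ^+ 2 <= M ^+ 2) -> `|u| <= M.
Proof. by move=> M0 h; apply: ell2_le_norm => //; exact: esum_le_sum. Qed.

Lemma ell2_coord_le u i : `|u i| <= `|u|.
Proof.
rewrite -(@ler_pXn2r _ 2)// ?nnegrE//.
by have := @ell2_sum_le u [:: i] isT; rewrite big_seq1 real_normK// num_real.
Qed.

Lemma ell2_sumE (J : Type) (r : seq J) (P : pred J) (f : J -> ell2 R I) i :
  (\sum_(j <- r | P j) f j) i = \sum_(j <- r | P j) f j i.
Proof. by elim/big_rec2 : _ => // j y1 y2 _ <-. Qed.

Lemma ell2_coord_continuous i : continuous (fun u : ell2 R I => u i).
Proof.
apply: (@lipschitz_fun_continuous _ _ _ _ 1) => u v.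
by rewrite mul1r; exact: (ell2_coord_le (u - v)).
Qed.

Lemma ell2_cvg_coord (u : nat -> ell2 R I) (l : ell2 R I) i :
  u @ \oo --> l -> u n i @[n --> \oo] --> l i.
Proof. by move=> ul; exact: (continuous_cvg_seq (@ell2_coord_continuous i) ul). Qed.

(** Completeness: the coordinatewise limit is square summable and is the limit in
    norm, since every finite sum of squares passes to the limit. *)
Lemma ell2_cauchy_cvg (u : nat -> ell2 R I) :
  (forall e, 0 < e -> exists N, forall n k, (N <= n)%N -> (N <= k)%N ->
     `|u n - u k| <= e) ->
  exists l : ell2 R I, u @ \oo --> l.
Proof.
move=> uC.
have cvi i : cvg (u n i @[n --> \oo]).
  apply/cauchy_cvgP/cauchy_exP => e e0.
  have [N hN] := uC (e / 2) (divr_gt0 e0 (ltr0Sn _ 1)).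
  exists (u N i); exists N => //= n Nn; rewrite /ball/=.
  apply: le_lt_trans (ell2_coord_le (u N - u n) i) _.
  by apply: le_lt_trans (hN _ _ _ Nn) _ => //; lra.
pose l i := limn (fun n => u n i).
have lim_sum n s : \sum_(i <- s) (u n i - u k i) ^+ 2 @[k --> \oo] -->
    \sum_(i <- s) (u n i - l i) ^+ 2.
  apply: cvg_big => //; first exact: add_continuous.
  move=> i _; apply: (cvg_comp (fun k => u n i - u k i) (fun x => x ^+ 2)).
    by apply: cvgB; [exact: cvg_cst|exact: cvi].
  exact: exprn_continuous.
have bnd e : 0 < e -> exists N, forall n, (N <= n)%N -> forall s, uniq s ->
    \sum_(i <- s) (u n i - l i) ^+ 2 <= e ^+ 2.
  move=> e0; have [N hN] := uC e e0; exists N => n Nn s us.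
  apply: (@cvg_le_bound _ _ _ _ N (lim_sum n s)) => k Nk.
  apply: le_trans (ell2_sum_le (u n - u k) us) _.
  by rewrite ler_pXn2r ?nnegrE//; [exact: hN|exact: ltW].
have [N0 hN0] := bnd 1 ltr01.
have lS : l \in @sqsummable R I.
  have dS : (fun i => u N0 i - l i) \in @sqsummable R I.
    rewrite inE/=; apply: le_lt_trans (ltry (1 ^+ 2)).
    by apply: esum_le_sum; exact: hN0.
  have -> : l = ell2_val (u N0) - (fun i => u N0 i - l i).
    by apply/funext => i; rewrite -[RHS]/(u N0 i - (u N0 i - l i)) subKr.
  by apply: rpredB => //; exact: ell2P.
exists (Ell2 lS); apply/cvgrPdist_le => e e0.
have [N hN] := bnd e e0; exists N => //= n Nn.
rewrite distrC; apply: ell2_le_normP; first exact: ltW.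
by move=> s us; exact: hN.
Qed.

End ell2_theory.

Lemma nondecreasing_bounded_cauchy (R : realType) (f : nat -> R) (C : R) :
  {homo f : n k / (n <= k)%N >-> n <= k} -> (forall n, f n <= C) ->
  forall e, 0 < e -> exists N, forall n k, (N <= n)%N -> (N <= k)%N ->
    `|f n - f k| <= e.
Proof.
move=> fm fC e e0.
have /cvgrPdist_le/(_ _ (divr_gt0 e0 (ltr0Sn _ 1)))[N _ hN] : cvgn f.
  by apply: nondecreasing_is_cvgn => //; exists C => _ [n _ <-].
exists N => n k /hN/= hn /hN/= hk.
rewrite (_ : f n - f k = (limn f - f k) - (limn f - f n)); last by ring.
by rewrite (le_trans (ler_normB _ _))//; lra.
Qed.

Lemma sum_ord_from (V : nmodType) (f : nat -> V) (k n : nat) : (k <= n)%N ->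
  \sum_(i < n) (if (k <= i)%N then f i else 0) = \sum_(k <= i < n) f i.
Proof.
move=> kn; rewrite -big_mkcond -(big_mkord (fun i => (k <= i)%N) f) big_mkcond.
rewrite (@big_cat_nat _ _ _ k)//= big_nat_cond big1 ?add0r; last first.
  by move=> i; rewrite andbT ltnNge => /negbTE ->.
by apply: eq_big_nat => i /andP[-> _].
Qed.

Section orthonormal_families.
Context {R : realType}.
Local Notation l2 := (ell2 R nat).

Lemma dotp_cvg (u v : l2) : \sum_(p < N) u p * v p @[N --> \oo] --> dotp u v.
Proof.
apply: (@usum_nat_cvg _ _ (`|u| ^+ 2 + `|v| ^+ 2)) => N.
have h (w : l2) : \sum_(i < N) w i ^+ 2 <= `|w| ^+ 2.
  by rewrite -(big_mkord xpredT (fun i => w i ^+ 2)); apply: ell2_sum_le; exact: iota_uniq.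
apply: le_trans (lerD (h u) (h v)); rewrite -big_split/=; apply: ler_sum => i _.
rewrite normrM -[u i ^+ 2]real_normK ?num_real// -[v i ^+ 2]real_normK ?num_real//.
have := sqr_ge0 (`|u i| - `|v i|); have := normr_ge0 (u i); have := normr_ge0 (v i).
nra.
Qed.

Variable x : nat -> l2.
Hypothesis xx : forall n l, dotp (x n) (x l) = (n == l)%:R.

(** Half of the Parseval identity: the full sum over the coordinates equals the
    right-hand side, and the partial sums increase to it. *)
Lemma orthonormal_comb_le (c : nat -> R) (N K : nat) :
  \sum_(p < K) (\sum_(n < N) c n * x n p) ^+ 2 <= \sum_(n < N) c n ^+ 2.
Proof.
pose f K := \sum_(p < K) (\sum_(n < N) c n * x n p) ^+ 2.
have fE k : f k = \sum_(n < N) \sum_(l < N) c n * c l * \sum_(p < k) x n p * x l p.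
  under eq_bigr do under eq_bigr do rewrite mulr_sumr.
  under eq_bigr do rewrite exchange_big/=.
  rewrite exchange_big/=; apply: eq_bigr => p _.
  rewrite expr2 mulr_suml; apply: eq_bigr => n _.
  by rewrite mulr_sumr; apply: eq_bigr => l _; rewrite mulrACA.
have flim : f @ \oo --> \sum_(n < N) c n ^+ 2.
  rewrite (funext fE).
  rewrite (_ : \sum_(n < N) _ = \sum_(n < N) \sum_(l < N) c n * c l * dotp (x n) (x l)).
    apply: cvg_big => [|n _]; first exact: add_continuous.
    apply: cvg_big => [|l _]; first exact: add_continuous.
    by apply: cvgMr; exact: dotp_cvg.
  apply: eq_bigr => n _; rewrite (bigD1 n)//= xx eqxx mulr1 big1 ?addr0// => l ln.
  by rewrite xx eq_sym (_ : (_ == _) = false) ?mulr0//; exact/negbTE.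
apply: (@cvg_ge_bound _ f _ _ K flim) => n Kn.
rewrite /f -!(big_mkord xpredT (fun p => (\sum_(n < N) c n * x n p) ^+ 2)).
by rewrite [leRHS](@big_cat_nat _ _ _ K)//= lerDl sumr_ge0// => i _; exact: sqr_ge0.
Qed.

(** Blocks of the series are controlled by [orthonormal_comb_le]; completeness
    of l^2 does the rest. *)
Lemma series_orthonormal_cvg (c : nat -> R) (C : R) :
  (forall N, \sum_(n < N) c n ^+ 2 <= C) ->
  exists v : l2, series (fun n => c n *: x n) @ \oo --> v.
Proof.
move=> cC; apply: ell2_cauchy_cvg => e e0.
have [|N hN] := nondecreasing_bounded_cauchy _ cC (exprn_gt0 2 e0).
  by apply/nondecreasing_seqP => n; rewrite big_ord_recr/= lerDl sqr_ge0.
exists N => n k; wlog kn : n k / (k <= n)%N => [hw Nn Nk|Nn Nk].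
  by have [/hw|/ltnW/hw] := leqP k n; [exact|rewrite distrC; exact].
apply: ell2_le_normP => [|s us]; first exact: ltW.
have -> : series (fun n => c n *: x n) n - series (fun n => c n *: x n) k =
    \sum_(i < n) (if (k <= i)%N then c i else 0) *: x i.
  rewrite sub_series_geq// -sum_ord_from//; apply: eq_bigr => i _.
  by case: ifP; rewrite ?scale0r.
set v := \sum_(i < n) _.
have [K] := sum_uniq_le (fun i => sqr_ge0 (v i)) us; move=> /le_trans; apply.
have -> : \sum_(i < K) v i ^+ 2 =
    \sum_(p < K) (\sum_(i < n) (if (k <= i)%N then c i else 0) * x i p) ^+ 2.
  by apply: eq_bigr => p _; rewrite /v ell2_sumE.
apply: le_trans (orthonormal_comb_le (fun i => if (k <= i)%N then c i else 0) n K) _.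
apply: le_trans (hN n k Nn Nk); apply: le_trans (ler_norm _).
rewrite -!(big_mkord xpredT (fun i => c i ^+ 2)) [X in X - _](@big_cat_nat _ _ _ k)//=.
rewrite [X in X - _]addrC addrK.
rewrite -sum_ord_from// le_eqVlt; apply/orP; left; apply/eqP.
by apply: eq_bigr => i _; case: ifP; rewrite ?expr0n.
Qed.

(** [orthonormal_comb_le] in each of the two tensor factors. *)
Lemma tensor_comb_le (b : nat -> nat -> R) (N K : nat) :
  \sum_(p < K) \sum_(q < K) (\sum_(n < N) \sum_(l < N) b n l * (x n p * x l q)) ^+ 2 <=
  \sum_(n < N) \sum_(l < N) b n l ^+ 2.
Proof.
have h1 (p : nat) : \sum_(q < K) (\sum_(n < N) \sum_(l < N) b n l * (x n p * x l q)) ^+ 2 <=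
    \sum_(l < N) (\sum_(n < N) b n l * x n p) ^+ 2.
  apply: le_trans (orthonormal_comb_le (fun l => \sum_(n < N) b n l * x n p) N K).
  apply: ler_sum => q _; rewrite le_eqVlt; apply/orP; left; apply/eqP.
  congr (_ ^+ 2); rewrite exchange_big/=; apply: eq_bigr => l _.
  by rewrite mulr_suml; apply: eq_bigr => n _; rewrite mulrA.
apply: (@le_trans _ _ (\sum_(p < K) \sum_(l < N) (\sum_(n < N) b n l * x n p) ^+ 2)).
  by apply: ler_sum => p _; exact: h1.
rewrite exchange_big/= [leRHS]exchange_big/=; apply: ler_sum => l _.
exact: (orthonormal_comb_le (b^~ l)).
Qed.

(** The square partial sums defining [opsum] are Cauchy in Hilbert-Schmidt norm,
    by [tensor_comb_le] applied to the terms outside of a smaller square. *)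
Lemma opsum_cvg (a : nat -> nat -> R) (C : R) :
  (forall N, \sum_(n < N) \sum_(l < N) a n l ^+ 2 <= C) ->
  forall p q, \sum_(n < N) \sum_(l < N) a n l * (x n p * x l q) @[N --> \oo]
    --> opsum x a (p, q).
Proof.
move=> aC p q.
pose A (N : nat) : ell2 R (nat * nat)%type :=
  \sum_(n < N) \sum_(l < N) a n l *: tensor (x n) (x l).
have AE N r : A N r = \sum_(n < N) \sum_(l < N) a n l * (x n r.1 * x l r.2).
  by rewrite /A ell2_sumE; apply: eq_bigr => n _; rewrite ell2_sumE.
pose f N := \sum_(n < N) \sum_(l < N) a n l ^+ 2.
have fS k n : (k <= n)%N -> f k = \sum_(i < n) \sum_(j < n)
    (if (i < k)%N && (j < k)%N then a i j ^+ 2 else 0).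
  move=> kn; rewrite /f.
  rewrite (big_ord_widen_cond n xpredT (fun i => \sum_(l < k) a i l ^+ 2))//.
  rewrite big_mkcond/=; apply: eq_bigr => i _; case: ifP => ik; last by rewrite big1.
  by rewrite (big_ord_widen_cond n xpredT (fun j => a i j ^+ 2))// big_mkcond.
have fm : {homo f : n k / (n <= k)%N >-> n <= k}.
  move=> k n kn; rewrite (fS k n kn) (fS n n (leqnn n)).
  apply: ler_sum => i _; apply: ler_sum => j _; rewrite !ltn_ord/=.
  by case: ifP => // _; exact: sqr_ge0.
have [L AL] : exists L : ell2 R (nat * nat)%type, A @ \oo --> L.
  apply: ell2_cauchy_cvg => e e0.
  have [N hN] := nondecreasing_bounded_cauchy fm aC (exprn_gt0 2 e0).
  exists N => n k; wlog kn : n k / (k <= n)%N => [hw Nn Nk|Nn Nk].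
    by have [/hw|/ltnW/hw] := leqP k n; [exact|rewrite distrC; exact].
  apply: ell2_le_normP => [|s us]; first exact: ltW.
  pose b i j := if (i < k)%N && (j < k)%N then 0 else a i j.
  have bE r : (A n - A k) r = \sum_(i < n) \sum_(l < n) b i l * (x i r.1 * x l r.2).
    rewrite -[LHS]/(A n r - A k r) !AE.
    rewrite (big_ord_widen_cond n xpredT (fun i => \sum_(l < k) a i l * (x i r.1 * x l r.2)))//.
    rewrite [X in _ - X]big_mkcond/= -sumrB; apply: eq_bigr => i _; rewrite /b.
    case: ifP => ik; last by rewrite subr0.
    rewrite [X in _ - X](big_ord_widen_cond n xpredT (fun l => a i l * (x i r.1 * x l r.2)))//.
    rewrite [X in _ - X]big_mkcond/= -sumrB; apply: eq_bigr => l _.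
    by case: ifP; rewrite ?subrr ?mul0r ?subr0.
  apply: le_trans (_ : f n - f k <= _); last first.
    by apply: le_trans (hN n k Nn Nk); exact: ler_norm.
  pose K := (\max_(r <- s) maxn r.1.+1 r.2.+1)%N.
  apply: le_trans (_ : \sum_(p < K) \sum_(q < K)
    (\sum_(i < n) \sum_(l < n) b i l * (x i p * x l q)) ^+ 2 <= _); last first.
    apply: le_trans (tensor_comb_le b n K) _.
    rewrite (fS k n kn) (fS n n (leqnn n)) -sumrB; apply: ler_sum => i _.
    rewrite -sumrB; apply: ler_sum => j _; rewrite !ltn_ord/= /b.
    by case: ifP; rewrite ?expr0n ?subrr ?subr0.
  under eq_bigr do rewrite bE.
  pose g (r : nat * nat) := (\sum_(i < n) \sum_(l < n) b i l * (x i r.1 * x l r.2)) ^+ 2.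
  have -> : \sum_(p0 < K) \sum_(q0 < K)
      (\sum_(i < n) \sum_(l < n) b i l * (x i p0 * x l q0)) ^+ 2 =
      \sum_(r <- [seq (p, q) | p <- index_iota 0 K, q <- index_iota 0 K]) g r.
    rewrite big_allpairs big_mkord; apply: eq_bigr => i _.
    by rewrite big_mkord.
  apply: (@sum_le_subset _ _ g) => //.
  - by move=> r; exact: sqr_ge0.
  - by apply: allpairs_uniq => //; [exact: iota_uniq|exact: iota_uniq|move=> [? ?] [? ?]].
  - move=> [r1 r2] rs; apply/allpairsP; exists (r1, r2); rewrite !mem_index_iota/=.
    have : (maxn r1.+1 r2.+1 <= K)%N by rewrite /K (big_rem _ rs)/= leq_max leqnn.
    by rewrite geq_max => /andP[-> ->].
have -> : opsum x a = L by apply/cvg_lim.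
by rewrite -(funext (fun N => AE N (p, q))); exact: ell2_cvg_coord.
Qed.

End orthonormal_families.

(** * Gamma function and beta integral *)

Section affine_substitution.
Context {R : realType}.
Local Notation mu := (@lebesgue_measure R).
Local Open Scope ereal_scope.

(** Both sides are translation invariant measures agreeing on the half-open
    intervals. *)
Lemma ge0_integral_affine (c d : R) (f : R -> \bar R) : (0 < c)%R ->
  measurable_fun [set: R] f -> (forall x, 0 <= f x) ->
  \int[mu]_x f x = c%:E * \int[mu]_x f (c * x + d)%R.
Proof.
move=> c0 mf f0.
pose phi : measurableTypeR R -> measurableTypeR R := fun x => (c * x + d)%R.
have mphi : @measurable_fun _ _ (measurableTypeR R) (measurableTypeR R) setT phi.
  by apply: measurable_funD => //; exact: measurable_funM.
pose pf : {measure set (measurableTypeR R) -> \bar R} :=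
  measure_function_pushforward__canonical__measure_function_Measure mu mphi.
pose nc : {nonneg R} := NngNum (ltW c0).
pose nu := mscale nc pf.
have munu A : measurable A -> mu A = nu A.
  apply: lebesgue_measure_unique => _ [[a b]] _ <-/=.
  rewrite /nu/= /mscale/= /pushforward/=.
  have -> : phi @^-1` `]a, b]%classic = `]((a - d) / c)%R, ((b - d) / c)%R]%classic.
    apply/seteqP; split => x/=; rewrite !in_itv/= /phi.
      by rewrite ltr_pdivrMr// ler_pdivlMr// ltrBlDr lerBrDr mulrC.
    by rewrite ltr_pdivrMr// ler_pdivlMr// ltrBlDr lerBrDr mulrC.
  rewrite !lebesgue_measure_itv/= !lte_fin ltr_pM2r ?invr_gt0// ltrD2r.
  case: ifP => _; last by rewrite mule0.
  by rewrite -EFinD -EFinM; congr (_%:E); field; rewrite gt_eqF.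
transitivity (\int[nu]_x f x).
  by apply: eq_measure_integral => A mA _; exact: munu.
rewrite /nu ge0_integral_mscale//; congr (_ * _).
by rewrite (ge0_integral_pushforward mphi)// => x _; exact: f0.
Qed.

End affine_substitution.

Section power_kernel.
Context {R : realType}.
Local Notation mu := (@lebesgue_measure R).

(** The kernel of the fractional integrals without its factor 1 / Gamma a;
    vanishing off the positive half-line, it turns the integrals over [0, x] and
    [x, 1] into convolutions on the line. *)
Definition powker (a t : R) : R := if 0 < t then t `^ (a - 1) else 0.

Lemma powker_ge0 a t : 0 <= powker a t.
Proof. by rewrite /powker; case: ifP => // _; exact: powR_ge0. Qed.

Lemma measurable_powker a : measurable_fun [set: R] (powker a).
Proof.
by apply: measurable_fun_ifT => //; exact: measurable_fun_ltr.
Qed.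

Lemma measurable_EFin_powker a (A : set R) :
  measurable_fun A (fun t => (powker a t)%:E).
Proof. by apply/measurable_EFinP/measurable_funTS; exact: measurable_powker. Qed.

Lemma powkerM a c t : 0 < c -> powker a (c * t) = c `^ (a - 1) * powker a t.
Proof.
move=> c0; rewrite /powker pmulr_rgt0//; case: ifP => [t0|_]; last by rewrite mulr0.
by rewrite powRM// ltW.
Qed.

Lemma integral_powker_lty a : 0 < a ->
  (\int[mu]_(t in `]-oo, 1%R]) (powker a t)%:E < +oo)%E.
Proof.
move=> a0; apply: le_lt_trans (ltry a^-1).
pose D (n : nat) : set R := `[n.+1%:R^-1, 1]%classic.
have -> : (\int[mu]_(t in `]-oo, 1%R]) (powker a t)%:E =
    \int[mu]_(t in `]0%R, 1%R]) (powker a t)%:E)%E.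
  rewrite integral_mkcond [RHS]integral_mkcond; apply: eq_integral => t _.
  rewrite !patchE !mem_setE !in_itv/=; case: ifP => t1; rewrite ?andbF// ?andbT.
  by rewrite /powker; case: ifP.
have DU : `]0%R, 1%R]%classic = \bigcup_n D n.
  apply/seteqP; split => [t|t [n _]]; rewrite /D/= !in_itv/=.
    move=> /andP[t0 t1]; exists (Num.truncn t^-1) => //=; rewrite in_itv/= t1 andbT.
    rewrite invf_ple ?posrE//; apply/ltW; exact: truncnS_gt.
  by move=> /andP[tn ->]; rewrite andbT (lt_le_trans _ tn).
have -> : (\int[mu]_(t in `]0%R, 1%R]) (powker a t)%:E =
    limn (fun n => \int[mu]_(t in D n) (powker a t)%:E))%E.
  apply/esym/cvg_lim => //; rewrite DU.
  apply: ge0_nondecreasing_set_cvg_integral.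
  - move=> n k nk; apply/subsetPset => t; rewrite /D/= !in_itv/= => /andP[tn ->].
    by rewrite andbT (le_trans _ tn)// lef_pV2 ?posrE// ler_nat.
  - by move=> n; exact: measurable_itv.
  - by move=> n; exact: measurable_EFin_powker.
  - by move=> n t _; rewrite lee_fin powker_ge0.
apply: lime_le.
  apply: ereal_nondecreasing_is_cvgn => n k nk; apply: ge0_subset_integral => //.
  - exact: measurable_itv.
  - exact: measurable_itv.
  - exact: measurable_EFin_powker.
  - by move=> t _; rewrite lee_fin powker_ge0.
  - move=> t; rewrite /D/= !in_itv/= => /andP[tn ->].
    by rewrite andbT (le_trans _ tn)// lef_pV2 ?posrE// ler_nat.
apply: nearW => -[|n].
  rewrite /D invr1 set_itv1 integral_set1 lee_fin invr_ge0; exact: ltW.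
have n1 : n.+2%:R^-1 < 1 :> R by rewrite invf_lt1// ltr1n.
have n0 : 0 < n.+2%:R^-1 :> R by [].
rewrite (_ : (\int[mu]_(t in D n.+1) _ = \int[mu]_(t in D n.+1) (t `^ (a - 1))%:E)%E); last first.
  apply: eq_integral => t; rewrite inE /D/= in_itv/= => /andP[tn _].
  by rewrite /powker (lt_le_trans n0 tn).
have pos (t : R) : n.+2%:R^-1 <= t -> t \in `]0, +oo[ by move=> h; rewrite in_itv/= andbT (lt_le_trans n0 h).
have dp (t : R) : t \in `]0, +oo[ -> is_derive t 1 (fun t => a^-1 * t `^ a) (t `^ (a - 1)).
  move=> t0; apply: DeriveDef.
    by apply: derivableM; [exact: derivable_cst|exact: derivable_powR].
  rewrite deriveM//; [|exact: derivable_powR].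
  rewrite derive_cst scaler0 addr0 -derive1E powR_derive1//.
  by rewrite /GRing.scale/= mulrA mulVf ?mul1r// gt_eqF.
have cF (t : R) : t \in `]0, +oo[ -> {for t, continuous (fun t => a^-1 * t `^ a)}.
  by move=> /dp[tD _]; exact/differentiable_continuous/derivable1_diffP.
rewrite (@continuous_FTC2 _ _ (fun t => a^-1 * t `^ a))//.
- rewrite powR1 mulr1 -EFinB lee_fin gerBl mulr_ge0 ?powR_ge0// invr_ge0; exact: ltW.
- apply: derivable_within_continuous => t; rewrite in_itv/= => /andP[/pos t0 _].
  exact: derivable_powR.
- split.
  + by move=> t; rewrite in_itv/= => /andP[/ltW/pos/dp[]].
  + by apply: cvg_at_right_filter; apply/cF/pos.
  + by apply: cvg_at_left_filter; apply/cF/pos/ltW.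
- move=> t; rewrite in_itv/= => /andP[/ltW/pos/dp tD _].
  by rewrite derive1E; exact: derive_val.
Qed.

End power_kernel.

Section gamma_function.
Context {R : realType}.
Local Notation mu := (@lebesgue_measure R).
Local Open Scope ereal_scope.

Lemma integral_expRN : \int[mu]_(t in `[0%R, +oo[) (expR (- t))%:E = 1 :> \bar R.
Proof.
have dF (x : R) : is_derive x (1%R : R) (fun t => - expR (- t))%R (expR (- x)).
  have h1 : is_derive x (1%R : R) (fun t : R => - t)%R (- 1)%R by exact: is_deriveN.
  have h2 : is_derive x (1%R : R) (fun t : R => expR (- t)) (expR (- x) * - 1)%R.
    exact: (is_derive1_comp (f := expR) (g := fun t : R => (- t)%R)).
  by apply: (is_derive_eq (is_deriveN h2)); rewrite mulrN1 opprK.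
rewrite (@ge0_continuous_FTC2y _ _ (fun t => - expR (- t))%R 0%R 0%R).
- by rewrite oppr0 expR0 sub0e EFinN oppeK.
- by move=> x _; exact: expR_ge0.
- apply: continuous_subspaceT => x; apply: continuous_comp; first exact: opp_continuous.
  exact: continuous_expR.
- rewrite -[X in _ --> X]oppr0; apply: cvgN; exact: cvgr_expR.
- by move=> x _; have [] := dF x.
- have cF : {for 0%R, continuous (fun t : R => - expR (- t))%R}.
    by have [dF0 _] := dF 0%R; exact/differentiable_continuous/derivable1_diffP.
  exact: cvg_at_right_filter cF.
- by move=> x _; have dFx := dF x; rewrite derive1E; exact: derive_val.
Qed.

Lemma Gamma_integral (a : R) : 
  Gamma a = fine (\int[mu]_t (powker a t * expR (- t))%:E).
Proof.
rewrite /Gamma /Rintegral integral_mkcond; congr fine; apply: eq_integral => t _.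
rewrite patchE mem_setE in_itv/= andbT /powker; case: ifP => //.
by rewrite mul0r.
Qed.

Lemma Gamma_integrand_ge0 (a t : R) : 0 <= (powker a t * expR (- t))%:E.
Proof. by rewrite lee_fin mulr_ge0 ?powker_ge0 ?expR_ge0. Qed.

Lemma measurable_expRN (A : set R) : measurable_fun A (fun t : R => expR (- t)).
Proof. by apply: measurableT_comp. Qed.

Lemma measurable_EFin_expRN (A : set R) :
  measurable_fun A (fun t : R => (expR (- t))%:E).
Proof. by apply/measurable_EFinP; exact: measurable_expRN. Qed.

Lemma measurable_Gamma_integrand (a : R) (A : set R) :
  measurable_fun A (fun t => (powker a t * expR (- t))%:E).
Proof.
apply/measurable_EFinP; apply: measurable_funM; last exact: measurable_expRN.
by apply: measurable_funTS; exact: measurable_powker.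
Qed.

(** Near 0 the power is integrable because a > 0; beyond 1 it is at most 1
    because a <= 1, and the exponential takes over. *)
Lemma Gamma_integral_lty (a : R) : (0 < a <= 1)%R ->
  \int[mu]_t (powker a t * expR (- t))%:E < +oo.
Proof.
move=> /andP[a0 a1].
rewrite -(setUv `]-oo, 1%R]%classic) ge0_integral_setU//=; last 4 first.
- exact: measurableC.
- by rewrite setUv; exact: measurable_Gamma_integrand.
- by move=> t _; exact: Gamma_integrand_ge0.
- by apply/disj_setPCl.
rewrite setCitvl.
apply: lte_add_pinfty.
  apply: le_lt_trans (integral_powker_lty a0); apply: ge0_le_integral => //.
  - by move=> t _; exact: Gamma_integrand_ge0.
  - exact: measurable_Gamma_integrand.
  - exact: measurable_EFin_powker.
  move=> t _; rewrite lee_fin /powker; case: ifP => [t0|_]; last by rewrite mul0r.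
  by rewrite ler_piMr ?powR_ge0// -expR0 ler_expR oppr_le0 ltW.
apply: (@le_lt_trans _ _ (\int[mu]_(t in `]1%R, +oo[) (expR (- t))%:E)).
  apply: ge0_le_integral => //.
  - by move=> t _; exact: Gamma_integrand_ge0.
  - exact: measurable_Gamma_integrand.
  - exact: measurable_EFin_expRN.
  move=> t /=; rewrite in_itv/= andbT => t1.
  rewrite lee_fin /powker (lt_trans ltr01 t1) ler_piMl ?expR_ge0//.
  by rewrite -[leRHS](powRr0 t); apply: ler_powR; rewrite ?(ltW t1)// subr_le0.
apply: (@le_lt_trans _ _ (\int[mu]_(t in `[0%R, +oo[) (expR (- t))%:E)).
  apply: ge0_subset_integral => //.
  - exact: measurable_EFin_expRN.
  - by move=> t /=; rewrite !in_itv/= !andbT => /ltW; apply: le_trans.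
by rewrite integral_expRN ltry.
Qed.

Lemma Gamma_EFin (a : R) : (0 < a <= 1)%R ->
  \int[mu]_t (powker a t * expR (- t))%:E = (Gamma a)%:E.
Proof.
move=> a01; rewrite Gamma_integral fineK// ge0_fin_numE ?Gamma_integral_lty//.
by apply: integral_ge0 => t _; exact: Gamma_integrand_ge0.
Qed.

Lemma Gamma_gt0 (a : R) : (0 < a <= 1)%R -> (0 < Gamma a)%R.
Proof.
move=> a01; rewrite -lte_fin -Gamma_EFin//.
apply: (@lt_le_trans _ _ (\int[mu]_(t in `]0%R, 1%R]) (expR (- 1))%:E)).
  rewrite integral_cst//= lebesgue_measure_itv/= lte_fin ltr01 -EFinB subr0 mule1.
  by rewrite lte_fin expR_gt0.
apply: (@le_trans _ _ (\int[mu]_(t in `]0%R, 1%R]) (powker a t * expR (- t))%:E)).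
  apply: ge0_le_integral => //.
  - exact: measurable_Gamma_integrand.
  move=> t /=; rewrite in_itv/= => /andP[t0 t1]; rewrite lee_fin /powker t0.
  case/andP: a01 => a0 a1.
  have h : (1 <= t `^ (a - 1))%R.
    by rewrite -[leLHS](powRr0 t); apply: ger_powR; rewrite ?t0// subr_le0.
  by rewrite -[leLHS]mul1r ler_pM ?expR_ge0// ler_expR lerN2.
apply: ge0_subset_integral => //.
- exact: measurable_Gamma_integrand.
- by move=> t _; exact: Gamma_integrand_ge0.
Qed.

Lemma Gamma1 : Gamma (1 : R) = 1%R.
Proof.
apply: EFin_inj; rewrite -Gamma_EFin ?ltr01 ?lexx// -integral_expRN.
rewrite -integral_itv_obnd_cbnd; last exact: measurable_EFin_expRN.
rewrite [RHS]integral_mkcond; apply: eq_integral => t _.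
rewrite patchE mem_setE in_itv/= andbT /powker; case: ifP => _; rewrite ?mul0r//.
by rewrite subrr powRr0 mul1r.
Qed.

End gamma_function.

Section beta_integral.
Context {R : realType}.
Local Notation mu := (@lebesgue_measure R).
Local Notation mR := (measurableTypeR R).
Local Open Scope ereal_scope.

Lemma measurable_powker_sub (a : R) (f g : mR * mR -> mR) (A : set (mR * mR)) :
  measurable_fun A f -> measurable_fun A g ->
  measurable_fun A (fun p => powker a (f p - g p)).
Proof.
by move=> mf mg; apply: measurableT_comp; [exact: measurable_powker|exact: measurable_funB].
Qed.

Let conv_ge0 (a b w u : R) : 0 <= (powker a u * powker b (w - u))%:E.
Proof. by rewrite lee_fin mulr_ge0 ?powker_ge0. Qed.

Let measurable_conv (a b w : R) :
  measurable_fun [set: R] (fun u => (powker a u * powker b (w - u))%:E).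
Proof.
apply/measurable_EFinP; apply: measurable_funM; first exact: measurable_powker.
by apply: measurableT_comp; [exact: measurable_powker|exact: measurable_funB].
Qed.

(** The exponents a - 1 and - a of the two kernels and the one of the measure
    cancel under scaling by w. *)
Let conv_scale (a w : R) : (0 < w)%R ->
  \int[mu]_u (powker a u * powker (1 - a) (w - u))%:E =
  \int[mu]_u (powker a u * powker (1 - a) (1 - u))%:E.
Proof.
move=> w0; rewrite (@ge0_integral_affine _ w 0%R)//.
transitivity (w%:E * \int[mu]_u ((w^-1)%:E * (powker a u * powker (1 - a) (1 - u))%:E)).
  congr (_ * _); apply: eq_integral => u _; rewrite addr0 -EFinM; congr EFin.
  rewrite (_ : w - w * u = w * (1 - u))%R; last by ring.
  rewrite !powkerM// mulrACA; congr (_ * _)%R.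
  rewrite -powRD; last by apply/implyP => _; rewrite gt_eqF.
  by rewrite (_ : _ + _ = - 1)%R ?powR_inv1 ?ltW//; ring.
rewrite ge0_integralZl//; last by rewrite lee_fin invr_ge0 ltW.
  by rewrite muleA -EFinM mulfV ?mul1e// gt_eqF.
exact: measurable_conv.
Qed.

(** Euler's formula B(a, 1 - a) = Gamma a * Gamma (1 - a): substitute w = u + v in the
    double integral of the right-hand side; as the exponents add up to 1, the
    convolution of the two kernels does not depend on the scale w. *)
Lemma powker_conv (a w : R) : (0 < a < 1)%R ->
  \int[mu]_u (powker a u * powker (1 - a) (w - u))%:E =
  if (0 < w)%R then (Gamma a * Gamma (1 - a))%:E else 0.
Proof.
move=> /andP[a0 a1].
have a01 : (0 < a <= 1)%R by rewrite a0 ltW.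
have b01 : (0 < 1 - a <= 1)%R by rewrite subr_gt0 a1 gerBl ltW.
case: ltP => [w0|w0]; last first.
  apply: integral0_eq => u _; rewrite /powker.
  case: ifP => u0; last by rewrite mul0r.
  by rewrite (_ : (0 < w - u)%R = false) ?mulr0//; apply/negbTE; rewrite -leNgt; lra.
rewrite conv_scale//; set Beta := \int[mu]_u _.
have Beta0 : 0 <= Beta by apply: integral_ge0 => u _; exact: conv_ge0.
pose f (p : mR * mR) := (powker a p.1 * powker (1 - a) (p.2 - p.1) * expR (- p.2))%:E.
have mf : measurable_fun setT f.
  apply/measurable_EFinP; apply: measurable_funM.
    apply: measurable_funM; first by apply: measurableT_comp; [exact: measurable_powker|].
    exact: measurable_powker_sub.
  by apply: measurableT_comp => //; exact: measurableT_comp.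
have f0 p : 0 <= f p by rewrite lee_fin !mulr_ge0 ?powker_ge0 ?expR_ge0.
rewrite EFinM -(Gamma_EFin a01) -(Gamma_EFin b01).
transitivity (\int[mu]_u \int[mu]_w f (u, w)); last first.
  rewrite -ge0_integralZr//; first last.
  - by apply: integral_ge0 => t _; exact: Gamma_integrand_ge0.
  - by move=> t _; exact: Gamma_integrand_ge0.
  - exact: measurable_Gamma_integrand.
  apply: eq_integral => u _.
  rewrite [X in _ * X](@ge0_integral_affine _ 1%R (- u)%R)//; first last.
  - by move=> t; exact: Gamma_integrand_ge0.
  - exact: measurable_Gamma_integrand.
  rewrite mul1e -ge0_integralZl//; first last.
  - exact: Gamma_integrand_ge0.
  - by move=> t _; exact: Gamma_integrand_ge0.
  - apply: (@measurableT_comp _ _ _ _ _ _ (fun v : R => (powker (1 - a) v * expR (- v))%:E) _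
      (fun v : mR => 1 * v - u)%R).
      exact: measurable_Gamma_integrand.
    by apply: measurable_funD => //; exact: measurable_funM.
  apply: eq_integral => v _; rewrite /f/= -EFinM; congr EFin.
  rewrite mul1r -!mulrA; congr (_ * _)%R; rewrite mulrCA; congr (_ * _)%R.
  by rewrite -expRD; congr expR; ring.
rewrite (fubini_tonelli f)//.
transitivity (\int[mu]_(w in `]0%R, +oo[) (Beta * (expR (- w))%:E)).
  rewrite ge0_integralZl//; first last.
  - exact: measurable_EFin_expRN.
  rewrite integral_itv_obnd_cbnd; last exact: measurable_EFin_expRN.
  by rewrite integral_expRN mule1.
rewrite integral_mkcond; apply: eq_integral => v _.
rewrite patchE mem_setE in_itv/= andbT; case: ifPn => v0; last first.
  rewrite integral0_eq// => u _; rewrite /f/= /powker.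
  case: ifP => u0; last by rewrite !mul0r.
  rewrite (_ : (0 < v - u)%R = false) ?mulr0 ?mul0r//; apply/negbTE.
  by rewrite -leNgt subr_le0; move: v0; rewrite -leNgt => /le_trans; apply; exact: ltW.
rewrite /f/=; under eq_integral do rewrite EFinM.
rewrite ge0_integralZr; [by rewrite conv_scale| exact: measurableT | exact: measurable_conv | | ].
  by move=> u _; exact: conv_ge0.
by rewrite lee_fin expR_ge0.
Qed.

End beta_integral.

(** * Fractional integrals on the unit interval *)

Section square_integrable_functions.
Context {R : realType}.
Local Notation mu := (@lebesgue_measure R).
Local Notation I01 := (`[0%R, 1%R]%classic : set R).
Implicit Types f g : R -> R.

Lemma measurable_I01 : measurable (`[0%R, 1%R]%classic : set (measurableTypeR R)).
Proof. exact: measurable_itv. Qed.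
Hint Resolve measurable_I01 : core.

Lemma square_integrable_mul f g : square_integrable f -> square_integrable g ->
  mu.-integrable I01 (EFin \o (fun t => f t * g t)).
Proof.
move=> [mf if2] [mg ig2].
apply: (@le_integrable _ _ _ _ _ measurable_I01 _ (fun t => (f t ^+ 2)%:E + (g t ^+ 2)%:E)%E).
- by apply/measurable_EFinP; exact: measurable_funM.
- move=> t _ /=; rewrite lee_fin normrM [leRHS]ger0_norm ?addr_ge0 ?sqr_ge0//.
  rewrite -[f t ^+ 2]real_normK ?num_real// -[g t ^+ 2]real_normK ?num_real//.
  have := sqr_ge0 (`|f t| - `|g t|); have := normr_ge0 (f t); have := normr_ge0 (g t).
  nra.
- exact: integrableD.
Qed.

Lemma square_integrable_bounded f (C : R) : measurable_fun I01 f ->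
  (forall t, I01 t -> `|f t| <= C) -> square_integrable f.
Proof.
move=> mf fC; split => //.
apply: measurable_bounded_integrable => //.
- by rewrite /= lebesgue_measure_itv/= lte_fin ltr01 -EFinB ltry.
- exact: measurable_funX.
exists (C ^+ 2); split; first exact: num_real.
move=> y Cy t It /=; rewrite normrX (le_trans _ (ltW Cy))// lerXn2r// ?nnegrE//.
  exact: le_trans (fC t It).
exact: fC.
Qed.

Lemma square_integrable_cst (c : R) : square_integrable (cst c : R -> R).
Proof. by apply: (@square_integrable_bounded _ `|c|). Qed.

Lemma square_integrable_integrable f : square_integrable f ->
  mu.-integrable I01 (EFin \o f).
Proof.
move=> sf; have := square_integrable_mul sf (square_integrable_cst 1).
by apply: eq_integrable => // t _ /=; rewrite mulr1.
Qed.

Lemma square_integrableD f g : square_integrable f -> square_integrable g ->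
  square_integrable (fun t => f t + g t).
Proof.
move=> sf sg; have [mf if2] := sf; have [mg ig2] := sg; split.
  exact: measurable_funD.
have ifg := square_integrable_mul sf sg.
have := integrableD measurable_I01 (integrableD measurable_I01 if2 ig2)
  (integrableZl measurable_I01 2 ifg).
apply: eq_integrable => // t _ /=; congr EFin; ring.
Qed.

Lemma square_integrableZ (c : R) f : square_integrable f ->
  square_integrable (fun t => c * f t).
Proof.
move=> [mf if2]; split; first exact: measurable_funM.
have := integrableZl measurable_I01 (c ^+ 2) if2.
by apply: eq_integrable => // t _ /=; rewrite exprMn.
Qed.

Lemma square_integrable_sum (J : Type) (r : seq J) (F : J -> R -> R) :
  (forall j, square_integrable (F j)) ->
  square_integrable (fun t => \sum_(j <- r) F j t).
Proof.
move=> sF; elim: r => [|j r ih].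
  by under [X in square_integrable X]funext do rewrite big_nil; exact: square_integrable_cst.
by under [X in square_integrable X]funext do rewrite big_cons; exact: square_integrableD.
Qed.

Lemma dotL2C f g : dotL2 f g = dotL2 g f.
Proof. by apply: eq_Rintegral => t _; rewrite mulrC. Qed.

Lemma dotL2Dr f g h : square_integrable f -> square_integrable g ->
  square_integrable h -> dotL2 f (fun t => g t + h t) = dotL2 f g + dotL2 f h.
Proof.
move=> sf sg sh; rewrite /dotL2 -RintegralD//; [|exact: square_integrable_mul..].
by apply: eq_Rintegral => t _; rewrite mulrDr.
Qed.

Lemma dotL2Zr (c : R) f g : square_integrable f -> square_integrable g ->
  dotL2 f (fun t => c * g t) = c * dotL2 f g.
Proof.
move=> sf sg; rewrite /dotL2 -RintegralZl//; last exact: square_integrable_mul.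
by apply: eq_Rintegral => t _; rewrite mulrCA.
Qed.

Lemma dotL2_sumr (J : Type) (r : seq J) (c : J -> R) (F : J -> R -> R) f :
  square_integrable f -> (forall j, square_integrable (F j)) ->
  dotL2 f (fun t => \sum_(j <- r) c j * F j t) = \sum_(j <- r) c j * dotL2 f (F j).
Proof.
move=> sf sF; elim: r => [|j r ih].
  rewrite big_nil /dotL2 (@eq_Rintegral _ _ _ _ _ (cst 0)) ?Rintegral_cst ?mul0r//.
  by move=> t _; rewrite big_nil mulr0.
rewrite big_cons -ih -dotL2Zr// -dotL2Dr//.
- by apply: eq_Rintegral => t _; rewrite big_cons.
- exact: square_integrableZ.
- by apply: square_integrable_sum => i; exact: square_integrableZ.
Qed.

Lemma dotL2_ge0 f : 0 <= dotL2 f f.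
Proof. by apply: Rintegral_ge0 => t _; rewrite -expr2 sqr_ge0. Qed.

(** Expand the square norm of f minus its projection. *)
Lemma dotL2_bessel N (u : 'I_N -> R -> R) f :
  (forall i, square_integrable (u i)) ->
  (forall i j, dotL2 (u i) (u j) = (i == j)%:R) -> square_integrable f ->
  \sum_(i < N) dotL2 f (u i) ^+ 2 <= dotL2 f f.
Proof.
move=> su uu sf; pose g t := \sum_(i < N) dotL2 f (u i) * u i t.
have sg : square_integrable g.
  by apply: square_integrable_sum => i; exact: square_integrableZ.
have fg : dotL2 f g = \sum_(i < N) dotL2 f (u i) ^+ 2.
  by rewrite /g dotL2_sumr//; apply: eq_bigr => i _; rewrite expr2.
have gg : dotL2 g g = \sum_(i < N) dotL2 f (u i) ^+ 2.
  rewrite {2}/g dotL2_sumr//; apply: eq_bigr => i _.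
  rewrite expr2; congr (_ * _); rewrite dotL2C /g dotL2_sumr//.
  rewrite (bigD1 i)//= uu eqxx mulr1 big1 ?addr0// => j ji.
  by rewrite uu eq_sym (negbTE ji) mulr0.
have sng : square_integrable (fun t => -1 * g t) by exact: square_integrableZ.
have sfg : square_integrable (fun t => f t + -1 * g t) by exact: square_integrableD.
have := dotL2_ge0 (fun t => f t + -1 * g t).
rewrite dotL2Dr// dotL2Zr// !(dotL2C (fun t => f t + _)) !dotL2Dr// !dotL2Zr//.
by rewrite (dotL2C g f) fg gg; lra.
Qed.

End square_integrable_functions.
#[export] Hint Resolve measurable_I01 : core.

Lemma ae_imply d (T : measurableType d) (R : realType)
    (mu : {measure set T -> \bar R}) (P Q : T -> Prop) :
  (forall t, P t -> Q t) -> {ae mu, forall t, P t} -> {ae mu, forall t, Q t}.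
Proof.
by move=> h; apply: filterS => //; exact: (ae_filter_ringOfSetsType mu).
Qed.

Lemma ae_imply2 d (T : measurableType d) (R : realType)
    (mu : {measure set T -> \bar R}) (P Q S : T -> Prop) :
  (forall t, P t -> Q t -> S t) ->
  {ae mu, forall t, P t} -> {ae mu, forall t, Q t} -> {ae mu, forall t, S t}.
Proof.
by move=> h; apply: filterS2 => //; exact: (ae_filter_ringOfSetsType mu).
Qed.

Section fractional_kernels.
Context {R : realType}.
Local Notation mu := (@lebesgue_measure R).
Local Notation mR := (measurableTypeR R).
Local Notation I01 := (`[0%R, 1%R]%classic : set R).
Local Notation J01 := (\1_I01 : R -> R).
Implicit Types (d f g : R -> R) (a x t s : R).

Lemma indic_I01 t : J01 t = if (0 <= t <= 1) then 1 else 0.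
Proof. by rewrite indicE mem_setE in_itv/=; case: ifP. Qed.

Lemma measurable_indic_I01 (A : set R) : measurable_fun A J01.
Proof. by apply: measurable_funTS; exact: measurable_indic. Qed.

Lemma ge0_integral_reflect (c : R) (f : R -> \bar R) :
  measurable_fun [set: R] f -> (forall x, 0 <= f x)%E ->
  (\int[mu]_x f x = \int[mu]_x f (c - x)%R)%E.
Proof.
move=> mf f0; rewrite (@ge0_integral_affine _ 1 c f)// mul1e.
have mN : @measurable_fun _ _ mR mR setT (-%R : R -> R) by exact: oppr_measurable.
transitivity (\int[pushforward mu (-%R : mR -> mR)]_x f (1 * x + c)%R)%E.
  by apply: eq_measure_integral => A mA _; exact: (esym (lebesgue_measureN mA)).
rewrite (ge0_integral_pushforward mN)//.
- by apply: eq_integral => x _ /=; rewrite mul1r addrC.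
- apply: (measurableT_comp mf); apply: measurable_funD => //; exact: measurable_funM.
Qed.

Definition powker_mass a : \bar R := (\int[mu]_(t in `]-oo, 1%R]) (powker a t)%:E)%E.

Let measurable_JK a (f g : R -> R) : measurable_fun [set: R] f -> measurable_fun [set: R] g ->
  measurable_fun [set: R] (fun t => (J01 (f t) * powker a (g t))%:E).
Proof.
move=> mf mg; apply/measurable_EFinP; apply: measurable_funM.
  by apply: measurableT_comp => //; exact: measurable_indic_I01.
by apply: measurableT_comp => //; exact: measurable_powker.
Qed.

Let JK_ge0 a t s : (0 <= (J01 t * powker a s)%:E)%E.
Proof. by rewrite lee_fin mulr_ge0// powker_ge0. Qed.

Lemma powker_mass_right a s : 0 <= s ->
  (\int[mu]_t (J01 t * powker a (t - s))%:E <= powker_mass a)%E.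
Proof.
move=> s0.
rewrite (@ge0_integral_affine _ 1 s)//; last first.
  by apply: measurable_JK => //; exact: measurable_funB.
rewrite mul1e /powker_mass [leRHS]integral_mkcond; apply: ge0_le_integral => //.
- apply: measurable_JK; first by apply: measurable_funD => //; exact: measurable_funM.
  by apply: measurable_funB => //; apply: measurable_funD => //; exact: measurable_funM.
- by apply/(measurable_restrictT _ _).1 => //; exact: measurable_EFin_powker.
move=> t _; rewrite patchE mem_setE in_itv/= indic_I01 mul1r addrK.
case: ifP => [/andP[h1 h2]|_]; last first.
  by rewrite mul0r; case: ifP => // _; rewrite lee_fin powker_ge0.
by rewrite ifT ?mul1r//; lra.
Qed.

Lemma powker_mass_left a t : t <= 1 ->
  (\int[mu]_s (J01 s * powker a (t - s))%:E <= powker_mass a)%E.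
Proof.
move=> t1; rewrite (@ge0_integral_reflect t)//; last first.
  by apply: measurable_JK => //; exact: measurable_funB.
rewrite /powker_mass [leRHS]integral_mkcond; apply: ge0_le_integral => //.
- apply: measurable_JK; first exact: measurable_funB.
  by apply: measurable_funB => //; exact: measurable_funB.
- by apply/(measurable_restrictT _ _).1 => //; exact: measurable_EFin_powker.
move=> s _; rewrite patchE mem_setE in_itv/= indic_I01 subKr.
case: ifP => [/andP[h1 h2]|_]; last first.
  by rewrite mul0r; case: ifP => // _; rewrite lee_fin powker_ge0.
by rewrite ifT ?mul1r//; lra.
Qed.

(** The kernel of the fractional integrals as a function on the plane: Fubini
    applies to it since its integral over either variable is at most
    [powker_mass a]. *)
Definition frac_kernel a (p : mR * mR) : R :=
  J01 p.1 * J01 p.2 * powker a (p.1 - p.2).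

Lemma frac_kernel_ge0 a p : 0 <= frac_kernel a p.
Proof. by rewrite !mulr_ge0 ?powker_ge0// indic_I01; case: ifP. Qed.

Lemma measurable_frac_kernel a : measurable_fun [set: mR * mR] (frac_kernel a).
Proof.
apply: measurable_funM; last exact: measurable_powker_sub.
by apply: measurable_funM; apply: measurableT_comp => //; exact: measurable_indic_I01.
Qed.

Lemma powker_mass_fin_num a : 0 < a -> powker_mass a \is a fin_num.
Proof.
move=> a0; rewrite ge0_fin_numE ?integral_powker_lty//.
by apply: integral_ge0 => t _; rewrite lee_fin powker_ge0.
Qed.

Lemma integrable_indic_mul f : mu.-integrable I01 (EFin \o f) ->
  mu.-integrable [set: R] (EFin \o (fun t => J01 t * f t)).
Proof.
move=> /(integrable_mkcond _ measurable_I01).1; apply: eq_integrable => // t _ /=.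
by rewrite patchE indicE; case: ifP => _; rewrite ?mul1r ?mul0r.
Qed.

Let measurable_norm_G (H : mR * mR -> \bar R) : measurable_fun setT H ->
  measurable_fun [set: mR] (fun s => \int[mu]_t `|H (t, s)|)%E.
Proof.
move=> mH; apply: (measurable_fun_fubini_tonelli_G (abse \o H)).
  exact: measurableT_comp.
by move=> p; exact: abse_ge0.
Qed.

Let measurable_norm_F (H : mR * mR -> \bar R) : measurable_fun setT H ->
  measurable_fun [set: mR] (fun t => \int[mu]_s `|H (t, s)|)%E.
Proof.
move=> mH; apply: (measurable_fun_fubini_tonelli_F (abse \o H)).
  exact: measurableT_comp.
by move=> p; exact: abse_ge0.
Qed.

Lemma integrable_frac_kernel_snd a d : 0 < a -> mu.-integrable I01 (EFin \o d) ->
  (mu \x mu)%E.-integrable [set: mR * mR] (fun p => (frac_kernel a p * (J01 p.2 * d p.2))%:E).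
Proof.
move=> a0 /integrable_indic_mul id.
have md : measurable_fun [set: R] (fun t => J01 t * d t).
  by apply/measurable_EFinP; exact: measurable_int id.
apply/integrable21ltyP.
  apply/measurable_EFinP; apply: measurable_funM; first exact: measurable_frac_kernel.
  exact: (@measurableT_comp _ _ _ _ _ _ (fun t => J01 t * d t) _ (@snd mR mR)).
apply: (@le_lt_trans _ _ (\int[mu]_s (powker_mass a * `|(J01 s * d s)%:E|))%E).
  apply: ge0_le_integral => //.
  - by move=> s _; apply: integral_ge0.
  - apply: (measurable_norm_G (H := fun p => (frac_kernel a p * (J01 p.2 * d p.2))%:E)).
    apply/measurable_EFinP; apply: measurable_funM.
      exact: measurable_frac_kernel.
    exact: (@measurableT_comp _ _ _ _ _ _ (fun t => J01 t * d t) _ (@snd mR mR)).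
  - apply: measurable_funeM; apply: measurableT_comp => //; exact/measurable_EFinP.
  move=> s _.
  under eq_integral do rewrite /= normrM EFinM.
  rewrite ge0_integralZr//; last first.
    apply/measurable_EFinP; apply: measurableT_comp => //.
    exact: (measurableT_comp (measurable_frac_kernel a) (measurable_pair2 s)).
  rewrite /= indic_I01; case: ifP => s01; last by rewrite mul0r normr0 !mule0.
  rewrite lee_wpmul2r//; apply: le_trans (@powker_mass_right a s _); last by case/andP: s01.
  apply: ge0_le_integral => //.
  - apply/measurable_EFinP; apply: measurableT_comp => //.
    exact: (measurableT_comp (measurable_frac_kernel a) (measurable_pair2 s)).
  - apply/measurable_EFinP; apply: measurable_funM; first exact: measurable_indic_I01.
    apply: measurableT_comp; [exact: measurable_powker|exact: measurable_funB].
  move=> t _; rewrite ger0_norm ?frac_kernel_ge0// /frac_kernel/= (indic_I01 s) s01.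
  by rewrite mulr1.
rewrite -(fineK (powker_mass_fin_num a0)) integralZl//; last exact: integrable_abse.
rewrite fineK ?powker_mass_fin_num// lte_mul_pinfty ?powker_mass_fin_num//.
  by apply: integral_ge0 => t _; rewrite lee_fin powker_ge0.
by case/integrableP : id.
Qed.

Lemma integrable_frac_kernel_fst a d : 0 < a -> mu.-integrable I01 (EFin \o d) ->
  (mu \x mu)%E.-integrable [set: mR * mR] (fun p => (frac_kernel a p * (J01 p.1 * d p.1))%:E).
Proof.
move=> a0 /integrable_indic_mul id.
have md : measurable_fun [set: R] (fun t => J01 t * d t).
  by apply/measurable_EFinP; exact: measurable_int id.
apply/integrable12ltyP.
  apply/measurable_EFinP; apply: measurable_funM; first exact: measurable_frac_kernel.
  exact: (@measurableT_comp _ _ _ _ _ _ (fun t => J01 t * d t) _ (@fst mR mR)).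
apply: (@le_lt_trans _ _ (\int[mu]_t (powker_mass a * `|(J01 t * d t)%:E|))%E).
  apply: ge0_le_integral => //.
  - by move=> s _; apply: integral_ge0.
  - apply: (measurable_norm_F (H := fun p => (frac_kernel a p * (J01 p.1 * d p.1))%:E)).
    apply/measurable_EFinP; apply: measurable_funM.
      exact: measurable_frac_kernel.
    exact: (@measurableT_comp _ _ _ _ _ _ (fun t => J01 t * d t) _ (@fst mR mR)).
  - apply: measurable_funeM; apply: measurableT_comp => //; exact/measurable_EFinP.
  move=> t _.
  under eq_integral do rewrite /= normrM EFinM.
  rewrite ge0_integralZr//; last first.
    apply/measurable_EFinP; apply: measurableT_comp => //.
    exact: (measurableT_comp (measurable_frac_kernel a) (measurable_pair1 t)).
  rewrite /= indic_I01; case: ifP => t01; last by rewrite mul0r normr0 !mule0.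
  rewrite lee_wpmul2r//; apply: le_trans (@powker_mass_left a t _); last by case/andP: t01.
  apply: ge0_le_integral => //.
  - apply/measurable_EFinP; apply: measurableT_comp => //.
    exact: (measurableT_comp (measurable_frac_kernel a) (measurable_pair1 t)).
  - apply/measurable_EFinP; apply: measurable_funM; first exact: measurable_indic_I01.
    apply: measurableT_comp; [exact: measurable_powker|exact: measurable_funB].
  move=> s _; rewrite ger0_norm ?frac_kernel_ge0// /frac_kernel/= (indic_I01 t) t01.
  by rewrite mul1r.
rewrite -(fineK (powker_mass_fin_num a0)) integralZl//; last exact: integrable_abse.
rewrite fineK ?powker_mass_fin_num// lte_mul_pinfty ?powker_mass_fin_num//.
  by apply: integral_ge0 => t _; rewrite lee_fin powker_ge0.
by case/integrableP : id.
Qed.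

(** Semigroup law I^(1-a) I^a = I^1, up to the factor of [powker_conv]: exchange the
    integrals and integrate the product of the two kernels first. *)
Lemma frac_composition a d x : 0 < a < 1 -> mu.-integrable I01 (EFin \o d) ->
  0 <= x <= 1 ->
  (mu \x mu)%E.-integrable [set: mR * mR] (fun p =>
     (powker (1 - a) (x - p.1) * powker a (p.1 - p.2) * (J01 p.2 * d p.2))%:E) /\
  (\int[mu]_t \int[mu]_s
     (powker (1 - a) (x - t) * powker a (t - s) * (J01 s * d s))%:E =
   (Gamma a * Gamma (1 - a))%:E * \int[mu]_(s in `[0%R, x]) (d s)%:E)%E.
Proof.
move=> a01 id x01; have /andP[a0 a1] := a01.
have ijd := integrable_indic_mul id.
have md : measurable_fun [set: R] (fun t => J01 t * d t).
  by apply/measurable_EFinP; exact: measurable_int ijd.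
pose c := Gamma a * Gamma (1 - a).
pose h (p : mR * mR) := powker (1 - a) (x - p.1) * powker a (p.1 - p.2).
have h0 p : 0 <= h p by rewrite mulr_ge0 ?powker_ge0.
have mh : measurable_fun [set: mR * mR] h.
  apply: measurable_funM; last exact: measurable_powker_sub.
  exact: (@measurable_powker_sub R (1 - a) (cst x) (@fst mR mR)).
have hE s : (\int[mu]_t (h (t, s))%:E = (if (s < x)%R then c%:E else 0))%E.
  rewrite (@ge0_integral_affine _ 1 s)//; first last.
  - by move=> t; rewrite lee_fin h0.
  - by apply/measurable_EFinP; exact: (measurableT_comp mh (measurable_pair2 s)).
  rewrite mul1e -subr_gt0 -(powker_conv (x - s) a01); apply: eq_integral => u _.
  by rewrite /h/= mul1r addrK mulrC; congr (_ * powker _ _)%:E; ring.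
pose H (p : mR * mR) := (h p * (J01 p.2 * d p.2))%:E.
have mH : measurable_fun setT H.
  apply/measurable_EFinP; apply: measurable_funM => //.
  exact: (@measurableT_comp _ _ _ _ _ _ (fun t => J01 t * d t) _ (@snd mR mR)).
have c0 : 0 <= c by rewrite mulr_ge0// ltW// Gamma_gt0//; lra.
have iH : (mu \x mu)%E.-integrable setT H.
  apply/integrable21ltyP => //.
  apply: (@le_lt_trans _ _ (\int[mu]_s (c%:E * `|(J01 s * d s)%:E|))%E).
    apply: ge0_le_integral => //.
    - by move=> s _; apply: integral_ge0.
    - exact: measurable_norm_G.
    - apply: measurable_funeM; apply: measurableT_comp => //; exact/measurable_EFinP.
    move=> s _; rewrite /H; under eq_integral do rewrite /= normrM EFinM (ger0_norm (h0 _)).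
    rewrite ge0_integralZr//; last 2 first.
    - by apply/measurable_EFinP; exact: (measurableT_comp mh (measurable_pair2 s)).
    - by move=> t _; rewrite lee_fin h0.
    by rewrite hE/= lee_wpmul2r//; case: ifP.
  rewrite integralZl//; last exact: integrable_abse.
  by rewrite lte_mul_pinfty//; case/integrableP : ijd.
split; first exact: iH.
transitivity (\int[mu]_t \int[mu]_s H (t, s))%E; first by [].
rewrite (Fubini iH) /H.
transitivity (\int[mu]_s (c%:E * ((fun s => (d s)%:E) \_ `[0%R, x[) s))%E.
  apply: eq_integral => s _; under eq_integral do rewrite EFinM.
  rewrite /= integralZr//; last first.
    apply/integrableP; split.
      by apply/measurable_EFinP; exact: (measurableT_comp mh (measurable_pair2 s)).
    under eq_integral do rewrite /= (ger0_norm (h0 _)).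
    by rewrite hE; case: ifP => _; rewrite ltry.
  rewrite hE patchE mem_setE in_itv/= indic_I01.
  case: (ltP s x) => sx; last by rewrite mul0e andbF mule0.
  rewrite andbT; case: (leP 0 s) => s0/=; last by rewrite mul0r.
  by rewrite ifT ?mul1r//; case/andP: x01 => _; apply: le_trans; exact: ltW.
have id' : mu.-integrable `[0%R, x[ (EFin \o d).
  apply: (integrableS measurable_I01) => // s /=; rewrite !in_itv/= => /andP[-> sx]/=.
  by case/andP: x01 => _; apply: le_trans; exact: ltW.
have id2 : mu.-integrable [set: R] ((fun s => (d s)%:E) \_ `[0%R, x[).
  have mx : measurable (`[0%R, x[%classic : set mR) by exact: measurable_itv.
  by move: (id') => /(integrable_mkcond _ mx).1; exact: eq_integrable.
rewrite (integralZl measurableT id2).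
rewrite -integral_mkcond integral_itv_bndo_bndc//.
exact: measurable_int id'.
Qed.

Lemma indic_I01_idem s : J01 s * J01 s = J01 s.
Proof. by rewrite indic_I01; case: ifP; rewrite ?mulr0 ?mulr1. Qed.

Lemma frac_leftE a f x : a != 0 -> measurable_fun I01 f -> 0 <= x <= 1 ->
  frac_left a f x =
  (Gamma a)^-1 * \int[mu]_s (powker a (x - s) * (J01 s * f s)).
Proof.
move=> a0 mf /andP[x0 x1]; rewrite /frac_left (negbTE a0); congr (_ * fine _).
rewrite -integral_itv_bndo_bndc; last first.
  apply/measurable_EFinP; apply: measurable_funM.
    apply: measurable_funS mf => // s /=; rewrite !in_itv/= => /andP[-> sx]/=.
    by apply: le_trans x1; exact: ltW.
  apply: (@measurableT_comp _ _ _ _ _ _ (fun t : R => t `^ (a - 1))) => //.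
  exact: measurable_funB.
rewrite [LHS]integral_mkcond; apply: eq_integral => s _.
rewrite patchE mem_setE in_itv/= indic_I01 /powker subr_gt0.
case: (ltP s x) => sx; last by rewrite andbF mul0r.
rewrite andbT; case: (leP 0 s) => s0/=; last by rewrite mul0r mulr0.
by rewrite ifT ?mul1r 1?mulrC//; apply: le_trans x1; exact: ltW.
Qed.

Lemma frac_rightE a f x : a != 0 -> measurable_fun I01 f -> 0 <= x <= 1 ->
  frac_right a f x =
  (Gamma a)^-1 * \int[mu]_s (powker a (s - x) * (J01 s * f s)).
Proof.
move=> a0 mf /andP[x0 x1]; rewrite /frac_right (negbTE a0); congr (_ * fine _).
rewrite -integral_itv_obnd_cbnd; last first.
  apply/measurable_EFinP; apply: measurable_funM.
    apply: measurable_funS mf => // s /=; rewrite !in_itv/= => /andP[xs ->].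
    by rewrite andbT; apply: (le_trans x0); exact: ltW.
  apply: (@measurableT_comp _ _ _ _ _ _ (fun t : R => t `^ (a - 1))) => //.
  exact: measurable_funB.
rewrite [LHS]integral_mkcond; apply: eq_integral => s _.
rewrite patchE mem_setE in_itv/= indic_I01 /powker subr_gt0.
case: (ltP x s) => sx/=; last by rewrite mul0r.
rewrite (ltW (le_lt_trans x0 sx))/=; case: (leP s 1) => s1/=; last by rewrite mul0r mulr0.
by rewrite mul1r mulrC.
Qed.

(** Lebesgue differentiation of the primitive of d extended by zero. *)
Lemma ae_eq0_primitive d : mu.-integrable I01 (EFin \o d) ->
  (forall x, 0 <= x <= 1 -> (\int[mu]_(s in `[0%R, x]) (d s)%:E = 0)%E) ->
  {ae mu, forall t, I01 t -> d t = 0}.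
Proof.
move=> id d0; pose D := d \_ I01.
have iD : mu.-integrable [set: R] (EFin \o D).
  by rewrite /D -restrict_EFin; exact/(integrable_mkcond _ measurable_I01).1.
have F0 x : \int[mu]_(t in `]-oo, x]) D t = 0.
  rewrite /Rintegral integral_mkcond.
  have [x0|x0] := ltP x 0.
    rewrite integral0_eq// => t _; rewrite patchE mem_setE in_itv/=; case: ifP => // tx.
    by rewrite /D patchE mem_setE in_itv/= leNgt (le_lt_trans tx x0).
  have h : (0 <= Num.min x 1 <= 1)%R by rewrite le_min x0 ler01 ge_min lexx orbT.
  rewrite -[RHS](congr1 fine (d0 _ h)); congr fine; rewrite [RHS]integral_mkcond.
  apply: eq_integral => t _; rewrite !patchE !mem_setE !in_itv/= le_min.
  case: ifP => tx; rewrite /= ?andbF// /D patchE mem_setE in_itv/=.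
  by case: ifP.
have := @FTC1Ny R D.
have lD : locally_integrable [set: R] D by exact: integrable_locally.
have iDy y : mu.-integrable `]-oo, y] (EFin \o D).
  by apply: integrableS iD => //; exact: measurable_itv.
move=> /(_ iDy lD).
apply: ae_imply => t + It => -[_].
rewrite (_ : (fun x => _) = cst 0); last by apply/funext => x; rewrite F0.
by rewrite derive1_cst /D patchE mem_set.
Qed.

Lemma ae_integrable_powker a d : 0 < a -> mu.-integrable I01 (EFin \o d) ->
  {ae mu, forall t, I01 t ->
    mu.-integrable [set: R] (fun s => (powker a (t - s) * (J01 s * d s))%:E)}.
Proof.
move=> a0 id; have := ae_integrable1 (integrable_frac_kernel_snd a0 id).
apply: ae_imply => t + It; apply: eq_integrable => // s _ /=.
rewrite /frac_kernel/= (indic_I01 t).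
have -> : 0 <= t <= 1 by move: It; rewrite /= in_itv.
by rewrite mul1r [J01 s * _]mulrC -!mulrA; congr (_ * _)%:E; rewrite mulrA indic_I01_idem.
Qed.

(** Injectivity of I^beta: apply I^(1-beta) to the difference of two candidates. *)
Lemma frac_derivative_unique a f g1 g2 : 0 <= a < 1 ->
  is_frac_derivative a f g1 -> is_frac_derivative a f g2 ->
  {ae mu, forall t, I01 t -> g1 t = g2 t}.
Proof.
move=> /andP[a0 a1] [s1 e1] [s2 e2].
have [az|az] := eqVneq a 0.
  apply: ae_imply2 e1 e2 => t + + It => /(_ It) + /(_ It).
  by rewrite /frac_left az eqxx => ->.
have {}a0 : 0 < a by rewrite lt0r az.
pose d t := g1 t + -1 * g2 t.
have sd : square_integrable d by apply: square_integrableD => //; exact: square_integrableZ.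
have i1 := square_integrable_integrable s1.
have i2 := square_integrable_integrable s2.
have id := square_integrable_integrable sd.
have a01 : 0 < a < 1 by rewrite a0.
suff : {ae mu, forall t, I01 t -> d t = 0}.
  by apply: ae_imply => t dt It; have := dt It; rewrite /d; lra.
have inner0 : {ae mu, forall t, I01 t ->
    mu.-integrable [set: R] (fun s => (powker a (t - s) * (J01 s * d s))%:E) /\
    (\int[mu]_s (powker a (t - s) * (J01 s * d s))%:E = 0)%E}.
  have k1 := ae_integrable_powker a0 i1; have k2 := ae_integrable_powker a0 i2.
  have e12 : {ae mu, forall t, I01 t -> frac_left a g1 t = frac_left a g2 t}.
    by apply: ae_imply2 e1 e2 => t h1 h2 It; rewrite -h1// h2.
  pose Q (g : R -> R) t := I01 t ->
    mu.-integrable [set: R] (fun s => (powker a (t - s) * (J01 s * g s))%:E).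
  have k12 : {ae mu, forall t, Q g1 t /\ Q g2 t}.
    by apply: ae_imply2 k1 k2 => t p q; split.
  apply: ae_imply2 e12 k12 => t e12 [h1 h2] It.
  have t01 : 0 <= t <= 1 by move: It; rewrite /= in_itv.
  have := e12 It; rewrite !frac_leftE// ?gt_eqF//; [|by case: s2|by case: s1].
  have G0 : Gamma a != 0 by rewrite gt_eqF// Gamma_gt0// a0 ltW.
  move/(mulfI (invr_neq0 G0)) => e0.
  have dE s : powker a (t - s) * (J01 s * d s) =
      powker a (t - s) * (J01 s * g1 s) - powker a (t - s) * (J01 s * g2 s).
    by rewrite /d; ring.
  split.
    have := integrableB measurableT (h1 It) (h2 It).
    by apply: eq_integrable => // s _; rewrite dE.
  under eq_integral do rewrite dE EFinB.
  rewrite integralB//; [|exact: h1|exact: h2].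
  have f1 := integrable_fin_num measurableT (h1 It).
  have f2 := integrable_fin_num measurableT (h2 It).
  by move: e0; rewrite /Rintegral -(fineK f1) -(fineK f2) /= => ->; rewrite -EFinB subrr.
apply: ae_eq0_primitive => // x x01.
have [iH comp] := frac_composition a01 id x01.
have c0 : 0 < Gamma a * Gamma (1 - a) by rewrite mulr_gt0// Gamma_gt0//; lra.
have idx : (\int[mu]_(s in `[0%R, x]) (d s)%:E)%E \is a fin_num.
  apply: integrable_fin_num; first exact: measurable_itv.
  apply: (integrableS measurable_I01 (measurable_itv _) _ id) => s /=.
  by rewrite !in_itv/= => /andP[-> /le_trans]; apply; case/andP: x01.
move: comp; rewrite -(fineK idx) -EFinM.
have -> : (\int[mu]_t \int[mu]_s
    (powker (1 - a) (x - t) * powker a (t - s) * (J01 s * d s))%:E = 0)%E.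
  rewrite -(integral0 mu [set: R]); apply: ae_eq_integral => //.
    exact: measurable_fubini_F iH.
  apply: ae_imply inner0 => t t0 _; rewrite /fubini_F/=.
  have [t01|t01] := boolP (0 <= t <= 1).
    have It : I01 t by rewrite /= in_itv.
    have [it e0] := t0 It.
    by under eq_integral do rewrite -mulrA EFinM; rewrite integralZl// e0 mule0.
  rewrite integral0_eq// => s _; rewrite indic_I01; congr EFin.
  case: ifP => [/andP[s0 s1']|_]; last by rewrite mul0r mulr0.
  move: t01; rewrite negb_and -!ltNge /powker => /orP[t0'|t1].
    by rewrite [X in _ * X * _]ifF ?mulr0 ?mul0r//; apply/negbTE; rewrite -leNgt; lra.
  by rewrite ifF ?mul0r//; apply/negbTE; rewrite -leNgt; lra.
move=> [] /esym/eqP; rewrite mulf_eq0 gt_eqF//= => /eqP ->.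
by [].
Qed.

Lemma integrable_powker_bounded b g (G : R) t : 0 < b -> measurable_fun [set: R] g ->
  (forall s, `|g s| <= G) -> t <= 1 ->
  mu.-integrable [set: R] (fun s => (powker b (t - s) * (J01 s * g s))%:E) /\
  `|\int[mu]_s (powker b (t - s) * (J01 s * g s))| <= fine (powker_mass b) * G.
Proof.
move=> b0 mg gG t1.
have mJg : measurable_fun [set: R] (fun s => J01 s * g s).
  by apply: measurable_funM => //; exact: measurable_indic_I01.
have mK : measurable_fun [set: R] (fun s => powker b (t - s)).
  by apply: measurableT_comp; [exact: measurable_powker|exact: measurable_funB].
have mH : measurable_fun [set: R] (fun s => (powker b (t - s) * (J01 s * g s))%:E).
  by apply/measurable_EFinP; exact: measurable_funM.
have G0 : 0 <= G by exact: le_trans (normr_ge0 (g 0)) (gG 0).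
have le : (\int[mu]_s `|(powker b (t - s) * (J01 s * g s))%:E| <= powker_mass b * G%:E)%E.
  apply: (@le_trans _ _ (\int[mu]_s ((J01 s * powker b (t - s))%:E * G%:E)))%E.
    apply: ge0_le_integral => //.
    - by apply: measurableT_comp.
    - apply/measurable_EFinP; apply: measurable_funM => //.
      by apply: measurable_funM => //; exact: measurable_indic_I01.
    move=> s _ /=; rewrite lee_fin !normrM (ger0_norm (powker_ge0 _ _)).
    rewrite mulrCA mulrA indic_I01; case: ifP => _; last by rewrite normr0 !mul0r.
    by rewrite normr1 !mul1r ler_wpM2l ?powker_ge0.
  rewrite ge0_integralZr//; last by apply: measurable_JK => //; exact: measurable_funB.
  by rewrite lee_wpmul2r//; exact: powker_mass_left.
have iH : mu.-integrable [set: R] (fun s => (powker b (t - s) * (J01 s * g s))%:E).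
  apply/integrableP; split => //; apply: le_lt_trans le _.
  by rewrite -(fineK (powker_mass_fin_num b0)) -EFinM ltry.
split => //.
rewrite -lee_fin EFinM fineK ?powker_mass_fin_num//; apply: le_trans le.
rewrite EFin_normr_Rintegral//; exact: le_abse_integral.
Qed.

Lemma square_integrable_frac_left b g (G : R) : 0 < b -> measurable_fun [set: R] g ->
  (forall s, `|g s| <= G) -> square_integrable (frac_left b g).
Proof.
move=> b0 mg gG.
have mgI : measurable_fun I01 g by exact: measurable_funTS.
have ig : mu.-integrable I01 (EFin \o g).
  exact: square_integrable_integrable (square_integrable_bounded mgI (fun t _ => gG t)).
have E t : I01 t -> frac_left b g t = (Gamma b)^-1 *
    fine (fubini_F mu (fun p => (frac_kernel b p * (J01 p.2 * g p.2))%:E) t).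
  move=> It; have t01 : 0 <= t <= 1 by move: It; rewrite /= in_itv.
  rewrite frac_leftE// ?gt_eqF//; congr (_ * fine _); apply: eq_integral => s _.
  rewrite /frac_kernel/= (indic_I01 t) t01 mul1r.
  by rewrite [J01 s * powker _ _]mulrC -!mulrA; congr (_ * _)%:E; rewrite mulrA indic_I01_idem.
apply: (@square_integrable_bounded _ _ ((`|Gamma b|)^-1 * (fine (powker_mass b) * G))).
  apply: (eq_measurable_fun (fun t => (Gamma b)^-1 *
    fine (fubini_F mu (fun p => (frac_kernel b p * (J01 p.2 * g p.2))%:E) t))).
    by move=> t /set_mem It; rewrite E.
  apply: measurable_funTS; apply: measurable_funM => //; apply: measurableT_comp => //.
  exact: measurable_fubini_F (integrable_frac_kernel_snd b0 ig).
move=> t It; have /andP[t0 t1] : 0 <= t <= 1 by move: It; rewrite /= in_itv.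
rewrite frac_leftE// ?gt_eqF ?t0// normrM normfV ler_wpM2l ?invr_ge0//.
by have [_] := integrable_powker_bounded b0 mg gG t1.
Qed.

(** By [frac_composition], I^a (I^(1-a) g) is the primitive of g. Together with
    [frac_derivative_unique] this computes the fractional derivative of a
    piecewise linear function. *)
Lemma frac_derivative_primitive a f g (G : R) : 0 <= a < 1 ->
  measurable_fun [set: R] g -> (forall s, `|g s| <= G) ->
  (forall x, 0 <= x <= 1 -> f x = \int[mu]_(s in `[0%R, x]) g s) ->
  is_frac_derivative a f (frac_left (1 - a) g).
Proof.
move=> /andP[a0 a1] mg gG fE.
have b0 : 0 < 1 - a by lra.
have sh := square_integrable_frac_left b0 mg gG.
split=> //; apply: aeW => x Ix; have x01 : 0 <= x <= 1 by move: Ix; rewrite /= in_itv.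
rewrite fE//; have [az|az] := eqVneq a 0.
  rewrite az /frac_left eqxx subr0 oner_eq0 Gamma1 invr1 mul1r.
  by apply: eq_Rintegral => s _; rewrite subrr powRr0 mulr1.
have {}a0 : 0 < a by rewrite lt0r az.
have ig : mu.-integrable I01 (EFin \o g).
  apply: square_integrable_integrable; apply: (@square_integrable_bounded _ _ G) => //.
  exact: measurable_funTS.
have b01 : 0 < 1 - a < 1 by lra.
move: (frac_composition b01 ig x01); rewrite subKr => -[iH comp].
rewrite frac_leftE//; last by case: sh.
have G1 : Gamma (1 - a) != 0 by rewrite gt_eqF// Gamma_gt0//; lra.
have Ga : Gamma a != 0 by rewrite gt_eqF// Gamma_gt0//; lra.
have igx : (\int[mu]_(s in `[0%R, x]) (g s)%:E)%E \is a fin_num.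
  apply: integrable_fin_num; first exact: measurable_itv.
  apply: (integrableS measurable_I01 (measurable_itv _) _ ig) => s /=.
  by rewrite !in_itv/= => /andP[-> /le_trans]; apply; case/andP: x01.
have -> : \int[mu]_t (powker a (x - t) * (J01 t * frac_left (1 - a) g t)) =
    (Gamma (1 - a))^-1 * (Gamma (1 - a) * Gamma a * \int[mu]_(s in `[0%R, x]) g s).
  rewrite (_ : Gamma (1 - a) * Gamma a * _ = fine ((Gamma (1 - a) * Gamma a)%:E *
    \int[mu]_(s in `[0%R, x]) (g s)%:E)%E); last first.
    by rewrite /Rintegral -{2}(fineK igx) -EFinM.
  rewrite -comp.
  have HE t : (\int[mu]_s (powker a (x - t) * powker (1 - a) (t - s) * (J01 s * g s))%:E =
      (Gamma (1 - a) * (powker a (x - t) * (J01 t * frac_left (1 - a) g t)))%:E)%E.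
    have [t01|t01] := boolP (0 <= t <= 1).
      have /andP[_ t1] := t01.
      have [it _] := integrable_powker_bounded b0 mg gG t1.
      under eq_integral do rewrite -mulrA EFinM.
      rewrite integralZl// frac_leftE ?gt_eqF//; last exact: measurable_funTS.
      rewrite (indic_I01 t) t01 mul1r mulrCA [X in _ * X]mulrA divff// mul1r EFinM.
      by rewrite /Rintegral fineK//; exact: integrable_fin_num it.
    rewrite (indic_I01 t) (negbTE t01) !(mul0r, mulr0).
    rewrite integral0_eq// => s _; rewrite indic_I01; congr EFin.
    case: ifP => [/andP[s0 s1]|_]; last by rewrite mul0r mulr0.
    move: t01; rewrite negb_and -!ltNge {2}/powker => /orP[t0'|t1].
      by rewrite [X in _ * X * _]ifF ?mulr0 ?mul0r//; apply/negbTE; rewrite -leNgt; lra.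
    by rewrite /powker ifF ?mul0r//; apply/negbTE; rewrite -leNgt; lra.
  have iF : mu.-integrable [set: R] (fun t =>
      (Gamma (1 - a) * (powker a (x - t) * (J01 t * frac_left (1 - a) g t)))%:E).
    have := integrable_fubini_F iH; apply: eq_integrable => // t _.
    by rewrite -HE.
  under [in RHS]eq_integral do rewrite HE.
  rewrite -/(Rintegral mu setT (fun t =>
    Gamma (1 - a) * (powker a (x - t) * (J01 t * frac_left (1 - a) g t)))) -RintegralZl//.
  by apply: eq_Rintegral => t _; rewrite mulKf.
by rewrite -!mulrA mulKf// mulKf.
Qed.

Lemma dotL2_le f g : square_integrable f -> square_integrable g ->
  `|dotL2 f g| <= dotL2 f f + dotL2 g g.
Proof.
move=> sf sg.
have h (c : R) : 0 <= dotL2 f f + 2 * c * dotL2 f g + c ^+ 2 * dotL2 g g.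
  have sc : square_integrable (fun t => c * g t) by exact: square_integrableZ.
  have sfc : square_integrable (fun t => f t + c * g t) by exact: square_integrableD.
  have := dotL2_ge0 (fun t => f t + c * g t).
  rewrite dotL2Dr// dotL2Zr// !(dotL2C (fun t => f t + _)) !dotL2Dr// !dotL2Zr//.
  by rewrite (dotL2C g f) => /le_trans; apply; rewrite le_eqVlt; apply/orP; left; apply/eqP; ring.
have := h 1; have := h (-1); have := dotL2_ge0 f; have := dotL2_ge0 g.
by rewrite ler_norml => h1 h2 h3 h4; apply/andP; split; lra.
Qed.

(** The square of the kernel of order b is the kernel of order 2 b - 1, which is
    integrable at 0 because b > 1/2. *)
Lemma square_integrable_powker b s : 2^-1 < b -> 0 <= s ->
  square_integrable (fun t => powker b (t - s)) /\
  dotL2 (fun t => powker b (t - s)) (fun t => powker b (t - s)) <=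
    fine (powker_mass (2 * b - 1)).
Proof.
move=> b2 s0; have c0 : 0 < 2 * b - 1 by lra.
have mK c : measurable_fun [set: R] (fun t => powker c (t - s)).
  by apply: measurableT_comp; [exact: measurable_powker|exact: measurable_funB].
have sqr t : powker b t * powker b t = powker (2 * b - 1) t.
  rewrite /powker; case: ifP => [t0|_]; last by rewrite mul0r.
  rewrite -powRD; last by apply/implyP => _; rewrite gt_eqF.
  by congr (_ `^ _); ring.
have le : (\int[mu]_(t in I01) (powker b (t - s) * powker b (t - s))%:E <=
    powker_mass (2 * b - 1))%E.
  apply: le_trans (@powker_mass_right (2 * b - 1) s s0).
  rewrite integral_mkcond le_eqVlt; apply/orP; left; apply/eqP.
  apply: eq_integral => t _; rewrite patchE indicE.
  by case: ifP => _; rewrite ?mul0r// mul1r sqr.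
have le' : (\int[mu]_(t in I01) (powker b (t - s) * powker b (t - s))%:E < +oo)%E.
  by apply: le_lt_trans le _; rewrite -(fineK (powker_mass_fin_num c0)) ltry.
have ge : (0 <= \int[mu]_(t in I01) (powker b (t - s) * powker b (t - s))%:E)%E.
  by apply: integral_ge0 => t _; rewrite lee_fin mulr_ge0 ?powker_ge0.
split; first split.
- exact: measurable_funTS.
- apply/integrableP; split.
    by apply/measurable_EFinP; apply: measurable_funX; exact: (measurable_funTS (mK b)).
  under eq_integral do rewrite gee0_abs ?lee_fin ?sqr_ge0// expr2.
  exact: le'.
- by rewrite -lee_fin (fineK (powker_mass_fin_num c0)) /dotL2 /Rintegral fineK ?ge0_fin_numE.
Qed.

Lemma frac_right_dotL2 b f s : 0 < b -> square_integrable f -> 0 <= s <= 1 ->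
  frac_right b f s = (Gamma b)^-1 * dotL2 (fun t => powker b (t - s)) f.
Proof.
move=> b0 [mf _] s01; rewrite frac_rightE ?gt_eqF//; congr (_ * _).
rewrite /dotL2 [RHS]Rintegral_mkcond; apply: eq_Rintegral => t _.
by rewrite patchE indicE; case: ifP => _; rewrite ?mul1r// mul0r mulr0.
Qed.

Lemma measurable_frac_right b f : 0 < b -> square_integrable f ->
  measurable_fun I01 (frac_right b f).
Proof.
move=> b0 sf; have iff := square_integrable_integrable sf.
apply: (eq_measurable_fun (fun s => (Gamma b)^-1 *
    fine (fubini_G mu (fun p => (frac_kernel b p * (J01 p.1 * f p.1))%:E) s))).
  move=> s /set_mem Is; have s01 : 0 <= s <= 1 by move: Is; rewrite /= in_itv.
  rewrite frac_rightE ?gt_eqF//; last by case: sf.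
  congr (_ * fine _); apply: eq_integral => t _.
  rewrite /frac_kernel/= (indic_I01 s) s01 mulr1.
  by rewrite [J01 t * powker _ _]mulrC -!mulrA; congr (_ * _)%:E; rewrite mulrA indic_I01_idem.
apply: measurable_funTS; apply: measurable_funM => //; apply: measurableT_comp => //.
exact: measurable_fubini_G (integrable_frac_kernel_fst b0 iff).
Qed.

Lemma square_integrable_frac_right b f : 2^-1 < b -> square_integrable f ->
  square_integrable (frac_right b f).
Proof.
move=> b2 sf; have b0 : 0 < b by lra.
apply: (@square_integrable_bounded _ _
  (`|(Gamma b)^-1| * (fine (powker_mass (2 * b - 1)) + dotL2 f f))).
  exact: measurable_frac_right.
move=> s Is; have s01 : 0 <= s <= 1 by move: Is; rewrite /= in_itv.
have /andP[s0 _] := s01; have [sk dk] := square_integrable_powker b2 s0.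
rewrite frac_right_dotL2// normrM ler_wpM2l//.
by apply: le_trans (dotL2_le sk sf) _; rewrite lerD2r.
Qed.

(** Fractional integration by parts: Fubini for the kernel of the two operators. *)
Lemma frac_left_right_dotL2 b g (G : R) f : 2^-1 < b <= 1 -> measurable_fun [set: R] g ->
  (forall s, `|g s| <= G) -> square_integrable f ->
  dotL2 (frac_left b g) f = dotL2 g (frac_right b f).
Proof.
move=> /andP[b2 b1] mg gG sf; have b0 : 0 < b by lra.
have G0 : Gamma b != 0 by rewrite gt_eqF// Gamma_gt0// b0.
have iff := square_integrable_integrable sf.
have mf : measurable_fun [set: R] (fun t => J01 t * f t).
  by apply/measurable_EFinP; exact: measurable_int (integrable_indic_mul iff).
pose H (p : mR * mR) := (frac_kernel b p * (J01 p.1 * f p.1) * g p.2)%:E.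
have iH : (mu \x mu)%E.-integrable [set: mR * mR] H.
  have := integrableZl measurableT G (integrable_frac_kernel_fst b0 iff).
  apply: le_integrable => //.
    apply/measurable_EFinP; apply: measurable_funM; last first.
      exact: (@measurableT_comp _ _ _ _ _ _ g _ (@snd mR mR)).
    apply: measurable_funM; first exact: measurable_frac_kernel.
    exact: (@measurableT_comp _ _ _ _ _ _ (fun t => J01 t * f t) _ (@fst mR mR)).
  move=> p _ /=; rewrite lee_fin [leLHS]normrM [leRHS]normrM mulrC ler_wpM2r//.
  by rewrite (le_trans (gG _))// ler_norm.
have mgI : measurable_fun I01 g by exact: measurable_funTS.
have E1 t : (\int[mu]_s H (t, s) = ((fun t => Gamma b * (frac_left b g t * f t)) \_ I01 t)%:E)%E.
  rewrite /H /frac_kernel patchE mem_setE in_itv/= (indic_I01 t).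
  case: ifPn => t01; last by rewrite integral0_eq// => s _; rewrite !mul0r.
  have /andP[_ t1] := t01.
  have [it _] := integrable_powker_bounded b0 mg gG t1.
  transitivity (\int[mu]_s ((f t)%:E * (powker b (t - s) * (J01 s * g s))%:E))%E.
    by apply: eq_integral => s _; rewrite -EFinM; congr EFin; ring.
  rewrite integralZl//.
  have := integrable_fin_num measurableT it; rewrite frac_leftE ?gt_eqF// /Rintegral.
  by move=> fin; rewrite -(fineK fin) -EFinM; congr EFin => /=; field.
have E2 s : (\int[mu]_t H (t, s) = ((fun s => Gamma b * (g s * frac_right b f s)) \_ I01 s)%:E)%E.
  rewrite /H /frac_kernel patchE mem_setE in_itv/= (indic_I01 s).
  case: ifPn => s01; last by rewrite integral0_eq// => t _; rewrite mulr0 !mul0r.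
  have /andP[s0 _] := s01; have [sk _] := square_integrable_powker b2 s0.
  have it := integrable_indic_mul (square_integrable_mul sk sf).
  transitivity (\int[mu]_t ((g s)%:E * (J01 t * (powker b (t - s) * f t))%:E))%E.
    apply: eq_integral => t _; rewrite -EFinM; congr EFin.
    by rewrite -{3}(indic_I01_idem t); ring.
  rewrite integralZl//.
  have := integrable_fin_num measurableT it; rewrite frac_rightE ?gt_eqF//; last by case: sf.
  rewrite /Rintegral => fin; rewrite -{1}(fineK fin) -EFinM; congr EFin => /=.
  have -> : (\int[mu]_t (J01 t * (powker b (t - s) * f t))%:E =
      \int[mu]_t (powker b (t - s) * (J01 t * f t))%:E)%E.
    by apply: eq_integral => t _; congr EFin; ring.
  by field.
have sg : square_integrable g by exact: (@square_integrable_bounded _ _ G).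
have sl := square_integrable_frac_left b0 mg gG.
have sr := square_integrable_frac_right b2 sf.
apply: (mulfI G0); rewrite -!RintegralZl//; [|exact: square_integrable_mul..].
rewrite Rintegral_mkcond [RHS]Rintegral_mkcond /Rintegral; congr fine.
by under eq_integral do rewrite -E1; rewrite (Fubini iH); apply: eq_integral => s _; rewrite E2.
Qed.

End fractional_kernels.

(** * The two covariances and the interpolation in coordinates *)

Section cauchy_schwarz.
Context {R : realType}.

(** Evaluate at c = - b / d when d > 0; otherwise some c makes the polynomial
    equal to -1 unless d = b = 0. *)
Lemma quadratic_ge0_discr (a b d : R) :
  (forall c, 0 <= a + 2 * c * b + c ^+ 2 * d) -> b ^+ 2 <= a * d.
Proof.
move=> h; have := h 0; rewrite mulr0 mul0r expr0n mul0r !addr0 => a0.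
have [d0|d0|d0] := ltgtP d 0.
- have dn : d != 0 by rewrite lt_eqF.
  have := h ((- 2 * b + Num.sqrt (4 * b ^+ 2 - 4 * a * d + - 4 * d)) / (2 * d)).
  set s := Num.sqrt _; have s2 : s ^+ 2 = 4 * b ^+ 2 - 4 * a * d + - 4 * d.
    by rewrite /s sqr_sqrtr//; have := sqr_ge0 b; nra.
  have -> : a + 2 * ((- 2 * b + s) / (2 * d)) * b + ((- 2 * b + s) / (2 * d)) ^+ 2 * d =
      a + (s ^+ 2 - 4 * b ^+ 2) / (4 * d) by field.
  by rewrite s2 (_ : a + _ = -1); [lra|field].
- have dn : d != 0 by rewrite gt_eqF.
  have := h (- b / d).
  have -> : a + 2 * (- b / d) * b + (- b / d) ^+ 2 * d = (a * d - b ^+ 2) / d by field.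
  by rewrite pmulr_lge0 ?invr_gt0// subr_ge0.
- rewrite d0 mulr0; have [->|b0] := eqVneq b 0; first by rewrite expr0n.
  have := h (- (a + 1) / (2 * b)); rewrite d0 mulr0 addr0.
  by rewrite (_ : a + _ = -1); [lra|field].
Qed.

Lemma dotL2_quadratic_ge0 (f g : R -> R) (c : R) :
  square_integrable f -> square_integrable g ->
  0 <= dotL2 f f + 2 * c * dotL2 f g + c ^+ 2 * dotL2 g g.
Proof.
move=> sf sg.
have sc : square_integrable (fun t => c * g t) by exact: square_integrableZ.
have sfc : square_integrable (fun t => f t + c * g t) by exact: square_integrableD.
have := dotL2_ge0 (fun t => f t + c * g t).
rewrite dotL2Dr// dotL2Zr// !(dotL2C (fun t => f t + _)) !dotL2Dr// !dotL2Zr//.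
by rewrite (dotL2C g f) => /le_trans; apply; rewrite le_eqVlt; apply/orP; left; apply/eqP; ring.
Qed.

Lemma dotL2_cauchy_schwarz (f g : R -> R) :
  square_integrable f -> square_integrable g ->
  dotL2 f g ^+ 2 <= dotL2 f f * dotL2 g g.
Proof.
by move=> sf sg; apply: quadratic_ge0_discr => c; exact: dotL2_quadratic_ge0.
Qed.

(** The square norm of \sum_n y n *: k n minus that of its projection on the steps,
    written in coordinates. *)
Lemma gram_projection (a d : nat -> nat -> R) (y : nat -> R) (N m : nat) :
  \sum_(n < N) \sum_(l < N) a n l * (y n * y l) -
    \sum_(i < m) (\sum_(n < N) y n * d n i) ^+ 2 =
  \sum_(n < N) \sum_(l < N) (a n l - \sum_(i < m) d n i * d l i) * (y n * y l).
Proof.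
under [X in _ - X]eq_bigr do rewrite expr2 mulr_suml.
rewrite [X in _ - X]exchange_big/= -sumrB; apply: eq_bigr => n _.
under [X in _ - X]eq_bigr do rewrite mulr_sumr.
rewrite [X in _ - X]exchange_big/= -sumrB; apply: eq_bigr => l _.
rewrite mulrBl; congr (_ - _).
by rewrite mulr_suml; apply: eq_bigr => i _; rewrite mulrACA mulrC.
Qed.

End cauchy_schwarz.

Section interpolation_coordinates.
Context {R : realType}.
Local Notation mu := (@lebesgue_measure R).
Local Notation I01 := (`[0%R, 1%R]%classic : set R).
Local Notation l2 := (ell2 R nat).
Variables (beta : R) (beta_ge0 : 0 <= beta) (beta_lt : beta < 2^-1).
Variables (m : nat) (m_ge1 : (1 <= m)%N).
Variables (x : nat -> l2) (e : nat -> R -> R).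
Hypothesis xx : forall n l, dotp (x n) (x l) = (n == l)%:R.
Hypothesis se : forall n, square_integrable (e n).
Hypothesis ee : forall n l, dotL2 (e n) (e l) = (n == l)%:R.

Let m0 : 0 < m%:R :> R. Proof. by rewrite ltr0n. Qed.

Lemma measurable_step j (A : set R) : measurable_fun A (@step R m j).
Proof. by apply: measurable_funTS; apply: measurable_funM => //; exact: measurable_indic. Qed.

Lemma step_le j t : `|step m j t| <= Num.sqrt m%:R :> R.
Proof.
rewrite /step normrM ger0_norm ?sqrtr_ge0// ler_piMr ?sqrtr_ge0//.
by rewrite indicE; case: (_ \in _); rewrite ?normr1 ?normr0.
Qed.

Lemma square_integrable_step j : square_integrable (@step R m j).
Proof.
apply: square_integrable_bounded; first exact: measurable_step.
by move=> t _; exact: step_le.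
Qed.

Lemma dotL2_step (i j : 'I_m) : dotL2 (@step R m i) (step m j) = (i == j)%:R.
Proof.
pose A (l : nat) : set R := `[l%:R / m%:R, l.+1%:R / m%:R[%classic.
have stepE (l : nat) (t : R) : step m l t = Num.sqrt m%:R * \1_(A l) t by [].
have sq : Num.sqrt m%:R * Num.sqrt m%:R = m%:R :> R by rewrite -expr2 sqr_sqrtr// ler0n.
have [<-{j}|ij] := eqVneq i j.
  have -> : dotL2 (step m i) (step m i) = \int[mu]_(t in I01) (m%:R * \1_(A i) t).
    apply: eq_Rintegral => t _; rewrite stepE mulrACA sq indicE.
    by case: (_ \in _); rewrite ?mulr1// !mulr0.
  rewrite RintegralZl//; last first.
    apply: (integrableS measurableT) => //; exact: integrable_indic_itv.
  rewrite /Rintegral integral_indic//; last exact: measurable_itv.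
  have -> : A i `&` I01 = A i.
    apply/setIidPl => t; rewrite /A/= !in_itv/= => /andP[h1 h2].
    rewrite (le_trans _ h1) ?divr_ge0//= (le_trans (ltW h2))// ler_pdivrMr// mul1r ler_nat.
    exact: ltn_ord.
  rewrite /A/= lebesgue_measure_itv/= lte_fin ltr_pM2r ?invr_gt0// ltr_nat ltnSn.
  by rewrite -EFinB/= -mulrBl -natrB// subSnn mul1r mulfV// gt_eqF.
rewrite /dotL2 (@eq_Rintegral _ _ _ _ _ (cst 0)) ?Rintegral_cst ?mul0r// => t _.
rewrite !stepE mulrACA !indicE; case: (boolP (t \in A i)) => [ti|]; last by rewrite mul0r mulr0.
case: (boolP (t \in A j)) => [tj|]; last by rewrite mul1r mulr0.
exfalso; move: ti tj; rewrite !inE /A/= !in_itv/= => /andP[h1 h2] /andP[h3 h4].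
have := le_lt_trans h1 h4; have := le_lt_trans h3 h2.
rewrite !ltr_pM2r ?invr_gt0// !ltr_nat !ltnS => ji ij'.
by move/eqP: ij; apply; apply/val_inj/eqP; rewrite eqn_leq ji ij'.
Qed.

Lemma interpolationE (b : R -> R) t : interpolation m b t =
  \int[mu]_(s in `[0, t]) (\sum_(i < m)
    (Num.sqrt m%:R * (b (i.+1%:R / m%:R) - b (i%:R / m%:R))) * step m i s).
Proof.
apply: eq_Rintegral => s _; rewrite mulr_sumr; apply: eq_bigr => i _.
have sq : Num.sqrt m%:R * Num.sqrt m%:R = m%:R :> R by rewrite -expr2 sqr_sqrtr// ler0n.
by rewrite /step mulrACA sq.
Qed.

Let b2 : 2^-1 < 1 - beta <= 1.
Proof. by have := beta_ge0; have := beta_lt; move=> ? ?; apply/andP; split; lra. Qed.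

Let b0 : 0 < 1 - beta.
Proof. by have := beta_ge0; have := beta_lt; move=> ? ?; lra. Qed.

Let k := kfun e beta.

Lemma square_integrable_kfun n : square_integrable (k n).
Proof. by apply: square_integrable_frac_right => //; case/andP: b2. Qed.

(** The derivative of order beta of a primitive is I^(1-beta) of the integrand;
    integration by parts moves this operator onto e n, where it produces k n. *)
Lemma dotL2_frac_derivative (c : nat -> R) (f : R -> R) n :
  (forall t, f t = \int[mu]_(s in `[0, t]) (\sum_(i < m) c i * step m i s)) ->
  dotL2 (frac_derivative beta f) (e n) = \sum_(i < m) c i * dotL2 (k n) (step m i).
Proof.
move=> fE; pose g s := \sum_(i < m) c i * step m i s : R.
have mg (A : set R) : measurable_fun A g.
  by apply: measurable_sum => i; apply: measurable_funM => //; exact: measurable_step.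
have gG s : `|g s| <= \sum_(i < m) `|c i| * Num.sqrt m%:R.
  by apply: le_trans (ler_norm_sum _ _ _) _; apply: ler_sum => i _; rewrite normrM ler_wpM2l// step_le.
have b01 : 0 <= beta < 1.
  by have := beta_ge0; have := beta_lt; move=> ? ?; apply/andP; split; lra.
have hd : is_frac_derivative beta f (frac_left (1 - beta) g).
  by apply: (frac_derivative_primitive b01 (mg _) gG) => t _; exact: fE.
have hd' : is_frac_derivative beta f (frac_derivative beta f).
  by apply: getPex; exists (frac_left (1 - beta) g).
have eqd := frac_derivative_unique b01 hd' hd.
transitivity (dotL2 (frac_left (1 - beta) g) (e n)).
  rewrite /dotL2; congr fine; apply: ae_eq_integral => //.
  - by apply/measurable_EFinP; apply: measurable_funM; [case: hd' => -[]|case: (se n)].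
  - by apply/measurable_EFinP; apply: measurable_funM; [case: hd => -[]|case: (se n)].
  - by apply: ae_imply eqd => t h It; rewrite /= h.
rewrite (frac_left_right_dotL2 b2 (mg _) gG (se n)) dotL2C /g.
by apply: dotL2_sumr; [exact: square_integrable_kfun|move=> i; exact: square_integrable_step].
Qed.

(** Bessel's inequality in L^2 for the kernel of I^(1-beta), whose square is
    integrable because beta < 1/2; the bound is uniform in s. *)
Lemma kfun_sqr_sum_le : exists C, forall N s, I01 s -> \sum_(n < N) k n s ^+ 2 <= C.
Proof.
exists ((Gamma (1 - beta))^-1 ^+ 2 * fine (powker_mass (2 * (1 - beta) - 1))) => N s Is.
have s01 : 0 <= s <= 1 by move: Is; rewrite /= in_itv.
have /andP[s0 _] := s01; have /andP[bl _] := b2.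
have [sk dk] := square_integrable_powker bl s0.
have kE n : k n s = (Gamma (1 - beta))^-1 * dotL2 (fun t => powker (1 - beta) (t - s)) (e n).
  exact: frac_right_dotL2.
under eq_bigr do rewrite kE exprMn.
rewrite -mulr_sumr ler_wpM2l ?sqr_ge0//; apply: le_trans dk.
by apply: (@dotL2_bessel _ N (fun i => e i)) => // i j; rewrite ee.
Qed.

(** Integrates the uniform bound [kfun_sqr_sum_le] over [0, 1]. With w the
    identity this bounds the sum of the square norms of the k n, with w the
    coordinates of the basis x it bounds the trace of S_beta. *)
Lemma kfun_comb_sqr_le : exists C, forall N (w : nat -> nat -> R) M,
  (forall s, \sum_(p < M) (\sum_(n < N) w n p * k n s) ^+ 2 <= \sum_(n < N) k n s ^+ 2) ->
  \sum_(p < M) dotL2 (fun s => \sum_(n < N) w n p * k n s) (fun s => \sum_(n < N) w n p * k n s) <= C.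
Proof.
have [C hC] := kfun_sqr_sum_le; exists C => N w M hw.
have sf p : square_integrable (fun s => \sum_(n < N) w n p * k n s).
  by apply: square_integrable_sum => i; apply: square_integrableZ; exact: square_integrable_kfun.
have ip p := square_integrable_mul (sf p) (sf p).
rewrite (_ : C = \int[mu]_(s in I01) C); last first.
  by rewrite Rintegral_cst//= lebesgue_measure_itv/= lte_fin ltr01 -EFinB subr0/= mulr1.
have -> : \sum_(p < M) dotL2 (fun s => \sum_(n < N) w n p * k n s) (fun s => \sum_(n < N) w n p * k n s) =
    \int[mu]_(s in I01) (\sum_(p < M) (\sum_(n < N) w n p * k n s) * (\sum_(n < N) w n p * k n s)).
  rewrite /Rintegral; under [in RHS]eq_integral do rewrite -sumEFin.
  have Ep p : (\int[mu]_(s in I01) ((\sum_(n < N) w n p * k n s) * (\sum_(n < N) w n p * k n s))%:E =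
      (dotL2 (fun s => \sum_(n < N) w n p * k n s) (fun s => \sum_(n < N) w n p * k n s))%:E)%E.
    by rewrite /dotL2 /Rintegral fineK//; exact: (integrable_fin_num measurable_I01 (ip p)).
  rewrite integral_sum//=.
    by under [in RHS]eq_bigr do rewrite Ep; rewrite sumEFin.
  by move=> p; exact: ip.
apply: le_Rintegral => //.
- have := integrable_sum measurable_I01 (index_enum 'I_M) (P := xpredT) (fun p _ => ip p).
  by apply: eq_integrable => // s _; rewrite /= sumEFin.
- have := square_integrable_integrable (square_integrable_cst C); exact.
- move=> s Is; apply: le_trans (hC N s Is).
  by apply: le_trans (hw s); apply: ler_sum => p _; rewrite expr2.
Qed.

Let a n l := dotL2 (k n) (k l).
Let d (n i : nat) := dotL2 (k n) (@step R m i).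
Let a' n l := dotL2 (proj_step m (k n)) (proj_step m (k l)).
Let sk := square_integrable_kfun.

Lemma dotL2_proj_step n l : a' n l = \sum_(i < m) d n i * d l i.
Proof.
have sp n' : square_integrable (proj_step m (k n')).
  by apply: square_integrable_sum => i; apply: square_integrableZ; exact: square_integrable_step.
have pd (i : 'I_m) : dotL2 (proj_step m (k n)) (step m i) = d n i.
  rewrite dotL2C /proj_step dotL2_sumr; [|exact: square_integrable_step..].
  rewrite (bigD1 i)//= dotL2_step eqxx mulr1 big1 ?addr0// => j ji.
  by rewrite dotL2_step eq_sym (negbTE ji) mulr0.
rewrite /a' {2}/proj_step dotL2_sumr; [|exact: sp|exact: square_integrable_step].
apply: eq_bigr => i _; rewrite [RHS]mulrC.
exact: (congr1 (fun z => d l i * z) (pd i)).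
Qed.

Let comb (y : nat -> R) N s := \sum_(n < N) y n * k n s.

Let dotL2_comb (y : nat -> R) N :
  dotL2 (comb y N) (comb y N) = \sum_(n < N) \sum_(l < N) a n l * (y n * y l).
Proof.
have sc : square_integrable (comb y N).
  by apply: square_integrable_sum => n; apply: square_integrableZ; exact: sk.
rewrite {2}/comb dotL2_sumr; [|exact: sc|exact: sk].
apply: eq_bigr => n _; rewrite dotL2C /comb dotL2_sumr; [|exact: sk|exact: sk].
by rewrite mulr_sumr; apply: eq_bigr => l _; rewrite /a; ring.
Qed.

(** Bessel's inequality for a combination of the k n against the steps. *)
Lemma gram_diff_ge0 (y : nat -> R) N :
  0 <= \sum_(n < N) \sum_(l < N) (a n l - a' n l) * (y n * y l).
Proof.
have sc : square_integrable (comb y N).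
  by apply: square_integrable_sum => n; apply: square_integrableZ; exact: sk.
have := @dotL2_bessel _ m (fun i => step m i) (comb y N)
  (fun i => square_integrable_step i) dotL2_step sc.
rewrite -subr_ge0 => /le_trans; apply; rewrite dotL2_comb le_eqVlt; apply/orP; left; apply/eqP.
have E (i : nat) : dotL2 (comb y N) (step m i) = \sum_(n < N) y n * d n i.
  rewrite dotL2C /comb dotL2_sumr; [|exact: square_integrable_step|exact: sk].
  by apply: eq_bigr => n _; rewrite dotL2C.
under [X in _ - X]eq_bigr do rewrite E.
rewrite gram_projection; apply: eq_bigr => n _; apply: eq_bigr => l _.
by rewrite dotL2_proj_step.
Qed.

Let kfun_mass_le : exists C, 0 <= C /\ forall N, \sum_(n < N) a n n <= C.
Proof.
have [C hC] := kfun_comb_sqr_le.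
have E n N s : (n < N)%N -> \sum_(l < N) (l == n :> nat)%:R * k l s = k n s.
  move=> nN; rewrite (bigD1 (Ordinal nN))//= eqxx mul1r big1 ?addr0// => l ln.
  rewrite (_ : (l == n :> nat) = false) ?mul0r//; apply/negbTE.
  by apply: contra ln => /eqP ln; apply/eqP/val_inj.
have h N : \sum_(n < N) a n n <= C.
  have := hC N (fun l n => (l == n)%:R) N.
  have -> : \sum_(p < N) dotL2 (fun s => \sum_(n < N) (n == p :> nat)%:R * k n s)
      (fun s => \sum_(n < N) (n == p :> nat)%:R * k n s) = \sum_(n < N) a n n.
    by apply: eq_bigr => n _; apply: eq_Rintegral => s _; rewrite E.
  apply=> s; rewrite le_eqVlt; apply/orP; left; apply/eqP.
  by apply: eq_bigr => n _; rewrite E.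
by exists C; split => //; have := h 0%N; rewrite big_ord0.
Qed.

Let sqr_sum_le (b : nat -> nat -> R) :
  (forall n l, b n l ^+ 2 <= a n n * a l l) ->
  exists C, forall N, \sum_(n < N) \sum_(l < N) b n l ^+ 2 <= C.
Proof.
have [C [C0 hC]] := kfun_mass_le => hb; exists (C * C) => N.
apply: (@le_trans _ _ (\sum_(n < N) \sum_(l < N) a n n * a l l)).
  by apply: ler_sum => n _; apply: ler_sum => l _; exact: hb.
under eq_bigr do rewrite -mulr_sumr.
rewrite -mulr_suml ler_pM// sumr_ge0// => n _; exact: dotL2_ge0.
Qed.

Let a'_le n : a' n n <= a n n.
Proof.
rewrite dotL2_proj_step; under eq_bigr do rewrite -expr2.
exact: (@dotL2_bessel _ m (fun i => step m i) (k n)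
  (fun i => square_integrable_step i) dotL2_step (sk n)).
Qed.

Let sproj n : square_integrable (proj_step m (k n)).
Proof.
by apply: square_integrable_sum => i; apply: square_integrableZ; exact: square_integrable_step.
Qed.

Lemma S_beta_cvg p q :
  \sum_(n < N) \sum_(l < N) a n l * (x n p * x l q) @[N --> \oo] --> S_beta e x beta (p, q).
Proof.
have [|C hC] := @sqr_sum_le a; first by move=> n l; apply: dotL2_cauchy_schwarz; exact: sk.
exact: (opsum_cvg xx hC).
Qed.

Lemma S_dag_cvg p q :
  \sum_(n < N) \sum_(l < N) a' n l * (x n p * x l q) @[N --> \oo] --> S_dag e x beta m (p, q).
Proof.
have [|C hC] := @sqr_sum_le a'; last exact: (opsum_cvg xx hC).
move=> n l; apply: le_trans (dotL2_cauchy_schwarz (sproj n) (sproj l)) _.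
by apply: ler_pM; rewrite ?dotL2_ge0//; exact: a'_le.
Qed.

Lemma S_beta_sym p q : S_beta e x beta (p, q) = S_beta e x beta (q, p).
Proof.
have h1 := @S_beta_cvg p q; have h2 := @S_beta_cvg q p.
rewrite -(cvg_lim (@Rhausdorff R) h1) -(cvg_lim (@Rhausdorff R) h2).
congr (limn _); apply/funext => N.
rewrite exchange_big/=; apply: eq_bigr => l _; apply: eq_bigr => n _.
exact: (congr2 (fun u v => u * v) (dotL2C (k n) (k l)) (mulrC (x n p) (x l q))).
Qed.

(** Limit of [gram_diff_ge0] for y n = \sum_p c p * x n p. *)
Lemma S_diff_psd M (c : nat -> R) : 0 <= \sum_(p < M) \sum_(q < M)
  (S_beta e x beta (p : nat, q : nat) - S_dag e x beta m (p : nat, q : nat)) * (c p * c q).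
Proof.
have : \sum_(p < M) \sum_(q < M) (\sum_(n < N) \sum_(l < N) a n l * (x n p * x l q) -
      \sum_(n < N) \sum_(l < N) a' n l * (x n p * x l q)) * (c p * c q) @[N --> \oo] -->
    \sum_(p < M) \sum_(q < M)
      (S_beta e x beta (p : nat, q : nat) - S_dag e x beta m (p : nat, q : nat)) * (c p * c q).
  apply: cvg_big => [|p _]; first exact: add_continuous.
  apply: cvg_big => [|q _]; first exact: add_continuous.
  by apply: cvgMl; apply: cvgB; [exact: S_beta_cvg|exact: S_dag_cvg].
move/(@cvg_ge_bound _ _ _ 0 0); apply => N _.
have := gram_diff_ge0 (fun n => \sum_(p < M) c p * x n p) N.
move=> /le_trans; apply; rewrite le_eqVlt; apply/orP; left; apply/eqP.
under [RHS]eq_bigr do under eq_bigr do rewrite -sumrB mulr_suml.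
under [RHS]eq_bigr do rewrite exchange_big/=.
rewrite [RHS]exchange_big/=; apply: eq_bigr => n _.
under [RHS]eq_bigr do under eq_bigr do rewrite -sumrB mulr_suml.
under [RHS]eq_bigr do rewrite exchange_big/=.
rewrite [RHS]exchange_big/=; apply: eq_bigr => l _.
rewrite mulr_suml mulr_sumr; apply: eq_bigr => p _.
rewrite mulr_sumr mulr_sumr; apply: eq_bigr => q _.
by ring.
Qed.

(** Limit of [kfun_comb_sqr_le], the coordinates of the orthonormal vectors x n
    being admissible weights by [orthonormal_comb_le]. *)
Lemma S_beta_trace_le : exists C, forall M, \sum_(p < M) S_beta e x beta (p : nat, p : nat) <= C.
Proof.
have [C hC] := kfun_comb_sqr_le; exists C => M.
have : \sum_(p < M) \sum_(n < N) \sum_(l < N) a n l * (x n p * x l p) @[N --> \oo] -->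
    \sum_(p < M) S_beta e x beta (p : nat, p : nat).
  by apply: cvg_big => [|p _]; [exact: add_continuous|exact: S_beta_cvg].
move/(@cvg_le_bound _ _ _ C 0); apply => N _.
apply: le_trans (hC N (fun n p => x n p) M _); last first.
  move=> s; have := orthonormal_comb_le xx (fun n => k n s) N M.
  move=> /(le_trans _); apply; rewrite le_eqVlt; apply/orP; left; apply/eqP.
  apply: eq_bigr => p _; congr (_ ^+ 2); apply: eq_bigr => n _; exact: mulrC.
rewrite le_eqVlt; apply/orP; left; apply/eqP; apply: eq_bigr => p _.
by rewrite (dotL2_comb (fun n => x n p)).
Qed.

(** The interpolation depends on the path through m increments only, hence lives
    in the span of m vectors: the images of the steps under the map that sends f
    to \sum_n (k n . f) *: x n. The same vectors factor S_dag, which is this map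
    composed with its adjoint on the span of the steps. *)
Lemma J_iso_interpolation : exists v : nat -> l2,
  (forall b, J_iso e x beta (interpolation m b) = \sum_(i < m)
    (Num.sqrt m%:R * (b (i.+1%:R / m%:R) - b (i%:R / m%:R))) *: v i) /\
  (forall p q, S_dag e x beta m (p, q) = \sum_(i < m) v i p * v i q).
Proof.
have [C [C0 hC]] := kfun_mass_le.
have dv (i : 'I_m) : exists v : l2, series (fun n => d n i *: x n) @ \oo --> v.
  apply: (series_orthonormal_cvg xx (C := C)) => N; apply: le_trans (hC N).
  apply: ler_sum => n _; apply: le_trans (a'_le n).
  by rewrite dotL2_proj_step (bigD1 i)//= -expr2 lerDl sumr_ge0// => j _; rewrite -expr2 sqr_ge0.
have [v hv] : exists v : nat -> l2, forall i : 'I_m, series (fun n => d n i *: x n) @ \oo --> v i.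
  have [w hw] := choice dv.
  exists (fun i => if insub i is Some j then w j else 0) => i.
  by rewrite valK; exact: hw.
exists v; split=> [b|p q].
  apply/cvg_lim; first exact: norm_hausdorff.
  pose c (i : nat) := Num.sqrt m%:R * (b (i.+1%:R / m%:R) - b (i%:R / m%:R)).
  have E : series (fun n => dotL2 (frac_derivative beta (interpolation m b)) (e n) *: x n) =
      (fun N => \sum_(i < m) c i *: series (fun n => d n i *: x n) N).
    apply/funext => N; rewrite /series/=.
    under [RHS]eq_bigr do rewrite scaler_sumr.
    rewrite [RHS]exchange_big/=; apply: eq_bigr => n _.
    rewrite (dotL2_frac_derivative (c := c)); last by move=> t; exact: interpolationE.
    by rewrite scaler_suml; apply: eq_bigr => i _; rewrite scalerA.
  rewrite E; apply: cvg_big => [|i _]; first exact: add_continuous.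
  by apply: cvgZr; exact: hv.
have h1 : \sum_(i < m) (series (fun n => d n i *: x n) N : l2) p *
    (series (fun n => d n i *: x n) N : l2) q @[N --> \oo] --> \sum_(i < m) v i p * v i q.
  apply: cvg_big => [|i _]; first exact: add_continuous.
  by apply: cvgM; apply: ell2_cvg_coord; exact: hv.
have h2 := @S_dag_cvg p q.
rewrite -(cvg_lim (@Rhausdorff R) h1) -(cvg_lim (@Rhausdorff R) h2).
congr (limn _); apply/funext => N; apply/esym.
under [RHS]eq_bigr do under eq_bigr do rewrite dotL2_proj_step mulr_suml.
under [RHS]eq_bigr do rewrite exchange_big/=.
rewrite [RHS]exchange_big/=; apply: eq_bigr => i _.
rewrite /series/= !big_mkord !ell2_sumE mulr_suml; apply: eq_bigr => n _.
rewrite mulr_sumr; apply: eq_bigr => l _.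
by rewrite [LHS]mulrACA.
Qed.

End interpolation_coordinates.

(** * Integration against the Gaussian density *)

Section real_integrable.
Context {R : realType} d (T : measurableType d) (mu : {measure set T -> \bar R}).
Implicit Types f g : T -> R.

Lemma Rintegrable_scale (c : R) f : mu.-integrable setT (EFin \o f) ->
  mu.-integrable setT (EFin \o (fun x => c * f x)).
Proof. exact: integrableZl. Qed.

Lemma Rintegrable_add f g : mu.-integrable setT (EFin \o f) ->
  mu.-integrable setT (EFin \o g) ->
  mu.-integrable setT (EFin \o (fun x => f x + g x)).
Proof. exact: integrableD. Qed.

Lemma Rintegrable_sub f g : mu.-integrable setT (EFin \o f) ->
  mu.-integrable setT (EFin \o g) ->
  mu.-integrable setT (EFin \o (fun x => f x - g x)).
Proof. exact: integrableB. Qed.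

Lemma Rintegrable_le f g : measurable_fun setT f -> (forall x, `|f x| <= g x) ->
  mu.-integrable setT (EFin \o g) -> mu.-integrable setT (EFin \o f).
Proof.
move=> mf fg; apply: le_integrable => //; first exact/measurable_EFinP.
by move=> x _; rewrite lee_fin (le_trans (fg x))// ler_norm.
Qed.

Lemma normr_Rintegral_le f g : mu.-integrable setT (EFin \o f) ->
  mu.-integrable setT (EFin \o g) -> (forall x, `|f x| <= g x) ->
  `|\int[mu]_x f x| <= \int[mu]_x g x.
Proof.
move=> i1 i2 fg; apply: le_trans (le_normr_Rintegral _ i1) _ => //.
by apply: le_Rintegral => //; exact: integrable_norm.
Qed.

End real_integrable.

Section trigonometric_measurability.
Context {R : realType}.

Lemma measurable_cos : measurable_fun [set: R] (cos : R -> R).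
Proof. by apply: continuous_measurable_fun; exact: continuous_cos. Qed.

Lemma measurable_sin : measurable_fun [set: R] (sin : R -> R).
Proof. by apply: continuous_measurable_fun; exact: continuous_sin. Qed.

Lemma norm_cos_le1 (x : R) : `|cos x| <= 1.
Proof. by rewrite ler_norml cos_geN1 cos_le1. Qed.

Lemma norm_sin_le1 (x : R) : `|sin x| <= 1.
Proof. by rewrite ler_norml sin_geN1 sin_le1. Qed.

End trigonometric_measurability.

Lemma Rintegral_dominated_cvg (R : realType) d (T : measurableType d)
    (mu : {measure set T -> \bar R}) (fn : nat -> T -> R) (f g : T -> R) :
  (forall n, measurable_fun setT (fn n)) -> mu.-integrable setT (EFin \o g) ->
  (forall n x, `|fn n x| <= g x) -> (forall x, fn n x @[n --> \oo] --> f x) ->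
  mu.-integrable setT (EFin \o f) /\
  \int[mu]_x fn n x @[n --> \oo] --> \int[mu]_x f x.
Proof.
move=> mfn ig fng fnf.
have mf : measurable_fun setT f.
  by apply: (measurable_fun_cvg (h := fn)) => // x _; exact: fnf.
have [|||||i1 _ i3] := @dominated_convergence _ T R mu setT measurableT
   (fun n => EFin \o fn n) (EFin \o f) (EFin \o g).
- by move=> n; apply/measurable_EFinP; exact: mfn.
- exact/measurable_EFinP.
- by apply/aeW => x _; apply: cvg_EFin; [exact: nearW|exact: fnf].
- exact: ig.
- by apply/aeW => x n _; rewrite lee_fin.
split=> //; apply: fine_cvg; rewrite fineK//.
exact: integrable_fin_num i1.
Qed.

Lemma cvg0_le_inv (R : realType) (K : R) (u : nat -> R) :
  (forall n, (1 <= n)%N -> `|u n| <= K / n%:R) -> u n @[n --> \oo] --> 0.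
Proof.
move=> uK; rewrite -(cvg_shiftS u); apply/norm_cvg0P.
apply: (@squeeze_cvgr _ _ _ _ (cst 0) (fun n => K * harmonic n)).
- by apply: nearW => n; rewrite normr_ge0/=; exact: uK.
- exact: cvg_cst.
- rewrite -[X in _ --> X](mulr0 K); apply: cvgM; first exact: cvg_cst.
  exact: cvg_harmonic.
Qed.

Section gaussian_density.
Context {R : realType}.
Local Notation mu := (@lebesgue_measure R).
Variables (s : R) (s0 : s != 0).
Local Notation p := (normal_pdf 0 s).

Lemma normal_pdf_centerE x : p x = normal_peak s * expR (- x ^+ 2 / (s ^+ 2 *+ 2)).
Proof. by rewrite normal_pdfE// /normal_fun subr0. Qed.

(** Doubling the variance absorbs any polynomial factor. *)
Lemma normal_pdf_poly_le : exists K, forall x,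
  (1 + x ^+ 4) * p x <= K * normal_pdf 0 (s * Num.sqrt 2) x.
Proof.
have s2 : 0 < s ^+ 2 by rewrite exprn_even_gt0.
have t0 : s * Num.sqrt 2 != 0 by rewrite mulf_neq0// gt_eqF// sqrtr_gt0.
have P1 := normal_peak_gt0 s0.
have P2 := normal_peak_gt0 t0.
exists (normal_peak s / normal_peak (s * Num.sqrt 2) * (1 + 64 * s ^+ 4)) => x.
rewrite normal_pdf_centerE normal_pdfE// /normal_fun subr0.
rewrite exprMn sqr_sqrtr// mulrCA.
move: P1 P2; set P1 := normal_peak s; set P2 := normal_peak _ => P1_gt0 P2_gt0.
have -> : P1 / P2 * (1 + 64 * s ^+ 4) * (P2 * expR (- x ^+ 2 / (s ^+ 2 * 2 *+ 2))) =
    P1 * ((1 + 64 * s ^+ 4) * expR (- x ^+ 2 / (s ^+ 2 * 2 *+ 2))).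
  by field; rewrite gt_eqF.
rewrite ler_pM2l//.
pose a := x ^+ 2 / (s ^+ 2 *+ 8).
have a0 : 0 <= a by rewrite divr_ge0 ?sqr_ge0// mulrn_wge0// ltW.
have -> : - x ^+ 2 / (s ^+ 2 *+ 2) = - (4 * a).
  by rewrite /a; field.
have -> : - x ^+ 2 / (s ^+ 2 * 2 *+ 2) = - (2 * a).
  by rewrite /a; field.
have -> : x ^+ 4 = 64 * s ^+ 4 * a ^+ 2 by rewrite /a; field.
have e1 : 1 + a <= expR a by exact: expR_ge1Dx.
have e2 : a ^+ 2 <= expR (2 * a).
  have -> : 2 * a = a + a by ring.
  rewrite expRD expr2; apply: ler_pM => //; lra.
have e3 : 1 <= expR (2 * a) by have := expR_ge1Dx (2 * a); lra.
have s4 : 0 <= s ^+ 4 by rewrite exprn_even_ge0.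
have -> : - (2 * a) = 2 * a - 4 * a by ring.
rewrite expRD mulrA ler_wpM2r ?expR_ge0// mulrC.
have : s ^+ 4 * a ^+ 2 <= s ^+ 4 * expR (2 * a) by rewrite ler_wpM2l.
by nra.
Qed.

Lemma integrable_normal_poly (h : R -> R) (C : R) : measurable_fun [set: R] h ->
  (forall x, `|h x| <= C * (1 + x ^+ 4)) ->
  mu.-integrable [set: R] (EFin \o (fun x => h x * p x)).
Proof.
move=> mh hC; have [K HK] := normal_pdf_poly_le.
have t0 : s * Num.sqrt 2 != 0 by rewrite mulf_neq0// gt_eqF// sqrtr_gt0.
apply: (@le_integrable _ _ _ mu _ measurableT _
  (EFin \o (fun x => (C * K) * normal_pdf 0 (s * Num.sqrt 2) x))).
- apply/measurable_EFinP; apply: measurable_funM => //.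
  exact: measurable_normal_pdf.
- move=> x _; rewrite lee_fin normrM.
  rewrite (ger0_norm (normal_pdf_ge0 _ _ _)).
  apply: le_trans (ler_norm _); rewrite -mulrA.
  have C0 : 0 <= C.
    by move: (hC 0); rewrite expr0n addr0 mulr1; apply: le_trans.
  apply: le_trans (_ : C * (1 + x ^+ 4) * p x <= _).
    by rewrite ler_wpM2r ?normal_pdf_ge0.
  by rewrite -mulrA ler_wpM2l.
- apply: (@eq_integrable _ _ _ mu _ measurableT
    (fun x => (C * K)%:E * (normal_pdf 0 (s * Num.sqrt 2) x)%:E)%E) => //.
  by apply: integrableZl => //; exact: integrable_normal_pdf.
Qed.

Lemma poly4_ge (x : R) : [/\ `|x| <= 1 + x ^+ 4, x ^+ 2 <= 1 + x ^+ 4 &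
  `|x| ^+ 3 <= 1 + x ^+ 4].
Proof.
have E2 : x ^+ 2 = `|x| ^+ 2 by rewrite real_normK ?num_real.
have -> : x ^+ 4 = (`|x| ^+ 2) ^+ 2 by rewrite -E2 -exprM.
rewrite E2 [`|x| ^+ 3]exprS; have := normr_ge0 x; set y := `|x| => y0.
have h1 : 0 <= (y - 1) ^+ 2 by exact: sqr_ge0.
have h2 : 0 <= (y ^+ 2 - 1) ^+ 2 by exact: sqr_ge0.
have h3 : 0 <= (y - y ^+ 2) ^+ 2 by exact: sqr_ge0.
split; nra.
Qed.

Lemma integrable_normal_bounded (h : R -> R) (C : R) : measurable_fun [set: R] h ->
  (forall x, `|h x| <= C) ->
  mu.-integrable [set: R] (EFin \o (fun x => h x * p x)).
Proof.
move=> mh hC; apply: (@integrable_normal_poly h C) => // x.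
have C0 : 0 <= C by apply: le_trans (hC 0).
rewrite (le_trans (hC x))// ler_peMr// lerDl.
by rewrite exprn_even_ge0.
Qed.

Lemma normal_vanish : exists K, forall x, 1 <= `|x| -> (1 + `|x|) * p x <= K / `|x|.
Proof.
have [K HK] := normal_pdf_poly_le.
have t0 : s * Num.sqrt 2 != 0 by rewrite mulf_neq0// gt_eqF// sqrtr_gt0.
exists (2 * (`|K| * normal_peak (s * Num.sqrt 2))) => x x1.
have x0 : 0 < `|x| by lra.
rewrite ler_pdivlMr//.
apply: le_trans (_ : 2 * ((1 + x ^+ 4) * p x) <= _).
  rewrite [leLHS]mulrAC [leRHS]mulrA ler_wpM2r ?normal_pdf_ge0//.
  by have [? ? ?] := poly4_ge x; have := real_normK (num_real x); nra.
rewrite ler_pM2l//; apply: le_trans (HK x) _.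
apply: le_trans (_ : `|K| * normal_pdf 0 (s * Num.sqrt 2) x <= _).
  by rewrite ler_wpM2r ?normal_pdf_ge0// ler_norm.
by rewrite ler_wpM2l// normal_pdf_ub.
Qed.

Lemma is_derive_normal_pdf (x : R) : is_derive x (1 : R) p (- x / s ^+ 2 * p x).
Proof.
have -> : p = fun x => normal_peak s * expR (- x ^+ 2 / (s ^+ 2 *+ 2)).
  by apply/funext => y; exact: normal_pdf_centerE.
have h1 : is_derive x (1 : R) (fun x : R => - x ^+ 2 / (s ^+ 2 *+ 2)) (- x / s ^+ 2).
  have -> : (fun x : R => - x ^+ 2 / (s ^+ 2 *+ 2)) =
      (fun x : R => (- (s ^+ 2 *+ 2)^-1) *: x ^+ 2).
    by apply/funext => y; rewrite mulrC mulrN scaleNr.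
  apply: is_derive_eq.
  by rewrite /GRing.scale/= !mulr1; field.
have h2 := is_derive1_comp (f := expR)
  (g := fun x : R => - x ^+ 2 / (s ^+ 2 *+ 2)) _ h1.
have h3 := is_deriveZ (normal_peak s) (h2 _ (is_derive_expR _)).
apply: (is_derive_eq (h3 : is_derive x (1 : R) (fun x => normal_peak s *
  expR (- x ^+ 2 / (s ^+ 2 *+ 2))) _)).
rewrite -[LHS]/(normal_peak s * (_ * _)).
by rewrite mulrA [RHS]mulrC.
Qed.

(** The fundamental theorem of calculus on [-n, n], with n tending to infinity. *)
Lemma integral_derivative_eq0 (f f' : R -> R) :
  (forall x : R, is_derive x (1 : R) f (f' x)) -> continuous f' ->
  mu.-integrable [set: R] (EFin \o f') ->
  f n%:R @[n --> \oo] --> 0 -> f (- n%:R) @[n --> \oo] --> 0 ->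
  \int[mu]_x f' x = 0.
Proof.
move=> df cf' if' f1 f2.
pose g n : R -> R := f' \_ `[- n.+1%:R, n.+1%:R].
have mf' : measurable_fun [set: R] f' by exact: continuous_measurable_fun.
have [||||_ h] := @Rintegral_dominated_cvg R _ _ mu g f' (fun x => `|f' x|).
- by move=> n; apply/measurable_restrict => //; exact: measurable_funTS.
- exact: (@integrable_norm _ _ _ mu _ f').
- move=> n x; rewrite /g patchE; case: ifP => // _.
  by rewrite normr0.
- move=> x; apply: cvg_near_cst.
  near=> n; rewrite /g patchE ifT// mem_setE in_itv/= -ler_norml.
  near: n; have xN := archi_boundP (normr_ge0 x).
  exists (Num.bound `|x|) => // n /= Nn; apply: le_trans (ltW xN) _.
  by rewrite ler_nat; exact: leqW.
have cf x : {for x, continuous f}.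
  by apply/differentiable_continuous/derivable1_diffP; apply: ex_derive.
have g0 : \int[mu]_x g n x @[n --> \oo] --> 0.
  have -> : (fun n => \int[mu]_x g n x) = (fun n => f n.+1%:R - f (- n.+1%:R)).
    apply/funext => n; rewrite /g -Rintegral_mkcond.
    rewrite /Rintegral (@continuous_FTC2 _ f' f)//.
    - by rewrite (@lt_trans _ _ 0)// oppr_lt0.
    - exact: continuous_subspaceT.
    - split.
      + by move=> x _; apply: ex_derive.
      + by apply: cvg_at_right_filter; exact: cf.
      + by apply: cvg_at_left_filter; exact: cf.
    - by move=> x _; rewrite derive1E; exact: derive_val.
  rewrite -[X in _ --> X](subr0 0).
  apply: cvgB; first by rewrite -(cvg_shiftS (fun n => f n%:R)) in f1.
  by rewrite -(cvg_shiftS (fun n => f (- n%:R))) in f2.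
by rewrite -(cvg_lim (@Rhausdorff R) h) (cvg_lim (@Rhausdorff R) g0).
Unshelve. all: by end_near. Qed.

(** Integration by parts against the Gaussian density, whose logarithmic
    derivative is linear. *)
Lemma normal_stein (h h' : R -> R) (C : R) :
  (forall x : R, is_derive x (1 : R) h (h' x)) -> continuous h' ->
  (forall x, `|h x| <= C * (1 + `|x|)) -> (forall x, `|h' x| <= C) ->
  \int[mu]_x (h' x * p x) = (s ^+ 2)^-1 * \int[mu]_x (x * h x * p x).
Proof.
move=> dh ch' hC h'C.
have ch : continuous h.
  by move=> x; apply/differentiable_continuous/derivable1_diffP; apply: ex_derive.
have C0 : 0 <= C by apply: le_trans (h'C 0).
have i1 : mu.-integrable [set: R] (EFin \o (fun x => h' x * p x)).
  by apply: (@integrable_normal_bounded _ C) => //; exact: continuous_measurable_fun.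
have i2 : mu.-integrable [set: R] (EFin \o (fun x => x * h x * p x)).
  apply: (@integrable_normal_poly _ (C * 2)).
    by apply: measurable_funM => //; exact: continuous_measurable_fun.
  move=> x; rewrite normrM; have := hC x; have := normr_ge0 x.
  have [q1 q2 _] := poly4_ge x; have := real_normK (num_real x).
  set y := `|x|; set z := `|h x| => q3 q4 q5.
  apply: le_trans (_ : C * (y * (1 + y)) <= _); last by rewrite -mulrA ler_wpM2l//; nra.
  by rewrite mulrCA ler_wpM2l.
have dhp (x : R) : is_derive x (1 : R) (fun x => h x * p x)
    (h' x * p x - (s ^+ 2)^-1 * (x * h x * p x)).
  apply: (is_derive_eq (is_deriveM (dh x) (is_derive_normal_pdf x))).
  by rewrite /GRing.scale/=; field.
have := integral_derivative_eq0 dhp.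
have i3 : mu.-integrable [set: R]
    (EFin \o (fun x => (s ^+ 2)^-1 * (x * h x * p x))).
  exact: Rintegrable_scale.
rewrite RintegralB// RintegralZl//.
move=> H; apply/eqP; rewrite -subr_eq0; apply/eqP; apply: H.
- move=> x; apply: cvgB; first apply: cvgM.
  + exact: ch'.
  + exact: continuous_normal_pdf.
  + apply: cvgM; first exact: cvg_cst.
    by apply: cvgM; [apply: cvgM; [exact: cvg_id|exact: ch]|exact: continuous_normal_pdf].
- exact: Rintegrable_sub.
- have [K HK] := normal_vanish; apply: (@cvg0_le_inv _ (C * K)) => n n1.
  have E : `|n%:R| = n%:R :> R by rewrite ger0_norm.
  have := HK n%:R; rewrite E ler1n => /(_ n1) H.
  rewrite normrM (ger0_norm (normal_pdf_ge0 _ _ _)) -mulrA.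
  apply: le_trans (ler_wpM2l C0 H); rewrite mulrA ler_wpM2r ?normal_pdf_ge0//.
  by rewrite (le_trans (hC _))// E.
- have [K HK] := normal_vanish; apply: (@cvg0_le_inv _ (C * K)) => n n1.
  have E : `|- n%:R| = n%:R :> R by rewrite normrN ger0_norm.
  have := HK (- n%:R); rewrite E ler1n => /(_ n1) H.
  rewrite normrM (ger0_norm (normal_pdf_ge0 _ _ _)) -mulrA.
  apply: le_trans (ler_wpM2l C0 H); rewrite mulrA ler_wpM2r ?normal_pdf_ge0//.
  by rewrite (le_trans (hC _))// E.
Qed.

Lemma normal_moment1 : \int[mu]_x (x * p x) = 0.
Proof.
have := @normal_stein (cst 1) (cst 0) 1.
rewrite (_ : (fun x => cst 0 x * p x) = cst 0); last by apply/funext => x /=; rewrite mul0r.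
rewrite Rintegral_cst// mul0r => H.
have /eqP : 0 = (s ^+ 2)^-1 * \int[mu]_x (x * p x).
  rewrite [LHS]H//.
  - by congr (_ * _); apply: eq_Rintegral => x _; rewrite /= mulr1.
  - by move=> x; exact: cvg_cst.
  - by move=> x; rewrite /= normr1 mul1r lerDl.
  - by move=> x; rewrite /= normr0.
by rewrite eq_sym mulf_eq0 invr_eq0 expf_eq0/= (negbTE s0) => /eqP.
Qed.

Lemma normal_mass : \int[mu]_x p x = 1.
Proof. by rewrite /Rintegral integral_normal_pdf. Qed.

Lemma normal_moment2 : \int[mu]_x (x ^+ 2 * p x) = s ^+ 2.
Proof.
have := @normal_stein id (cst 1) 1.
rewrite (_ : (fun x => cst 1 x * p x) = p); last by apply/funext => x /=; rewrite mul1r.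
rewrite normal_mass => H.
have : 1 = (s ^+ 2)^-1 * \int[mu]_x (x ^+ 2 * p x).
  rewrite [LHS]H//.
  - by move=> x; exact: cvg_cst.
  - by move=> x; rewrite mul1r lerDr.
  - by move=> x; rewrite /= normr1.
by move=> E; rewrite -[LHS]mul1r -(@mulfV _ (s ^+ 2)) ?expf_neq0// -mulrA -E mulr1.
Qed.

(** Differentiating under the integral and applying [normal_stein] to the sine
    shows that the integral, as a function of t, solves f' = - s^2 t f. *)
Lemma normal_charfun (t a : R) :
  \int[mu]_x (cos (t * x + a) * p x) = cos a * expR (- (s ^+ 2 * t ^+ 2) / 2).
Proof.
pose phi (t : R) := \int[mu]_x (cos (t * x + a) * p x).
have dphi (u : R) : is_derive u (1 : R) phi (- (s ^+ 2) * u * phi u).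
  pose f (t x : R) := cos (t * x + a) * p x.
  have dx x v : is_derive v (1 : R) (f ^~ x) (- (x * sin (v * x + a) * p x)).
    have h1 : is_derive v (1 : R) (fun v : R => v * x + a) x.
      have -> : (fun v : R => v * x + a) = (fun v : R => x *: v + a).
        by apply/funext => w; rewrite /GRing.scale/= mulrC.
      by apply: is_derive_eq; rewrite addr0 /GRing.scale/= mulr1.
    have h2 := is_derive1_comp (f := cos) (g := fun v : R => v * x + a)
      (is_derive_cos _) h1.
    have h3 := is_deriveZ (p x) h2.
    have -> : f ^~ x = p x \*: (cos \o (fun v : R => v * x + a)).
      by apply/funext => w; rewrite /f /= mulrC.
    by apply: (is_derive_eq h3); rewrite /GRing.scale/=; ring.
  have dfE v x : partial1of2 f v x = - (x * sin (v * x + a) * p x).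
    by rewrite partial1of2E; exact: derive_val.
  have mlin c : measurable_fun [set: R] (fun x : R => c * x + a).
    by apply: measurable_funD => //; exact: measurable_funM.
  have iphi v : mu.-integrable [set: R] (EFin \o f v).
    apply: (@integrable_normal_bounded (fun x => cos (v * x + a)) 1).
      exact: measurableT_comp measurable_cos (mlin v).
    by move=> x; exact: norm_cos_le1.
  have iabs : mu.-integrable [set: R] (EFin \o (fun x => `|x| * p x)).
    apply: (@integrable_normal_poly _ 1) => [|x].
      exact: normr_measurable.
    by rewrite mul1r normr_id; have [] := poly4_ge x.
  have uI : `](u - 1), (u + 1)[%classic u by rewrite /= in_itv/=; lra.
  have db x y : `](u - 1), (u + 1)[%classic x -> [set: R] y ->
      `|partial1of2 f x y| <= `|y| * p y.
    move=> _ _; rewrite dfE normrN !normrM (ger0_norm (normal_pdf_ge0 _ _ _)).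
    rewrite ler_wpM2r ?normal_pdf_ge0// ler_piMr//.
    exact: norm_sin_le1.
  have ge0 y : 0 <= `|y| * p y by rewrite mulr_ge0// normal_pdf_ge0.
  have H1 := derivable_under_integral (mu := mu) measurableT uI (fun x _ => iphi x)
    (fun x y _ _ => ex_derive (is_derive := dx y x)) ge0 iabs db.
  have H2 := differentiation_under_integral (mu := mu) measurableT uI (fun x _ => iphi x)
    (fun x y _ _ => ex_derive (is_derive := dx y x)) ge0 iabs db.
  split => //.
  rewrite -derive1E [LHS]H2.
  pose h x := sin (u * x + a); pose h' x := u * cos (u * x + a).
  have dh (x : R) : is_derive x (1 : R) h (h' x).
    have h1 : is_derive x (1 : R) (fun x : R => u * x + a) u.
      have -> : (fun x : R => u * x + a) = (fun x : R => u *: x + a) by [].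
      by apply: is_derive_eq; rewrite addr0 /GRing.scale/= mulr1.
    apply: (is_derive_eq (is_derive1_comp (f := sin) (g := fun v : R => u * v + a)
      (is_derive_sin _) h1)).
    by rewrite /h' mulrC.
  have := @normal_stein h h' (1 + `|u|) dh.
  rewrite (@eq_Rintegral _ _ _ mu setT (fun x => u * f u x)); last first.
    by move=> x _; rewrite /h' /f mulrA.
  rewrite RintegralZl// => H.
  rewrite (@eq_Rintegral _ _ _ mu setT (fun x => (-1) * (x * h x * p x))); last first.
    by move=> x _; rewrite dfE mulN1r.
  rewrite RintegralZl//; last first.
    apply: (@integrable_normal_poly _ 1) => [|x].
      by apply: measurable_funM => //; exact: measurableT_comp measurable_sin (mlin u).
    rewrite mul1r normrM; have [q _ _] := poly4_ge x; apply: le_trans q.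
    by rewrite ler_piMr// norm_sin_le1.
  have s2 : s ^+ 2 != 0 by rewrite expf_neq0.
  rewrite mulN1r -mulrA /phi -/(f u) H.
  - by rewrite mulNr mulrA divff// mul1r.
  - move=> x; apply: cvgM; first exact: cvg_cst.
    apply: (@continuous_comp _ _ _ (fun x => u * x + a) cos); last exact: continuous_cos.
    by apply: cvgD; [apply: cvgM; [exact: cvg_cst|exact: cvg_id]|exact: cvg_cst].
  - move=> x; apply: le_trans (norm_sin_le1 _) _.
    by have := normr_ge0 u; have := normr_ge0 x; nra.
  - move=> x; rewrite /h' normrM; have := norm_cos_le1 (u * x + a).
    by have := normr_ge0 u; nra.
have dpsi (u : R) :
    is_derive u (1 : R) (fun u => phi u * expR (s ^+ 2 / 2 * u ^+ 2)) 0.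
  have h1 : is_derive u (1 : R) (fun u : R => s ^+ 2 / 2 * u ^+ 2) (s ^+ 2 * u).
    have -> : (fun u : R => s ^+ 2 / 2 * u ^+ 2) =
      (fun u : R => (s ^+ 2 / 2) *: u ^+ 2) by [].
    by apply: is_derive_eq; rewrite /GRing.scale/= !mulr1; field.
  have h2 := is_derive1_comp (f := expR) (g := fun u : R => s ^+ 2 / 2 * u ^+ 2)
    (is_derive_expR _) h1.
  by apply: (is_derive_eq (is_deriveM (dphi u) h2)); rewrite /GRing.scale/=; ring.
have := is_derive_0_is_cst t 0 dpsi.
rewrite expr0n/= mulr0 expR0 mulr1.
have -> : phi 0 = cos a.
  rewrite /phi (@eq_Rintegral _ _ _ mu setT (fun x => cos a * p x)); last first.
    by move=> x _; rewrite mul0r add0r.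
  rewrite RintegralZl//; last exact: integrable_normal_pdf.
  by rewrite normal_mass mulr1.
move=> <-; rewrite -[RHS]mulrA -expRD.
by rewrite (_ : _ + _ = 0) ?expR0 ?mulr1//; field.
Qed.

End gaussian_density.

(** * Lipschitz functions, expectations, and uniqueness from cosines *)

Lemma derivative_bound_lipschitz (R : realType) (f df : R -> R) (K x y : R) :
  (forall z : R, is_derive z (1 : R) f (df z)) -> (forall z, `|df z| <= K) ->
  `|f x - f y| <= K * `|x - y|.
Proof.
move=> fdf dfK; wlog yx : x y / y <= x.
  by move=> W; have /orP[/W//|/W] := le_total y x; rewrite distrC (distrC y).
have [|c _ ->] := @MVT_segment R f df y x yx; last first.
  by rewrite normrM ler_wpM2r.
apply: continuous_subspaceT => z.
by apply/differentiable_continuous/derivable1_diffP; apply: ex_derive.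
Qed.

Lemma cvg_dist_le (R : realType) (a r : nat -> R) (l : R) :
  (forall n, `|a n - l| <= r n) -> r n @[n --> \oo] --> 0 -> a n @[n --> \oo] --> l.
Proof.
move=> ar r0; apply/subr_cvg0/norm_cvg0P.
by apply: (@squeeze_cvgr _ _ _ _ (cst 0) r) => //; [apply: nearW => n; rewrite normr_ge0/=|exact: cvg_cst].
Qed.

Section bernstein.
Context {R : realType}.

(** Mean of h over a binomial variable with parameters N and z, as a random walk. *)
Fixpoint bern (z : R) (N : nat) (h : nat -> R) : R :=
  if N is N'.+1 then z * bern z N' (fun c => h c.+1) + (1 - z) * bern z N' h
  else h 0%N.

Lemma bern_le (z : R) N (h g : nat -> R) : 0 <= z <= 1 ->
  (forall c, h c <= g c) -> bern z N h <= bern z N g.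
Proof.
move=> /andP[z0 z1]; elim: N h g => [|N IH] h g hg /=; first exact: hg.
apply: lerD; apply: ler_wpM2l; rewrite ?subr_ge0//; apply: IH => // c; exact: hg.
Qed.

Lemma bern_cst (z c : R) N : bern z N (fun=> c) = c.
Proof. by elim: N => //= N ->; ring. Qed.

Lemma bern_affine (z a b : R) N (h : nat -> R) :
  bern z N (fun c => a + b * h c) = a + b * bern z N h.
Proof. by elim: N h => [|N IH] h //=; rewrite !IH; ring. Qed.

Lemma bern_var (z e : R) N :
  bern z N (fun c => (c%:R - e) ^+ 2) = N%:R * z * (1 - z) + (N%:R * z - e) ^+ 2.
Proof.
elim: N e => [|N IH] e /=; first by rewrite !mul0r !add0r.
rewrite IH (_ : (fun c => (c.+1%:R - e) ^+ 2) = (fun c => (c%:R - (e - 1)) ^+ 2)).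
  by rewrite IH -natr1; ring.
by apply/funext => c; rewrite -natr1; congr (_ ^+ 2); ring.
Qed.

(** The points (2 c / n^4 - 1) n, weighted by the binomial law of parameters
    n^4 and z, concentrate at n (2 z - 1) up to an error of order 1 / n. *)
Lemma bern_concentration (z a y L : R) n (h : nat -> R) : (1 <= n)%N -> 0 <= L ->
  0 <= z <= 1 ->
  (forall c, `|h c - a| <= L * `|(2 * c%:R / n%:R ^+ 4 - 1) * n%:R - y|) ->
  `|bern z (n ^ 4) h - a| <= L * (`|n%:R * (2 * z - 1) - y| + n%:R^-1).
Proof.
move=> n1 L0 z01 hL.
have n0 : 0 < n%:R :> R by rewrite ltr0n.
have nN : (n ^ 4)%:R = n%:R ^+ 4 :> R by rewrite natrX.
pose r := `|n%:R * (2 * z - 1) - y| + (2 * n%:R)^-1.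
pose q := 2 * n%:R ^- 5 : R.
have key c : `|h c - a| <= L * r + (L * q) * (c%:R - n%:R ^+ 4 * z) ^+ 2.
  apply: le_trans (hL c) _; set X := (_ - _) ^+ 2.
  rewrite (_ : _ + _ = L * (r + q * X)); last by ring.
  rewrite ler_wpM2l// /X.
  have -> : (2 * c%:R / n%:R ^+ 4 - 1) * n%:R - y =
     (n%:R * (2 * z - 1) - y) + 2 * n%:R ^- 3 * (c%:R - n%:R ^+ 4 * z).
    by field; rewrite gt_eqF.
  apply: le_trans (ler_normD _ _) _; rewrite -addrA lerD2l.
  set e := c%:R - _; rewrite -subr_ge0.
  have -> : (2 * n%:R)^-1 + q * e ^+ 2 - `|2 * n%:R ^- 3 * e| =
     (2 * n%:R)^-1 * (1 - 2 * n%:R ^- 2 * `|e|) ^+ 2.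
    rewrite normrM ger0_norm; last by rewrite mulr_ge0// invr_ge0 exprn_ge0// ltW.
    rewrite -[e ^+ 2]real_normK ?num_real// /q; field.
    by rewrite gt_eqF.
  by rewrite mulr_ge0 ?sqr_ge0// invr_ge0 mulr_ge0// ltW.
have var : bern z (n ^ 4) (fun c => L * r + (L * q) * (c%:R - n%:R ^+ 4 * z) ^+ 2)
    <= L * (`|n%:R * (2 * z - 1) - y| + n%:R^-1).
  rewrite bern_affine bern_var nN subrr expr0n/= addr0 -mulrA -mulrDr ler_wpM2l//.
  rewrite /r -addrA lerD2l.
  have -> : q * (n%:R ^+ 4 * z * (1 - z)) = n%:R^-1 * (2 * (z * (1 - z))).
    by rewrite /q; field; rewrite gt_eqF.
  rewrite invfM -[X in X + _]mulrC -mulrDr ger_pMr ?invr_gt0//.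
  by have := sqr_ge0 (z - 2^-1); nra.
rewrite ler_norml lerBlDr lerBrDl; apply/andP; split.
- apply: le_trans (bern_le (n ^ 4) z01 (fun c => _ : a + (-1) * (L * r +
      (L * q) * (c%:R - n%:R ^+ 4 * z) ^+ 2) <= h c)).
    by rewrite bern_affine mulN1r lerD2l lerN2.
  by move=> c; have := key c; rewrite ler_norml mulN1r; lra.
- apply: le_trans (bern_le (n ^ 4) z01 (fun c => _ : h c <= a + 1 * (L * r +
      (L * q) * (c%:R - n%:R ^+ 4 * z) ^+ 2))) _.
    by move=> c; have := key c; rewrite ler_norml mul1r; lra.
  by rewrite bern_affine mul1r addrC lerD2r.
Qed.

(** From the derivative of sin at 0. *)
Lemma cvg_sin_scale (y : R) : n%:R * sin (y / n%:R) @[n --> \oo] --> y.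
Proof.
have [->|y0] := eqVneq y 0.
  rewrite (_ : (fun n => _) = cst 0); first exact: cvg_cst.
  by apply/funext => n; rewrite mul0r sin0 mulr0.
have [g [gE gc g1]] := (is_derive1_caratheodory _ _ _).1 (is_derive_sin (0 : R)).
have H : y / n%:R @[n --> \oo] --> (0 : R).
  by apply: (@cvg0_le_inv _ `|y|) => n n1; rewrite normrM normfV normr_nat.
rewrite -(cvg_shiftS (fun n => n%:R * sin (y / n%:R))).
have -> : (fun n => n.+1%:R * sin (y / n.+1%:R)) = (fun n => y * g (y / n.+1%:R)).
  apply/funext => n; have := gE (y / n.+1%:R); rewrite sin0 !subr0 => ->.
  by rewrite mulrCA mulrC [_ * (y / _)]mulrCA divff ?mulr1// pnatr_eq0.
rewrite -(cvg_shiftS (fun n => y / n%:R)) in H.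
have := cvgM (cvg_cst y) (cvg_comp _ _ H gc).
by rewrite g1 cos0 mulr1; apply.
Qed.

End bernstein.

Section lipschitz_functions.
Context {R : realType}.
Local Notation l2 := (ell2 R nat).
Implicit Types f g : l2 -> R.

Definition lipf f : Prop :=
  exists2 L : R, 0 <= L & forall u v, `|f u - f v| <= L * `|u - v|.

Definition boundedf f : Prop := exists C : R, forall u, `|f u| <= C.

Lemma lipf_cst (c : R) : lipf (fun=> c).
Proof. by exists 0 => // u v; rewrite subrr normr0 mul0r. Qed.

Lemma lipf_add f g : lipf f -> lipf g -> lipf (fun u => f u + g u).
Proof.
move=> [L L0 Lf] [K K0 Kg]; exists (L + K) => [|u v]; first exact: addr_ge0.
rewrite opprD addrACA mulrDl; apply: le_trans (ler_normD _ _) _.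
exact: lerD.
Qed.

Lemma lipf_scale (c : R) f : lipf f -> lipf (fun u => c * f u).
Proof.
move=> [L L0 Lf]; exists (`|c| * L) => [|u v]; first exact: mulr_ge0.
by rewrite -mulrBr normrM -mulrA ler_wpM2l.
Qed.

Lemma lipf_sum (I : Type) (r : seq I) (f : I -> l2 -> R) :
  (forall i, lipf (f i)) -> lipf (fun u => \sum_(i <- r) f i u).
Proof.
move=> lf; elim: r => [|i r IH].
  by have [L L0 H] := lipf_cst 0; exists L => // u v; rewrite !big_nil; exact: H.
have [L L0 H] := lipf_add (lf i) IH; exists L => // u v.
by rewrite !big_cons; exact: H.
Qed.

Lemma lipf_mul f g : lipf f -> boundedf f -> lipf g -> boundedf g ->
  lipf (fun u => f u * g u).
Proof.
move=> [L L0 Lf] [C Cf] [K K0 Kg] [D Dg].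
have C0 : 0 <= C by apply: le_trans (Cf 0).
have D0 : 0 <= D by apply: le_trans (Dg 0).
exists (L * D + C * K) => [|u v]; first by rewrite addr_ge0// mulr_ge0.
have -> : f u * g u - f v * g v = (f u - f v) * g u + f v * (g u - g v) by ring.
apply: le_trans (ler_normD _ _) _; rewrite !normrM mulrDl lerD//.
  by rewrite mulrAC ler_pM.
by rewrite -mulrA ler_pM.
Qed.

Lemma boundedf_mul f g : boundedf f -> boundedf g -> boundedf (fun u => f u * g u).
Proof.
by move=> [C Cf] [D Dg]; exists (C * D) => u; rewrite normrM ler_pM.
Qed.

Lemma lipf_comp (h : R -> R) (K : R) f : 0 <= K ->
  (forall x y, `|h x - h y| <= K * `|x - y|) -> lipf f -> lipf (fun u => h (f u)).
Proof.
move=> K0 Kh [L L0 Lf]; exists (K * L) => [|u v]; first exact: mulr_ge0.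
by apply: le_trans (Kh _ _) _; rewrite -mulrA ler_wpM2l.
Qed.

Lemma sin_lipschitz (x y : R) : `|sin x - sin y| <= 1 * `|x - y|.
Proof.
apply: (@derivative_bound_lipschitz _ _ cos); last by move=> z; exact: norm_cos_le1.
Qed.

Lemma cos_lipschitz (x y : R) : `|cos x - cos y| <= 1 * `|x - y|.
Proof.
have E z : cos z = sin (z + pi / 2) by rewrite sinDpihalf.
by rewrite !E; apply: le_trans (sin_lipschitz _ _) _; rewrite opprD addrACA subrr addr0.
Qed.

(** Linear forms in the coordinates from n on, so that in an induction over n the
    dependence on the coordinates before n can be arbitrary. *)
Definition linf (n M : nat) (eta : nat -> R) (u : l2) : R :=
  \sum_(n <= p < M) eta p * u p.

Lemma linfD n M eta u v : linf n M eta (u + v) = linf n M eta u + linf n M eta v.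
Proof. by rewrite /linf -big_split/=; apply: eq_bigr => p _; exact: (mulrDr (eta p) (u p) (v p)). Qed.

Lemma linfZ n M eta c u : linf n M eta (c *: u) = c * linf n M eta u.
Proof. by rewrite /linf big_distrr/=; apply: eq_bigr => p _; exact: (mulrCA (eta p) c (u p)). Qed.

Lemma lipf_coord p : lipf (fun u => u p).
Proof. by exists 1 => // u v; rewrite mul1r; exact: (ell2_coord_le (u - v)). Qed.

Lemma lipf_linf n M eta : lipf (linf n M eta).
Proof.
by apply: lipf_sum => p; apply: lipf_scale; exact: lipf_coord.
Qed.

Lemma lipf_growth f : lipf f -> exists2 C, 0 <= C & forall u, `|f u| <= C * (1 + `|u|).
Proof.
move=> [L L0 Lf]; exists (`|f 0| + L) => [|u]; first exact: addr_ge0.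
have := Lf u 0; rewrite subr0 => H.
apply: le_trans (_ : `|f 0| + L * `|u| <= _).
  by rewrite -{1}(subrK (f 0) (f u)) addrC (le_trans (ler_normD _ _))// lerD2l.
by have := normr_ge0 (f 0); have := normr_ge0 u; nra.
Qed.

Lemma lipf_continuous f : lipf f -> continuous f.
Proof. by move=> [L _ Lf]; exact: (@lipschitz_fun_continuous _ _ _ _ L). Qed.

Lemma lipf_measurable f : lipf f -> measurable_fun [set: l2] f.
Proof.
move=> /lipf_continuous /continuousP cf.
apply: (measurability _ (RGenOpens.measurableE R)) => _ [_ [a [b ->] <-]].
by apply: measurableI => //; apply: sub_sigma_algebra; apply: cf; exact: interval_open.
Qed.

End lipschitz_functions.

Section gaussian_averages.
Context {R : realType}.
Local Notation l2 := (ell2 R nat).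
Local Notation mu := (@lebesgue_measure R).
Local Notation p := (@normal_pdf R 0 1).
Implicit Types f g : l2 -> R.

(** Convolution with the law of x *: w for a standard normal x. *)
Definition avg (w : l2) f (u : l2) : R := \int[mu]_x (f (u + x *: w) * p x).

Let one0 : (1 : R) != 0. Proof. exact: oner_neq0. Qed.

Lemma measurable_line f u w : lipf f -> measurable_fun [set: R] (fun x => f (u + x *: w)).
Proof.
move=> [L L0 Lf]; apply: continuous_measurable_fun.
apply: (@lipschitz_fun_continuous _ _ _ _ (L * `|w|)) => x y.
by apply: le_trans (Lf _ _) _; rewrite opprD addrACA subrr add0r -scalerBl normrZ
  -mulrA (mulrC `|w|).
Qed.

Lemma growth_line (C : R) (u w : l2) (x : R) : 0 <= C ->
  C * (1 + `|u + x *: w|) <= C * (1 + `|u| + `|w|) * (1 + `|x|).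
Proof.
move=> C0; rewrite -mulrA ler_wpM2l//.
have := ler_normD u (x *: w); rewrite normrZ.
by have := normr_ge0 u; have := normr_ge0 w; have := normr_ge0 x; nra.
Qed.

Lemma integrable_abs_normal : mu.-integrable [set: R] (EFin \o (fun x => (1 + `|x|) * p x)).
Proof.
apply: (@integrable_normal_poly _ 1 one0 _ 2) => [|x].
  by apply: measurable_funD => //; exact: normr_measurable.
rewrite ger0_norm ?addr_ge0//; have [] := poly4_ge x.
by have := exprn_even_ge0 (n := 4) x isT; lra.
Qed.

Lemma integrable_avg f u w : lipf f ->
  mu.-integrable [set: R] (EFin \o (fun x => f (u + x *: w) * p x)).
Proof.
move=> lf; have [C C0 fC] := lipf_growth lf.
apply: (@Rintegrable_le _ _ _ mu _ (fun x => (C * (1 + `|u| + `|w|)) * ((1 + `|x|) * p x))).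
- by apply: measurable_funM; [exact: measurable_line|exact: measurable_normal_pdf].
- move=> x; rewrite normrM (ger0_norm (normal_pdf_ge0 _ _ _)) mulrA.
  rewrite ler_wpM2r ?normal_pdf_ge0//.
  by apply: le_trans (fC _) _; exact: growth_line.
- by apply: Rintegrable_scale; exact: integrable_abs_normal.
Qed.

Lemma avg_cst w (c : R) u : avg w (fun=> c) u = c.
Proof.
by rewrite /avg RintegralZl ?normal_mass ?mulr1//; exact: integrable_normal_pdf.
Qed.

Lemma avgD w f g u : lipf f -> lipf g ->
  avg w (fun u => f u + g u) u = avg w f u + avg w g u.
Proof.
move=> lf lg; rewrite /avg -RintegralD//; [|exact: integrable_avg..].
by apply: eq_Rintegral => x _; rewrite mulrDl.
Qed.

Lemma avgZ w (c : R) f u : lipf f -> avg w (fun u => c * f u) u = c * avg w f u.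
Proof.
move=> lf; rewrite /avg -RintegralZl//; last exact: integrable_avg.
by apply: eq_Rintegral => x _; rewrite mulrA.
Qed.

Lemma avg_le w f g u : lipf f -> lipf g -> (forall v, f v <= g v) ->
  avg w f u <= avg w g u.
Proof.
move=> lf lg fg; apply: le_Rintegral => //; [exact: integrable_avg..|].
by move=> x _; rewrite ler_wpM2r ?normal_pdf_ge0.
Qed.

Lemma avg_lipf w f : lipf f -> lipf (avg w f).
Proof.
move=> lf; have [L L0 Lf] := lf; exists L => // u v.
rewrite /avg -RintegralB//; [|exact: integrable_avg..].
apply: (le_trans (@normr_Rintegral_le _ _ _ mu _ (fun x => L * `|u - v| * p x) _ _ _)).
- by apply: Rintegrable_sub; exact: integrable_avg.
- by apply: Rintegrable_scale; exact: integrable_normal_pdf.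
- move=> x; rewrite -mulrBl normrM (ger0_norm (normal_pdf_ge0 _ _ _)).
  rewrite ler_wpM2r ?normal_pdf_ge0//; apply: le_trans (Lf _ _) _.
  by rewrite opprD addrACA subrr addr0.
- by rewrite RintegralZl ?normal_mass ?mulr1//; exact: integrable_normal_pdf.
Qed.

Lemma avg_dominated w (fn : nat -> l2 -> R) f (C : R) : 0 <= C ->
  (forall n, lipf (fn n)) -> (forall n u, `|fn n u| <= C * (1 + `|u|)) ->
  (forall u, fn n u @[n --> \oo] --> f u) ->
  (forall u, avg w (fn n) u @[n --> \oo] --> avg w f u) /\
  exists2 D, 0 <= D & forall n u, `|avg w (fn n) u| <= D * (1 + `|u|).
Proof.
move=> C0 lfn fnC fnf.
pose G (u : l2) x := C * (1 + `|u| + `|w|) * ((1 + `|x|) * p x).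
have iG u : mu.-integrable [set: R] (EFin \o G u).
  by apply: Rintegrable_scale; exact: integrable_abs_normal.
have leG n u x : `|fn n (u + x *: w) * p x| <= G u x.
  rewrite /G normrM (ger0_norm (normal_pdf_ge0 _ _ _)) [leRHS]mulrA.
  rewrite ler_wpM2r ?normal_pdf_ge0//.
  by apply: le_trans (fnC _ _) _; exact: growth_line.
split=> [u|].
  have [||||_ //] := @Rintegral_dominated_cvg R _ _ mu
    (fun n x => fn n (u + x *: w) * p x) (fun x => f (u + x *: w) * p x) (G u) => //.
  - by move=> n; apply: measurable_funM; [exact: measurable_line|exact: measurable_normal_pdf].
  - by move=> x; apply: cvgM; [exact: fnf|exact: cvg_cst].
pose I := \int[mu]_x ((1 + `|x|) * p x).
have I0 : 0 <= I.
  by apply: Rintegral_ge0 => x _; rewrite mulr_ge0 ?normal_pdf_ge0 ?addr_ge0.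
exists (C * (1 + `|w|) * I) => [|n u]; first by rewrite !mulr_ge0 ?addr_ge0.
apply: le_trans (normr_Rintegral_le _ (iG u) (leG n u)) _.
  exact: integrable_avg.
rewrite /G RintegralZl//; last exact: integrable_abs_normal.
rewrite -[X in _ * X <= _]/I [leRHS]mulrAC ler_wpM2r// -mulrA ler_wpM2l//.
by have := normr_ge0 u; have := normr_ge0 w; nra.
Qed.

Lemma avg_cos w n M eta (a : R) u :
  avg w (fun u => cos (linf n M eta u + a)) u =
  expR (- (linf n M eta w ^+ 2) / 2) * cos (linf n M eta u + a).
Proof.
rewrite /avg (@eq_Rintegral _ _ _ mu setT
  (fun x => cos (linf n M eta w * x + (linf n M eta u + a)) * p x)); last first.
  by move=> x _; rewrite linfD linfZ; congr (cos _ * _); ring.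
by rewrite normal_charfun// expr1n mul1r mulrC.
Qed.

End gaussian_averages.

Section coordinate_projections.
Context {R : realType}.
Local Notation l2 := (ell2 R nat).

Definition finvec (M : nat) (c : nat -> R) : l2 := \sum_(p < M) c p *: delta p.

Lemma finvecE M c q : finvec M c q = if (q < M)%N then c q else 0.
Proof.
rewrite /finvec ell2_sumE.
rewrite (eq_bigr (fun p : 'I_M => if (q == p :> nat) then c q else 0)); last first.
  move=> p _; rewrite -[LHS]/(c p * (q == p :> nat)%:R).
  by case: eqP => [->|_]; rewrite ?mulr1 ?mulr0.
rewrite -big_mkcond/=; case: ifP => qM; last first.
  by rewrite big_pred0// => p; apply/negP => /eqP qp; rewrite qp ltn_ord in qM.
by rewrite (big_pred1 (Ordinal qM))// => p; rewrite -val_eqE/= eq_sym.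
Qed.

Definition proj (k : nat) (u : l2) : l2 := finvec k u.

Lemma projE k u q : proj k u q = if (q < k)%N then u q else 0.
Proof. exact: finvecE. Qed.

Lemma norm_delta_le p : `|delta p : l2| <= 1.
Proof.
apply: ell2_le_normP => // s us.
rewrite expr1n; apply: le_trans (_ : \sum_(i <- s | i == p) 1 <= _).
  rewrite [leRHS]big_mkcond/=; apply: ler_sum => i _.
  rewrite /=.
  by case: eqP => _; rewrite ?expr1n ?expr0n.
rewrite big_const_seq iter_addr_0.
by rewrite (count_uniq_mem p us); case: (p \in s); rewrite /= ?ler01.
Qed.

Lemma proj_norm_le k u v : `|proj k u - proj k v| <= `|u - v|.
Proof.
apply: ell2_le_normP => // s us.
apply: le_trans (ell2_sum_le (u - v) us); apply: ler_sum => q _.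
rewrite -[_ q]/(proj k u q - proj k v q) !projE -[(u - v) q]/(u q - v q).
by case: ifP => // _; rewrite subrr expr0n sqr_ge0.
Qed.

Lemma norm_proj_le k u : `|proj k u| <= `|u|.
Proof.
have := proj_norm_le k u 0; rewrite subr0 (_ : proj k 0 = 0) ?subr0//.
by rewrite /proj /finvec big1// => p _; rewrite scale0r.
Qed.

End coordinate_projections.

Section positive_functionals.
Context {R : realType}.
Local Notation l2 := (ell2 R nat).
Implicit Types (f g : l2 -> R) (Lam : (l2 -> R) -> R).

(** What is used of an expectation. Integrals against laws with a first moment
    qualify, and the class is stable under composition with [avg], so that
    Gaussian perturbations of a law are available without constructing measures
    on l^2. *)
Record expectation Lam : Prop := Expectation {
  expectationD : forall f g, lipf f -> lipf g ->
    Lam (fun u => f u + g u) = Lam f + Lam g ;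
  expectationZ : forall c f, lipf f -> Lam (fun u => c * f u) = c * Lam f ;
  expectation_cst : forall c, Lam (fun=> c) = c ;
  expectation_le : forall f g, lipf f -> lipf g -> (forall u, f u <= g u) ->
    Lam f <= Lam g ;
  expectation_cvg : forall (fn : nat -> l2 -> R) f C, 0 <= C ->
    (forall n, lipf (fn n)) -> lipf f ->
    (forall n u, `|fn n u| <= C * (1 + `|u|)) ->
    (forall u, fn n u @[n --> \oo] --> f u) -> Lam (fn n) @[n --> \oo] --> Lam f }.

Lemma expectation_avg Lam w : expectation Lam -> expectation (fun f => Lam (avg w f)).
Proof.
move=> [D Z K L V]; split.
- move=> f g lf lg; rewrite -D; [|exact: avg_lipf..].
  by congr Lam; apply/funext => u; exact: avgD.
- move=> c f lf; rewrite -Z; last exact: avg_lipf.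
  by congr Lam; apply/funext => u; exact: avgZ.
- by move=> c; rewrite -[RHS]K; congr Lam; apply/funext => u; exact: avg_cst.
- move=> f g lf lg fg; apply: L; [exact: avg_lipf..|].
  by move=> u; exact: avg_le.
- move=> fn f C C0 lfn lf fnC fnf.
  have [H1 [E E0 H2]] := avg_dominated w C0 lfn fnC fnf.
  by apply: (V _ _ E) => // [n|]; exact: avg_lipf.
Qed.

Lemma expectation_integral (m : probability l2 R) :
  m.-integrable [set: l2] (EFin \o (fun u : l2 => `|u|)) ->
  expectation (fun f => \int[m]_u f u).
Proof.
move=> im.
have i1 C : m.-integrable [set: l2] (EFin \o (fun u : l2 => C * (1 + `|u|))).
  apply: Rintegrable_scale; apply: Rintegrable_add => //.
  by apply: finite_measure_integrable_cst.
have il f : lipf f -> m.-integrable [set: l2] (EFin \o f).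
  move=> lf; have [C C0 fC] := lipf_growth lf.
  by apply: Rintegrable_le fC (i1 C); exact: lipf_measurable.
split.
- by move=> f g lf lg; rewrite RintegralD//; exact: il.
- by move=> c f lf; rewrite RintegralZl//; exact: il.
- by move=> c; rewrite Rintegral_cst//= probability_setT mulr1.
- by move=> f g lf lg fg; apply: le_Rintegral => //; exact: il.
- move=> fn f C C0 lfn lf fnC fnf.
  have [||||_ //] := @Rintegral_dominated_cvg R _ _ m fn f (fun u => C * (1 + `|u|)) => //.
  by move=> n; exact: lipf_measurable.
Qed.

Section uniqueness.
Variables (L1 L2 : (l2 -> R) -> R) (E1 : expectation L1) (E2 : expectation L2).
Variable M : nat.
Hypothesis charfunE : forall eta a,
  L1 (fun u => cos (linf 0 M eta u + a)) = L2 (fun u => cos (linf 0 M eta u + a)).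

Let agree f := [/\ lipf f, boundedf f & L1 f = L2 f].

Let agreeD f g : agree f -> agree g -> agree (fun u => f u + g u).
Proof.
move=> [l1 [C b1] e1] [l2 [D b2] e2]; split; first exact: lipf_add.
  by exists (C + D) => u; rewrite (le_trans (ler_normD _ _))// lerD.
by rewrite (expectationD E1)// (expectationD E2)// e1 e2.
Qed.

Let agreeZ c f : agree f -> agree (fun u => c * f u).
Proof.
move=> [l1 [C b1] e1]; split; first exact: lipf_scale.
  by exists (`|c| * C) => u; rewrite normrM ler_wpM2l.
by rewrite (expectationZ E1)// (expectationZ E2)// e1.
Qed.

Let local k f := [/\ lipf f, boundedf f &
  forall u v : l2, (forall p, (p < k)%N -> u p = v p) -> f u = f v].

Let local_agree k := forall f eta a, local k f ->
  agree (fun u => f u * cos (linf k M eta u + a)).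

Let zfun k n (u : l2) : R := 2^-1 * (1 + sin (u k / n%:R)).

Let zfun01 k n u : 0 <= zfun k n u <= 1.
Proof.
by rewrite /zfun; have := sin_geN1 (u k / n%:R); have := sin_le1 (u k / n%:R); lra.
Qed.

(** Multiplication by 1 + sin (u_k / n) maps cosines of linear forms to linear
    combinations of such cosines, so one factor is added at a time to the
    polynomial in that sine. *)
Let bern_agree k n N (h : nat -> l2 -> R) eta a : local_agree k -> (k < M)%N ->
  (forall c, local k (h c)) ->
  agree (fun u => bern (zfun k n u) N (fun c => h c u) * cos (linf k M eta u + a)).
Proof.
move=> lk kM; elim: N h eta a => [|N IH] h eta a lh; first exact: (lk (h 0%N) eta a (lh 0%N)).
pose s : nat -> R := fun p => if p == k then n%:R^-1 else 0.
have sE (b : R) u : linf k M (fun p => eta p + b * s p) u =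
    linf k M eta u + b * (u k / n%:R).
  rewrite /linf [LHS]big_ltn// [in RHS]big_ltn// {1}/s eqxx.
  rewrite (@eq_big_nat _ _ _ k.+1 M _ (fun p => eta p * u p)); last first.
    by move=> p /andP[kp _]; rewrite /s gtn_eqF// mulr0 addr0.
  ring.
have trig u : zfun k n u * cos (linf k M eta u + a) =
    2^-1 * cos (linf k M eta u + a) +
    (4^-1 * cos (linf k M (fun p => eta p + 1 * s p) u + (a - pi / 2)) +
    - 4^-1 * cos (linf k M (fun p => eta p + (-1) * s p) u + (a - pi / 2))).
  rewrite !sE !mul1r !mulN1r.
  set b := linf k M eta u; set y := u k / n%:R.
  have -> : b + y + (a - pi / 2) = (b + a + y) - pi / 2 by ring.
  have -> : b - y + (a - pi / 2) = (b + a - y) - pi / 2 by ring.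
  rewrite !cosB !cos_pihalf !sin_pihalf !mulr0 !mulr1 !add0r !sinD cosN sinN /zfun -/y.
  by field.
have H1 b c := IH (fun c => h c.+1) b c (fun c => lh c.+1).
have H2 b c := IH h b c lh.
have -> : (fun u => bern (zfun k n u) N.+1 (fun c => h c u) *
      cos (linf k M eta u + a)) = (fun u =>
    (2^-1 * (bern (zfun k n u) N (fun c => h c.+1 u) * cos (linf k M eta u + a)) +
    (4^-1 * (bern (zfun k n u) N (fun c => h c.+1 u) *
       cos (linf k M (fun p => eta p + 1 * s p) u + (a - pi / 2))) +
    - 4^-1 * (bern (zfun k n u) N (fun c => h c.+1 u) *
       cos (linf k M (fun p => eta p + (-1) * s p) u + (a - pi / 2))))) +
    (2^-1 * (bern (zfun k n u) N (fun c => h c u) * cos (linf k M eta u + a)) +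
    (- 4^-1 * (bern (zfun k n u) N (fun c => h c u) *
       cos (linf k M (fun p => eta p + 1 * s p) u + (a - pi / 2))) +
    4^-1 * (bern (zfun k n u) N (fun c => h c u) *
       cos (linf k M (fun p => eta p + (-1) * s p) u + (a - pi / 2)))))).
  apply/funext => u /=; move: (trig u).
  set X := cos (linf k M eta u + a); set Y := cos _; set Z := cos _.
  set B := bern _ _ _; set B' := bern _ _ _; move: (zfun k n u) => z zE.
  have -> : (z * B + (1 - z) * B') * X = B * (z * X) + B' * (X - z * X) by ring.
  by rewrite zE; field.
by do !(apply: agreeD || apply: agreeZ || apply: H1 || apply: H2).
Qed.

(** The coordinate u k is replaced by n sin (u k / n), and the dependence of f on
    it by a Bernstein polynomial of degree n^4 in (1 + sin (u k / n)) / 2; both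
    approximations become exact as n grows. *)
Let local_agree_step k : (k < M)%N -> local_agree k -> local_agree k.+1.
Proof.
move=> kM lk f eta a [lf bf locf].
have cosl : lipf (fun u => cos (linf k.+1 M eta u + a)).
  apply: (@lipf_comp _ cos 1) => //; first exact: cos_lipschitz.
  by apply: lipf_add; [exact: lipf_linf|exact: lipf_cst].
have cosb : boundedf (fun u => cos (linf k.+1 M eta u + a)).
  by exists 1 => u; exact: norm_cos_le1.
have lfc := lipf_mul lf bf cosl cosb.
split => //; first exact: boundedf_mul.
(* the values of n sin (u k / n) when its normalization to [0, 1] is c / n^4 *)
pose pt n c : R := (2 * c%:R / n%:R ^+ 4 - 1) * n%:R.
pose h n c u := f (proj k u + pt n c *: delta k).
have [L L0 Lf] := lf; have [C Cf] := bf.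
have C0 : 0 <= C by apply: le_trans (Cf 0).
have lh n c : local k (h n c).
  split.
  - exists L => // u v; apply: le_trans (Lf _ _) _.
    by rewrite opprD addrACA subrr addr0 ler_wpM2l// proj_norm_le.
  - by exists C => u; exact: Cf.
  - move=> u v uv; congr (f (_ + _)); apply: eq_bigr => p _.
    by rewrite uv.
pose eta' p := if p == k then 0 else eta p.
have eta'E u : linf k.+1 M eta u = linf k M eta' u.
  rewrite /linf [RHS]big_ltn// {1}/eta' eqxx mul0r add0r.
  by apply: eq_big_nat => p /andP[kp _]; rewrite /eta' gtn_eqF.
pose fn n u := bern (zfun k n.+1 u) (n.+1 ^ 4) (fun c => h n.+1 c u) *
  cos (linf k M eta' u + a).
have fnA n : agree (fn n) by apply: bern_agree.
have fnC n u : `|fn n u| <= C * (1 + `|u|).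
  apply: le_trans (_ : C * 1 <= _); last by rewrite ler_wpM2l// lerDl.
  rewrite normrM ler_pM// ?norm_cos_le1//.
  rewrite ler_norml -[in X in X && _](bern_cst (zfun k n.+1 u) (- C) (n.+1 ^ 4)).
  rewrite -[in X in _ && X](bern_cst (zfun k n.+1 u) C (n.+1 ^ 4)).
  by apply/andP; split; apply: bern_le => // c; have := Cf (proj k u + pt n.+1 c *: delta k);
    rewrite ler_norml /h => /andP[].
have fnf u : fn n u @[n --> \oo] --> f u * cos (linf k.+1 M eta u + a).
  rewrite eta'E; apply: cvgM; last exact: cvg_cst.
  have fE : f u = f (proj k u + u k *: delta k).
    apply: locf => q; rewrite -[RHS]/(proj k u q + u k * (q == k)%:R) projE ltnS leq_eqVlt.
    by case: eqP => [->|_] /=; [rewrite ltnn add0r mulr1|rewrite mulr0 addr0 => ->].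
  have hc n : `|bern (zfun k n.+1 u) (n.+1 ^ 4) (fun c => h n.+1 c u) - f u| <=
      L * (`|n.+1%:R * (2 * zfun k n.+1 u - 1) - u k| + n.+1%:R^-1).
    apply: bern_concentration => // c; rewrite fE.
    apply: le_trans (Lf _ _) _; rewrite opprD addrACA subrr add0r -scalerBl normrZ.
    by rewrite ler_wpM2l// ler_piMr// norm_delta_le.
  apply: (cvg_dist_le hc); rewrite -(mulr0 L); apply: cvgM; first exact: cvg_cst.
  rewrite -(addr0 0); apply: cvgD; last exact: cvg_harmonic.
  have := @cvg_sin_scale R (u k).
  rewrite -(cvg_shiftS (fun n => n%:R * sin (u k / n%:R))) => H.
  have H2 : n.+1%:R * sin (u k / n.+1%:R) - u k @[n --> \oo] --> 0.
    by rewrite -(subrr (u k)); apply: cvgB; [exact: H|exact: cvg_cst].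
  have E n : `|n.+1%:R * (2 * zfun k n.+1 u - 1) - u k| =
      `|n.+1%:R * sin (u k / n.+1%:R) - u k|.
    by rewrite /zfun; congr `| n.+1%:R * _ - _|; field.
  by rewrite (funext E); apply/norm_cvg0P.
have V1 := expectation_cvg E1 C0 (fun n => let: And3 l _ _ := fnA n in l) lfc fnC fnf.
have V2 := expectation_cvg E2 C0 (fun n => let: And3 l _ _ := fnA n in l) lfc fnC fnf.
rewrite -(cvg_lim (@Rhausdorff R) V1) -(cvg_lim (@Rhausdorff R) V2).
by congr (limn _); apply/funext => n; have [] := fnA n.
Qed.

Let all_agree k : (k <= M)%N -> local_agree k.
Proof.
elim: k => [_|k IH kM]; last by apply: local_agree_step => //; apply: IH; exact: ltnW.
move=> f eta a [lf bf locf].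
have -> : (fun u => f u * cos (linf 0 M eta u + a)) =
    (fun u => f 0 * cos (linf 0 M eta u + a)).
  by apply/funext => u; rewrite (locf u 0).
apply: agreeZ; split; last exact: charfunE.
  apply: (@lipf_comp _ cos 1) => //; first exact: cos_lipschitz.
  by apply: lipf_add; [exact: lipf_linf|exact: lipf_cst].
by exists 1 => u; exact: norm_cos_le1.
Qed.

(** Functions of the first M coordinates are reached from trigonometric
    polynomials one coordinate at a time: bern_concentration approximates the
    dependence on one coordinate by trigonometric polynomials. *)
Lemma expectation_unique f : lipf f ->
  (forall u v : l2, (forall p, (p < M)%N -> u p = v p) -> f u = f v) -> L1 f = L2 f.
Proof.
move=> lf locf.
have bounded_case g : local M g -> L1 g = L2 g.
  move=> /(all_agree (leqnn M) (fun=> 0) 0)[_ _].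
  rewrite (_ : (fun u => g u * _) = g)//.
  by apply/funext => u; rewrite /linf big_geq// addr0 cos0 mulr1.
have [C C0 fC] := lipf_growth lf.
pose tr (n : nat) (y : R) := Num.max (- n%:R) (Num.min n%:R y).
have trE n z : [\/ tr n z = n%:R /\ n%:R <= z, tr n z = - n%:R /\ z <= - n%:R |
    tr n z = z /\ - n%:R <= z <= n%:R].
  have n0 := ler0n R n; rewrite /tr.
  have [h1|h1] := lerP n%:R z.
    by rewrite max_r; [constructor 1|lra].
  by have [h2|h2] := lerP (- n%:R) z; [constructor 3|constructor 2]; split; lra.
have tr_lip n x y : `|tr n x - tr n y| <= 1 * `|x - y|.
  have n0 := ler0n R n; have := ler_norm (x - y); have := ler_norm (y - x).
  rewrite mul1r (distrC y x) => h1 h2; rewrite ler_norml.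
  by case: (trE n x) => -[-> ?]; case: (trE n y) => -[-> ?]; lra.
have tr_le n y : `|tr n y| <= `|y|.
  have n0 := ler0n R n; have h1 := ler_norm y; have := ler_norm (- y).
  by rewrite normrN => h2; rewrite ler_norml; case: (trE n y) => -[-> ?]; lra.
have tr_leC n y : `|tr n y| <= n%:R.
  have n0 := ler0n R n; rewrite ler_norml.
  by case: (trE n y) => -[-> ?]; lra.
have V (L : (l2 -> R) -> R) : expectation L ->
    L (fun u => tr n (f u)) @[n --> \oo] --> L f.
  move=> E; apply: (expectation_cvg E C0) => //.
  - by move=> n; exact: (@lipf_comp _ (tr n) 1).
  - by move=> n u; exact: le_trans (tr_le _ _) (fC u).
  - move=> u; apply: cvg_near_cst; near=> n.
    have : `|f u| <= n%:R.
      near: n; exists (Num.bound `|f u|) => // n /= Nn.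
      by apply: le_trans (ltW (archi_boundP _)) _; rewrite ?ler_nat.
    by rewrite ler_norml /tr => /andP[h1 h2]; rewrite min_r// max_r.
rewrite -(cvg_lim (@Rhausdorff R) (V _ E1)) -(cvg_lim (@Rhausdorff R) (V _ E2)).
congr (limn _); apply/funext => n; apply: bounded_case; split.
- exact: (@lipf_comp _ (tr n) 1).
- by exists n%:R => u.
- by move=> u v uv; rewrite (locf _ _ uv).
Unshelve. all: by end_near. Qed.

End uniqueness.
End positive_functionals.

(** * First moments and transfer of integrals *)

Lemma cvg_sum_seq (R : realType) (I : Type) (r : seq I) (f : nat -> I -> R) (l : I -> R) :
  (forall i, f n i @[n --> \oo] --> l i) ->
  \sum_(i <- r) f n i @[n --> \oo] --> \sum_(i <- r) l i.
Proof.
move=> fl; elim: r => [|i r IH].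
  by rewrite big_nil; apply: cvg_near_cst; apply: nearW => n; rewrite big_nil.
rewrite big_cons (_ : (fun n => _) = (fun n => f n i + \sum_(j <- r) f n j)).
  by apply: cvgD; [exact: fl|exact: IH].
by apply/funext => n; rewrite big_cons.
Qed.

Lemma fatou_bound (R : realType) d (T : measurableType d)
    (mu : {measure set T -> \bar R}) (fn : nat -> T -> R) (f : T -> R) (C : R) :
  (forall n, measurable_fun setT (fn n)) -> (forall n x, 0 <= fn n x) ->
  (forall x, fn n x @[n --> \oo] --> f x) ->
  (forall n, \int[mu]_x (fn n x)%:E <= C%:E)%E ->
  (\int[mu]_x (f x)%:E <= C%:E)%E.
Proof.
move=> mfn fn0 fnf fnC.
have mf n : measurable_fun [set: T] (fun x => (fn n x)%:E) by exact/measurable_EFinP.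
have f0 n x : [set: T] x -> (0 <= (fn n x)%:E)%E by rewrite lee_fin.
have := @fatou _ T R mu setT measurableT (fun n x => (fn n x)%:E) mf f0.
rewrite (@eq_integral _ _ _ mu setT (fun x => (f x)%:E)); last first.
  move=> x _; have [] // := @cvg_limn_einf_sup R (fun n => (fn n x)%:E) (f x)%:E.
  by apply: cvg_EFin; [exact: nearW|exact: fnf].
move=> /le_trans; apply.
rewrite limn_einf_lim; apply: lime_le.
  exact: is_cvg_einfs.
apply: nearW => n; apply: le_trans (fnC n); apply: ereal_inf_lbound.
by exists n => /=.
Qed.

Lemma sum_sqr_le_dotp (R : realType) (u : ell2 R nat) N : \sum_(p < N) u p ^+ 2 <= dotp u u.
Proof.
refine (@cvg_ge_bound R (fun N => \sum_(p < N) u p * u p) _ _ N (@dotp_cvg R u u) _) => K NK.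
rewrite -(subnKC NK) big_split_ord/= -[leLHS]addr0 lerD//.
by apply: sumr_ge0 => i _; rewrite -expr2 sqr_ge0.
Qed.

Lemma norm_sqr_le_dotp (R : realType) (u : ell2 R nat) : `|u| ^+ 2 <= dotp u u.
Proof.
rewrite ell2_normE -lee_fin ell2_norm_sqr; apply: sqsum_nat_le => N.
exact: sum_sqr_le_dotp.
Qed.

Section square_moment.
Context {R : realType}.
Local Notation l2 := (ell2 R nat).
Variables (m : probability l2 R) (S : nat -> R) (C : R).
Hypothesis charfun_coord : forall p t,
  \int[m]_u cos (t * u p) = expR (- (t ^+ 2 * S p) / 2).
Hypothesis S_sum_le : forall N, \sum_(p < N) S p <= C.

Let integrable_cos t p : m.-integrable [set: l2] (EFin \o (fun u : l2 => cos (t * u p))).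
Proof.
apply: (@Rintegrable_le _ _ _ m _ (fun=> 1)) => [|u|].
- by apply: lipf_measurable; apply: (@lipf_comp _ cos 1) => //;
    [exact: cos_lipschitz|apply: lipf_scale; exact: lipf_coord].
- exact: norm_cos_le1.
- exact: finite_measure_integrable_cst.
Qed.

Let approx_moment N n : (\int[m]_u (\sum_(p < N)
  (2 * n.+1%:R * sin (u p / 2 / n.+1%:R)) ^+ 2)%:E <= C%:E)%E.
Proof.
have n0 : n.+1%:R != 0 :> R by rewrite pnatr_eq0.
pose c : R := 2 * n.+1%:R ^+ 2.
have c0 : 0 <= c by rewrite mulr_ge0 ?exprn_ge0.
have E (u : l2) : \sum_(p < N) (2 * n.+1%:R * sin (u p / 2 / n.+1%:R)) ^+ 2 =
    \sum_(p < N) c * (1 - cos (n.+1%:R^-1 * u p)).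
  apply: eq_bigr => p _.
  have -> : n.+1%:R^-1 * u p = u p / 2 / n.+1%:R + u p / 2 / n.+1%:R by field.
  set y := u p / 2 / _; rewrite cosD.
  have := cos2Dsin2 y; rewrite exprMn /c => Ey; rewrite -!expr2.
  have -> : cos y ^+ 2 = 1 - sin y ^+ 2 by rewrite -Ey; ring.
  by ring.
have i1 p : m.-integrable [set: l2] (EFin \o (fun u : l2 => c * (1 - cos (n.+1%:R^-1 * u p)))).
  apply: Rintegrable_scale; apply: Rintegrable_sub => //.
  exact: finite_measure_integrable_cst.
have int1 : \int[m]__ (1 : R) = 1 by rewrite Rintegral_cst//= probability_setT mul1r.
have H K : m.-integrable [set: l2]
    (EFin \o (fun u : l2 => \sum_(p < K) c * (1 - cos (n.+1%:R^-1 * u p)))) /\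
  \int[m]_u (\sum_(p < K) c * (1 - cos (n.+1%:R^-1 * u p))) <= \sum_(p < K) S p.
  elim: K => [|K [IH1 IH2]].
    rewrite big_ord0 (_ : (fun _ => _) = fun=> 0); last by apply/funext => u; rewrite big_ord0.
    split; first exact: finite_measure_integrable_cst.
    by rewrite Rintegral_cst//= mul0r.
  rewrite big_ord_recr/= (_ : (fun _ => _) = (fun u : l2 =>
    \sum_(p < K) c * (1 - cos (n.+1%:R^-1 * u p)) + c * (1 - cos (n.+1%:R^-1 * u K)))); last first.
    by apply/funext => u; rewrite big_ord_recr.
  split; first exact: Rintegrable_add.
  rewrite RintegralD// lerD// RintegralZl//; last first.
    by apply: Rintegrable_sub => //; exact: finite_measure_integrable_cst.
  rewrite RintegralB//; last exact: finite_measure_integrable_cst.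
  rewrite int1 charfun_coord.
  have := expR_ge1Dx (- (n.+1%:R^-1 ^+ 2 * S K) / 2) => h.
  apply: le_trans (_ : c * (n.+1%:R^-1 ^+ 2 * S K / 2) <= _).
    apply: (ler_wpM2l c0); clear -h; move: h.
    by rewrite mulNr lerBlDr lerBlDl.
  by rewrite /c le_eqVlt; apply/orP; left; apply/eqP; field.
have [iN leN] := H N.
rewrite (@eq_integral _ _ _ m setT (EFin \o (fun u : l2 => \sum_(p < N) c * (1 - cos (n.+1%:R^-1 * u p))))).
  rewrite -[leLHS]fineK; last exact: integrable_fin_num iN.
  by rewrite lee_fin (le_trans leN).
by move=> u _; rewrite E.
Qed.

(** The second moment is recovered from the characteristic function by Fatou
    applied to the second differences 2 (1 - cos (t u)) / t^2, whose integrals are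
    bounded by the variance. *)
Lemma integrable_norm_charfun :
  m.-integrable [set: l2] (EFin \o (fun u : l2 => `|u|)).
Proof.
have step1 N : (\int[m]_u (\sum_(p < N) (u p) ^+ 2)%:E <= C%:E)%E.
  apply: fatou_bound (approx_moment N) => [n|n u|u].
  - apply: measurable_sum => p; apply: measurable_funX.
    apply: lipf_measurable; apply: lipf_scale.
    apply: (@lipf_comp _ sin 1) => //; first exact: sin_lipschitz.
    have := lipf_scale (2^-1 / n.+1%:R) (@lipf_coord R p).
    rewrite (_ : (fun u => _) = (fun u : l2 => u p / 2 / n.+1%:R))//.
    by apply/funext => u; rewrite mulrC mulrA.
  - by apply: sumr_ge0 => p _; exact: sqr_ge0.
  - apply: cvg_sum_seq => p.
    have H := @cvg_sin_scale R (u p / 2).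
    rewrite -(cvg_shiftS (fun n => n%:R * sin (u p / 2 / n%:R))) in H.
    have -> : u p ^+ 2 = (2 * (u p / 2)) * (2 * (u p / 2)) by field.
    rewrite (_ : (fun n => _) = (fun n => (2 * (n.+1%:R * sin (u p / 2 / n.+1%:R))) *
       (2 * (n.+1%:R * sin (u p / 2 / n.+1%:R))))); last first.
      by apply/funext => n; rewrite expr2 !mulrA.
    by apply: cvgM; apply: cvgM; [exact: cvg_cst|exact: H|exact: cvg_cst|exact: H].
have mnorm : measurable_fun [set: l2] (fun u : l2 => `|u|).
  apply: lipf_measurable; exists 1 => // u v; rewrite mul1r; exact: ler_dist_dist.
have step2 : (\int[m]_u (dotp u u)%:E <= C%:E)%E.
  apply: fatou_bound step1 => [N|N u|u].
  - by apply: measurable_sum => p; apply: measurable_funX; exact: lipf_measurable (@lipf_coord R p).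
  - by apply: sumr_ge0 => p _; exact: sqr_ge0.
  - exact: dotp_cvg.
have mdot : measurable_fun [set: l2] (fun u : l2 => dotp u u).
  apply: (measurable_fun_cvg (h := fun N (u : l2) => \sum_(p < N) u p * u p)).
  - by move=> N; apply: measurable_sum => p; apply: measurable_funM;
      exact: lipf_measurable (@lipf_coord R p).
  - by move=> u _; exact: dotp_cvg.
have i2 : m.-integrable [set: l2] (EFin \o (fun u : l2 => dotp u u)).
  apply/integrableP; split; first exact/measurable_EFinP.
  rewrite (@eq_integral _ _ _ m setT (fun u : l2 => (dotp u u)%:E)).
    exact: le_lt_trans step2 (ltry _).
  move=> u _; rewrite gee0_abs// lee_fin.
  exact: le_trans (sqr_ge0 _) (norm_sqr_le_dotp u).
apply: (@Rintegrable_le _ _ _ m _ (fun u : l2 => 1 + dotp u u)) => //.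
  move=> u; rewrite normr_id; apply: le_trans (_ : 1 + `|u| ^+ 2 <= _).
    by have := sqr_ge0 (`|u| - 1); have := normr_ge0 u; nra.
  by rewrite lerD2l norm_sqr_le_dotp.
by apply: Rintegrable_add => //; exact: finite_measure_integrable_cst.
Qed.

End square_moment.

(** Turns a bounded nonnegative function into a combination of indicators of its
    superlevel sets, up to a uniform error. *)
Lemma count_steps_le (R : realType) K (z : R) : 0 <= z -> z <= K%:R ->
  z - 1 <= \sum_(j < K) (j.+1%:R <= z)%R%:R <= z.
Proof.
move=> z0; elim: K => [|K IH] zK.
  by rewrite big_ord0 z0 andbT lerBlDr add0r (le_trans zK).
rewrite big_ord_recr/=; have [zK'|zK'] := lerP z K%:R.
  rewrite [(K.+1%:R <= z)]leNgt (le_lt_trans zK') ?ltr_nat//= addr0; exact: IH.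
rewrite (eq_bigr (fun=> 1)) ?sumr_const ?card_ord; last first.
  by move=> j _; rewrite (le_trans _ (ltW zK'))// ler_nat.
move: zK; rewrite -natr1 => zK.
by have [h|h] := lerP (K%:R + 1) z; rewrite /= ?mulr1n ?mulr0n; lra.
Qed.

Section bounded_measurable_transfer.
Context {R : realType}.
Context d1 (T1 : measurableType d1) (mu1 : {measure set T1 -> \bar R}).
Context d2 (T2 : measurableType d2) (mu2 : {measure set T2 -> \bar R}).
Local Notation mR := (measurableTypeR R).
Variables (x1 : T1 -> mR) (h1 : T1 -> R) (x2 : T2 -> mR) (h2 : T2 -> R).
Hypothesis (mx1 : measurable_fun [set: T1] x1) (mx2 : measurable_fun [set: T2] x2).
Hypothesis (ih1 : mu1.-integrable [set: T1] (EFin \o h1)).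
Hypothesis (ih2 : mu2.-integrable [set: T2] (EFin \o h2)).
Hypothesis agree_sets : forall A : set mR, measurable A ->
  \int[mu1]_x (\1_A (x1 x) * h1 x) = \int[mu2]_x (\1_A (x2 x) * h2 x).

Let integrable_weight d (T : measurableType d) (mu : {measure set T -> \bar R})
    (x : T -> mR) (h : T -> R) (f : mR -> R) (C : R) :
  measurable_fun [set: T] x -> mu.-integrable [set: T] (EFin \o h) ->
  measurable_fun [set: mR] f -> (forall y, `|f y| <= C) ->
  mu.-integrable [set: T] (EFin \o (fun t => f (x t) * h t)).
Proof.
move=> mx ih mf fC.
apply: (@Rintegrable_le _ _ _ mu _ (fun t => C * `|h t|)).
- apply: measurable_funM; first exact: (measurableT_comp mf mx).
  by apply/measurable_EFinP; case/integrableP : ih.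
- by move=> t; rewrite normrM ler_wpM2r.
- by apply: Rintegrable_scale; exact: (@integrable_norm _ _ _ mu _ h).
Qed.

Let good (f : mR -> R) := [/\ measurable_fun [set: mR] f,
  exists C, forall y, `|f y| <= C &
  \int[mu1]_x (f (x1 x) * h1 x) = \int[mu2]_x (f (x2 x) * h2 x)].

Let good_indic A : measurable A -> good \1_A.
Proof.
move=> mA; split; [exact: measurable_indic| |exact: agree_sets].
by exists 1 => y; rewrite indicE; case: (y \in A); rewrite ?normr1 ?normr0.
Qed.

Let good_lin (a : R) f g : good f -> good g -> good (fun y => a * f y + g y).
Proof.
move=> [mf [C fC] ef] [mg [D gD] eg].
have mafg : measurable_fun [set: mR] (fun y => a * f y + g y).
  by apply: measurable_funD => //; exact: measurable_funM.
split => //.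
  exists (`|a| * C + D) => y; apply: le_trans (ler_normD _ _) _.
  by rewrite lerD// normrM ler_wpM2l.
have E d (T : measurableType d) (mu : {measure set T -> \bar R})
    (x : T -> mR) (h : T -> R) : measurable_fun [set: T] x ->
    mu.-integrable [set: T] (EFin \o h) ->
    \int[mu]_t ((a * f (x t) + g (x t)) * h t) =
    a * \int[mu]_t (f (x t) * h t) + \int[mu]_t (g (x t) * h t).
  move=> mx ih.
  have i1 := integrable_weight mx ih mf fC; have i2 := integrable_weight mx ih mg gD.
  rewrite -RintegralZl// -RintegralD//; last exact: Rintegrable_scale.
  by apply: eq_Rintegral => t _; rewrite mulrDl mulrA.
by rewrite !E// ef eg.
Qed.

Let good_unit (f : mR -> R) : measurable_fun [set: mR] f -> (forall y, 0 <= f y <= 1) -> good f.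
Proof.
move=> mf f01.
pose A n j : set mR := [set y | j.+1%:R <= n%:R * f y].
have mA n j : measurable (A n j).
  have m1 : measurable_fun [set: mR] (fun y => n%:R * f y) by exact: measurable_funM.
  rewrite (_ : A n j = (fun y => n%:R * f y) @^-1` `[j.+1%:R, +oo[%classic).
    by rewrite -[X in measurable X]setTI; exact: m1.
  by apply/seteqP; split => y /=; rewrite in_itv/= andbT.
pose fn n (y : mR) : R := n.+1%:R^-1 * (\sum_(j < n.+1) \1_(A n.+1 j) y).
have g0 : good (fun=> 0).
  have := good_indic (@measurable0 _ mR).
  by rewrite (_ : \1_set0 = fun=> 0)//; apply/funext => y; rewrite indic0.
have gsum n K : good (fun y => \sum_(j < K) \1_(A n j) y).
  elim: K => [|K IH].
    by rewrite (_ : (fun y => _) = fun=> 0)//; apply/funext => y; rewrite big_ord0.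
  rewrite (_ : (fun y => _) = (fun y => 1 * \1_(A n K) y + \sum_(j < K) \1_(A n j) y)).
    exact: good_lin (good_indic _) IH.
  by apply/funext => y; rewrite big_ord_recr/= addrC mul1r.
have gfn n : good (fn n).
  rewrite (_ : fn n = fun y => n.+1%:R^-1 * (\sum_(j < n.+1) \1_(A n.+1 j) y) + 0).
    exact: good_lin.
  by apply/funext => y; rewrite addr0.
have AE n j y : \1_(A n j) y = (j.+1%:R <= n%:R * f y)%R%:R :> R.
  rewrite indicE; congr (_%:R).
  by case: (boolP (j.+1%:R <= n%:R * f y)) => h; [rewrite mem_set|rewrite memNset//; apply/negP].
have fnE n y : `|fn n y - f y| <= n.+1%:R^-1.
  have /andP[f0 f1] := f01 y.
  have n0 : 0 < n.+1%:R :> R by [].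
  have /andP[] := @count_steps_le _ n.+1 _ (mulr_ge0 (ltW n0) f0)
    (ler_piMr (ltW n0) f1).
  have -> : fn n y = n.+1%:R^-1 * \sum_(j < n.+1) (j.+1%:R <= n.+1%:R * f y)%R%:R.
    by rewrite /fn; congr (_ * _); apply: eq_bigr => j _; exact: AE.
  set s := \sum_(j < n.+1) _ => h h'.
  have -> : n.+1%:R^-1 * s - f y = n.+1%:R^-1 * (s - n.+1%:R * f y) by field.
  rewrite normrM gtr0_norm ?invr_gt0// ler_piMr ?invr_ge0 ?(ltW n0)//.
  by rewrite ler_norml; lra.
have fn2 n y : `|fn n y| <= 2.
  have := fnE n y; have /andP[f0 f1] := f01 y.
  have : n.+1%:R^-1 <= 1 :> R by rewrite invf_le1// ler1n.
  move=> le1 le2; rewrite -(subrK (f y) (fn n y)); apply: le_trans (ler_normD _ _) _.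
  rewrite -[2]/(1 + 1); apply: lerD; first exact: le_trans le2 le1.
  by rewrite ger0_norm.
have V d (T : measurableType d) (mu : {measure set T -> \bar R})
    (x : T -> mR) (h : T -> R) : measurable_fun [set: T] x ->
    mu.-integrable [set: T] (EFin \o h) ->
    \int[mu]_t (fn n (x t) * h t) @[n --> \oo] --> \int[mu]_t (f (x t) * h t).
  move=> mx ih.
  have [||||_ //] := @Rintegral_dominated_cvg R _ _ mu (fun n t => fn n (x t) * h t)
     (fun t => f (x t) * h t) (fun t => 2 * `|h t|).
  - move=> n; have [mfn _ _] := gfn n.
    apply: measurable_funM; first exact: (measurableT_comp mfn mx).
    by apply/measurable_EFinP; case/integrableP : ih.
  - by apply: Rintegrable_scale; exact: (@integrable_norm _ _ _ mu _ h).
  - by move=> n t; rewrite normrM ler_wpM2r.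
  - move=> t; apply: cvgM; last exact: cvg_cst.
    by apply: (cvg_dist_le (fun n => fnE n (x t))); exact: cvg_harmonic.
split => //.
  by exists 1 => y; rewrite ler_norml; have := f01 y; lra.
rewrite -(cvg_lim (@Rhausdorff R) (V _ _ _ _ _ mx1 ih1)).
rewrite -(cvg_lim (@Rhausdorff R) (V _ _ _ _ _ mx2 ih2)).
by congr (limn _); apply/funext => n; have [] := gfn n.
Qed.

(** Uniform approximation by combinations of indicators of superlevel sets, on
    which the hypothesis applies. The two measures may live on different spaces,
    and the densities h1 and h2 may change sign. *)
Lemma bounded_measurable_transfer (f : mR -> R) (C : R) :
  measurable_fun [set: mR] f -> (forall y, `|f y| <= C) ->
  \int[mu1]_x (f (x1 x) * h1 x) = \int[mu2]_x (f (x2 x) * h2 x).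
Proof.
move=> mf fC; pose K := C + 1.
have C0 : 0 <= C by apply: le_trans (fC 0).
have K0 : 0 < K by rewrite /K; lra.
have g1 : good (fun y => (2 * K)^-1 * (f y + K)).
  apply: good_unit => [|y].
    by apply: measurable_funM => //; exact: measurable_funD.
  have := fC y; rewrite ler_norml => /andP[h h'].
  by rewrite mulrC ler_pdivrMr ?mulr_gt0// divr_ge0 /K; lra.
have [] // : good f.
have gT := good_indic (@measurableT _ mR).
have z : good (fun=> 0).
  have := good_indic (@measurable0 _ mR).
  by rewrite (_ : \1_set0 = fun=> 0)//; apply/funext => y; rewrite indic0.
rewrite (_ : f = fun y => (2 * K) * ((2 * K)^-1 * (f y + K)) + ((- K) * \1_setT y + 0)).
  by apply: good_lin => //; exact: good_lin.
have K2 : 2 * K != 0 by rewrite mulf_neq0// gt_eqF.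
by apply/funext => y; rewrite indicT addr0 mulr1 mulrA divff// mul1r addrK.
Qed.

End bounded_measurable_transfer.

(** * Characteristic functions of the two laws *)

Lemma normal_prob_indic (R : realType) (s : R) (D : set R) : measurable D ->
  \int[@lebesgue_measure R]_x (\1_D x * normal_pdf 0 s x) = fine (normal_prob 0 s D).
Proof.
move=> mD; rewrite -[RHS]/(\int[lebesgue_measure]_(x in D) normal_pdf 0 s x).
rewrite [RHS]Rintegral_mkcond; apply: eq_Rintegral => x _; rewrite patchE indicE.
by case: ifP => _; rewrite ?mul1r ?mul0r.
Qed.

Section brownian_increments.
Context {R : realType} d (Omega : measurableType d) (P : probability Omega R).
Local Notation mu := (@lebesgue_measure R).
Local Notation mR := (measurableTypeR R).
Variables (B : R -> Omega -> R) (m : nat).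
Hypothesis (BM : brownian_motion P B) (m_ge1 : (1 <= m)%N).

Let t (i : nat) : R := i%:R / m%:R.
Let sg : R := Num.sqrt m%:R^-1.

Definition increment (i : nat) (w : Omega) : mR := B (t i.+1) w - B (t i) w.

Let m0 : 0 < m%:R :> R. Proof. by rewrite ltr0n. Qed.

Let sg0 : sg != 0. Proof. by rewrite gt_eqF// sqrtr_gt0 invr_gt0. Qed.

Let t_itv i : (i <= m)%N -> 0 <= t i <= 1.
Proof. by move=> im; rewrite divr_ge0//= ler_pdivrMr// mul1r ler_nat. Qed.

Lemma measurable_increment i : (i < m)%N -> measurable_fun [set: Omega] (increment i).
Proof.
case: BM => mB _ _ _ _ im; apply: measurable_funB; apply: mB; apply: t_itv => //.
exact: ltnW.
Qed.

Lemma increment_law i A : (i < m)%N -> measurable A ->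
  P [set w | A (increment i w)] = normal_prob 0 sg A.
Proof.
case: BM => _ _ _ H _ im mA.
transitivity (normal_prob 0 (Num.sqrt (t i.+1 - t i)) A).
  apply: H => //; first by case/andP: (t_itv (ltnW im)).
    by rewrite ltr_pM2r ?invr_gt0// ltr_nat.
  by case/andP: (t_itv im).
have -> : t i.+1 - t i = m%:R^-1 by rewrite /t -mulrBl -natr1 addrAC subrr add0r mul1r.
by [].
Qed.

Lemma increment_independent (A : nat -> set mR) : (forall i, measurable (A i)) ->
  \int[P]_w (\prod_(i < m) \1_(A i) (increment i w)) =
  \prod_(i < m) fine (normal_prob 0 sg (A i)).
Proof.
move=> mA; case: BM => _ _ /(_ m t A) + _ _.
have t0 : 0 <= t 0%N by rewrite /t mul0r.
have t1 i : (i < m)%N -> t i <= t i.+1.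
  by move=> _; rewrite ler_pM2r ?invr_gt0// ler_nat.
have tm : t m <= 1 by case/andP: (t_itv (leqnn m)).
move=> /(_ t0 t1 tm mA) H.
pose E := [set w | forall i, (i < m)%N -> A i (increment i w)].
have mE : measurable E.
  rewrite (_ : E = \bigcap_(i in [set i | (i < m)%N]) (increment i @^-1` A i)).
    apply: bigcap_measurable => [|i im]; first by exists 0%N.
    by rewrite -[X in measurable X]setTI; exact: measurable_increment.
  by apply/seteqP; split => w.
rewrite (@eq_Rintegral _ _ _ P setT \1_E); last first.
  move=> w _; rewrite [RHS]indicE; have [/set_mem Ew|Ew] := boolP (w \in E).
    by rewrite big1// => i _; rewrite indicE mem_set//; exact: Ew.
  have [i im nA] : exists2 i, (i < m)%N & ~ A i (increment i w).
    move/negP : Ew; rewrite inE => /existsNP[i /not_implyP[im nA]].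
    by exists i.
  by rewrite (bigD1 (Ordinal im))//= indicE memNset// mul0r.
rewrite /Rintegral integral_indic// setIT.
rewrite [LHS]H; apply: eq_bigr => i _; congr fine.
exact: increment_law.
Qed.

Let weight k (c : nat -> R) (A : nat -> set mR) (a : R) (w : Omega) : R :=
  cos (\sum_(0 <= i < k) c i * increment i w + a) *
  \prod_(k <= i < m) \1_(A i) (increment i w).

Let measurable_weight k c A a : (k <= m)%N -> (forall i, measurable (A i)) ->
  measurable_fun [set: Omega] (weight k c A a).
Proof.
move=> km mA; apply: measurable_funM.
  apply: (measurableT_comp measurable_cos); apply: measurable_funD => //.
  have : forall j, (j <= m)%N ->
      measurable_fun [set: Omega] (fun w => \sum_(0 <= i < j) c i * increment i w).
    elim=> [|j IH] jm.
      rewrite (_ : (fun _ => _) = cst 0)//; apply/funext => w.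
      by rewrite big_geq.
    rewrite (_ : (fun _ => _) = fun w => \sum_(0 <= i < j) c i * increment i w +
        c j * increment j w); last first.
      by apply/funext => w; rewrite big_nat_recr.
    apply: measurable_funD; first by apply: IH; exact: ltnW.
    by apply: measurable_funM => //; exact: measurable_increment.
  exact.
have : forall j, (j <= m)%N -> measurable_fun [set: Omega]
    (fun w => \prod_(m - j <= i < m) \1_(A i) (increment i w) : R).
  elim=> [|j IH] jm.
    rewrite (_ : (fun _ => _) = cst 1)//; apply/funext => w.
    by rewrite big_geq// subn0.
  rewrite (_ : (fun _ => _) = fun w => \1_(A (m - j.+1)%N) (increment (m - j.+1) w) *
      \prod_(m - j <= i < m) \1_(A i) (increment i w)); last first.
    apply/funext => w; rewrite big_ltn; last by rewrite ltn_subrL (leq_trans _ jm).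
    by rewrite subnSK.
  apply: measurable_funM; last by apply: IH; exact: ltnW.
  apply: (measurableT_comp (measurable_indic (mA _))); apply: measurable_increment.
  by rewrite ltn_subrL (leq_trans _ jm).
by move=> /(_ (m - k)%N (leq_subr _ _)); rewrite subKn.
Qed.

Let weight_le1 k c A a w : `|weight k c A a w| <= 1.
Proof.
rewrite normrM -[leRHS]mulr1 ler_pM// ?norm_cos_le1//.
rewrite normr_prod; apply: prodr_ile1 => i _; rewrite normr_ge0 indicE.
by case: (_ \in _); rewrite /= ?normr1 ?normr0 ?lexx ?ler01.
Qed.

Let integrable_weight k c A a : (k <= m)%N -> (forall i, measurable (A i)) ->
  P.-integrable [set: Omega] (EFin \o weight k c A a).
Proof.
move=> km mA.
apply: (Rintegrable_le (measurable_weight c a km mA) (weight_le1 k c A a)).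
exact: finite_measure_integrable_cst.
Qed.

(** The product formula for events extends to cosines one increment at a time,
    both sides being integrals of a bounded function of that increment against
    measures agreeing on all sets. *)
Let weight_integral k c A a : (k <= m)%N -> (forall i, measurable (A i)) ->
  \int[P]_w weight k c A a w = cos a * expR (- (\sum_(0 <= i < k) c i ^+ 2 / m%:R) / 2) *
    \prod_(k <= i < m) fine (normal_prob 0 sg (A i)).
Proof.
elim: k c A a => [|k IH] c A a km mA.
  have -> : \sum_(0 <= i < 0) c i ^+ 2 / m%:R = 0 by rewrite big_geq.
  rewrite oppr0 mul0r expR0 mulr1.
  rewrite (@eq_Rintegral _ _ _ P setT (fun w => cos a *
     \prod_(i < m) \1_(A i) (increment i w))); last first.
    by move=> w _; rewrite /weight (@big_geq _ _ _ 0 0)// add0r big_mkord.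
  rewrite RintegralZl//.
    by rewrite increment_independent// big_mkord.
  have := @integrable_weight 0 c A 0 isT mA; rewrite /weight.
  rewrite (_ : (fun w => _) = (fun w => \prod_(i < m) \1_(A i) (increment i w) : R))//.
  by apply/funext => w; rewrite (@big_geq _ _ _ 0 0)// add0r cos0 mul1r big_mkord.
pose h b w : R := cos (\sum_(0 <= i < k) c i * increment i w + b) *
  \prod_(k.+1 <= i < m) \1_(A i) (increment i w).
pose K b := cos b * expR (- (\sum_(0 <= i < k) c i ^+ 2 / m%:R) / 2) *
    \prod_(k.+1 <= i < m) fine (normal_prob 0 sg (A i)).
have hA b (D : set mR) w : \1_D (increment k w) * h b w =
    weight k c (fun i => if i == k then D else A i) b w.
  rewrite /weight big_ltn// eqxx mulrCA; congr (_ * (_ * _)).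
  by apply: eq_big_nat => i /andP[ki _]; rewrite gtn_eqF.
have mAD (D : set mR) : measurable D ->
    forall i, measurable (if i == k then D else A i).
  by move=> mD i; case: ifP.
have ih b : P.-integrable [set: Omega] (EFin \o h b).
  have := @integrable_weight k c (fun i => if i == k then setT else A i) b (ltnW km)
    (mAD _ measurableT).
  rewrite (_ : weight _ _ _ _ = h b)//.
  by apply/funext => w; rewrite -hA indicT mul1r.
have step b (f : mR -> R) : measurable_fun [set: mR] f -> (forall y, `|f y| <= 1) ->
    \int[P]_w (f (increment k w) * h b w) = K b * \int[mu]_x (f x * normal_pdf 0 sg x).
  move=> mf f1.
  have -> : K b * \int[mu]_x (f x * normal_pdf 0 sg x) =
      \int[mu]_x (f x * (K b * normal_pdf 0 sg x)).
    rewrite -RintegralZl//; last exact: (integrable_normal_bounded sg0 mf f1).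
    by apply: eq_Rintegral => x _; rewrite mulrCA.
  apply: (@bounded_measurable_transfer R _ Omega P _ mR mu (increment k) (h b)
    id (fun x => K b * normal_pdf 0 sg x) _ _ _ _ _ f 1) => //.
  - exact: measurable_increment.
  - by apply: Rintegrable_scale; exact: integrable_normal_pdf.
  - move=> D mD.
    rewrite (@eq_Rintegral _ _ _ P setT
      (weight k c (fun i => if i == k then D else A i) b)); last first.
      by move=> w _; exact: hA.
    rewrite IH//; [|exact: ltnW|exact: mAD].
    rewrite [in LHS]big_ltn// eqxx.
    rewrite (@eq_big_nat _ _ _ k.+1 m _ (fun i => fine (normal_prob 0 sg (A i)))); last first.
      by move=> i /andP[ki _]; rewrite gtn_eqF.
    rewrite [RHS](@eq_Rintegral _ _ _ mu setT
      (fun x => K b * (\1_D x * normal_pdf 0 sg x))); last first.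
      by move=> x _; rewrite mulrCA.
    rewrite RintegralZl//; last first.
      apply: (@integrable_normal_bounded _ _ sg0 _ 1); first exact: measurable_indic.
      by move=> x; rewrite indicE; case: (_ \in _); rewrite ?normr1 ?normr0.
    by rewrite normal_prob_indic// /K mulrCA mulrC.
have mlin v : measurable_fun [set: mR] (fun x : mR => c k * x + v).
  by apply: measurable_funD => //; exact: measurable_funM.
have ihf b v : P.-integrable [set: Omega]
    (EFin \o (fun w => cos (c k * increment k w + v) * h b w)).
  apply: (@Rintegrable_le _ _ _ P _ (fun w => `|h b w|)).
  - apply: measurable_funM.
      exact: (measurableT_comp (measurableT_comp measurable_cos (mlin v)) (measurable_increment km)).
    by apply/measurable_EFinP; case/integrableP : (ih b).
  - by move=> w; rewrite normrM ler_piMl// norm_cos_le1.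
  - exact: (@integrable_norm _ _ _ P _ (h b)).
rewrite (@eq_Rintegral _ _ _ P setT (fun w =>
  cos (c k * increment k w + 0) * h a w -
  cos (c k * increment k w + - (pi / 2)) * h (a - pi / 2) w)); last first.
  move=> w _; rewrite /weight /h big_nat_recr//= addr0.
  move: (\sum_(0 <= i < k) _) (\prod_(_ <= i < m) _) (c k * _) => X Y Z.
  have sE y : cos (y - pi / 2) = sin y.
    by rewrite cosB cos_pihalf sin_pihalf mulr0 mulr1 add0r.
  have -> : X + Z + a = X + a + Z by rewrite addrAC.
  by rewrite cosD [X + (a - _)]addrA !sE; ring.
rewrite RintegralB//; [|exact: ihf..].
rewrite (step _ (fun y => cos (c k * y + 0))); last 2 first.
- exact: (measurableT_comp measurable_cos (mlin _)).
- by move=> y; exact: norm_cos_le1.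
rewrite (step _ (fun y => cos (c k * y + - (pi / 2)))); last 2 first.
- exact: (measurableT_comp measurable_cos (mlin _)).
- by move=> y; exact: norm_cos_le1.
rewrite !normal_charfun// cosN cos_pihalf mul0r mulr0 subr0 cos0 mul1r.
rewrite /K big_nat_recr//= opprD mulrDl expRD.
rewrite sqr_sqrtr ?invr_ge0 ?(ltW m0)// [_ * c k ^+ 2]mulrC.
by rewrite mulrAC mulrA.
Qed.

Lemma increments_charfun (c : nat -> R) (a : R) :
  \int[P]_w cos (\sum_(i < m) c i * increment i w + a) =
  cos a * expR (- ((\sum_(i < m) c i ^+ 2) / m%:R / 2)).
Proof.
have := weight_integral c a (leqnn m) (fun=> measurableT).
rewrite [X in _ * X]big_geq// mulr1 big_mkord -mulr_suml mulNr => <-.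
by apply: eq_Rintegral => w _; rewrite /weight big_geq// mulr1 big_mkord.
Qed.

End brownian_increments.

Section characteristic_functions.
Context {R : realType}.
Local Notation l2 := (ell2 R nat).
Local Notation mR := (measurableTypeR R).

(** The phase a encodes the real and the imaginary part of the characteristic
    function at once. *)
Definition gaussian_charfun (m : probability l2 R) (S : nat -> nat -> R) : Prop :=
  forall M eta a, \int[m]_u cos (linf 0 M eta u + a) =
    cos a * expR (- (\sum_(p < M) \sum_(q < M) S p q * (eta p * eta q)) / 2).

(** A law is specified by its values on sets; [bounded_measurable_transfer]
    extends the identity to the cosine. *)
Lemma law_charfun d (Omega : measurableType d) (P : probability Omega R)
    (Y : Omega -> l2) (nu : probability l2 R) M eta a :
  is_law P Y nu -> measurable_fun [set: Omega] (fun w => linf 0 M eta (Y w) : mR) ->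
  \int[nu]_u cos (linf 0 M eta u + a) = \int[P]_w cos (linf 0 M eta (Y w) + a).
Proof.
move=> law mY; have ml := lipf_measurable (@lipf_linf R 0 M eta).
have mc : measurable_fun [set: mR] (fun y : mR => cos (y + a)).
  by apply: (measurableT_comp measurable_cos); exact: measurable_funD.
have := @bounded_measurable_transfer R _ l2 nu _ Omega P (fun u => linf 0 M eta u : mR)
  (fun=> 1) (fun w => linf 0 M eta (Y w) : mR) (fun=> 1) ml mY
  (finite_measure_integrable_cst nu 1 measurableT)
  (finite_measure_integrable_cst P 1 measurableT) _
  (fun y => cos (y + a)) 1 mc (fun y => norm_cos_le1 (y + a)).
rewrite (@eq_Rintegral _ _ _ nu setT (fun u => cos (linf 0 M eta u + a))); last first.
  by move=> u _; rewrite mulr1.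
rewrite (@eq_Rintegral _ _ _ P setT (fun w => cos (linf 0 M eta (Y w) + a))); last first.
  by move=> u _; rewrite mulr1.
apply => A mA.
rewrite (@eq_Rintegral _ _ _ nu setT (\1_((fun u => linf 0 M eta u : mR) @^-1` A))); last first.
  by move=> u _; rewrite mulr1.
rewrite (@eq_Rintegral _ _ _ P setT (\1_((fun w => linf 0 M eta (Y w) : mR) @^-1` A))); last first.
  by move=> u _; rewrite mulr1.
have mA1 : measurable ((fun u => linf 0 M eta u : mR) @^-1` A).
  by rewrite -[X in measurable X]setTI; exact: ml.
have mA2 : measurable ((fun w => linf 0 M eta (Y w) : mR) @^-1` A).
  by rewrite -[X in measurable X]setTI; exact: mY.
rewrite /Rintegral !integral_indic// !setIT; congr fine; exact: law.
Qed.

(** On vectors with finitely many coordinates the scalar products are finite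
    sums. *)
Lemma centered_gaussian_charfun (m : probability l2 R) (S : ell2 R (nat * nat)%type) :
  centered_gaussian m S -> gaussian_charfun m (fun p q => S (p, q)).
Proof.
move=> gm M eta a.
pose u0 : l2 := finvec M eta.
have u0E q : u0 q = if (q < M)%N then eta q else 0 by exact: finvecE.
have dotE (u : nat -> R) : dotp u0 u = \sum_(p < M) eta p * u p.
  rewrite /dotp (@usum_finsupp R _ M).
    by apply: eq_bigr => p _; rewrite u0E ltn_ord.
  by move=> i Mi; rewrite u0E ltnNge Mi mul0r.
have dotC (u : nat -> R) : dotp u u0 = \sum_(p < M) u p * eta p.
  rewrite /dotp (@usum_finsupp R _ M).
    by apply: eq_bigr => p _; rewrite u0E ltn_ord.
  by move=> i Mi; rewrite u0E ltnNge Mi mulr0.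
have linE (u : l2) : linf 0 M eta u = dotp u0 u by rewrite dotE /linf big_mkord.
have [c1 s1] := gm u0.
have qE : qform S u0 = \sum_(p < M) \sum_(q < M) S (p : nat, q : nat) * (eta p * eta q).
  rewrite /qform dotC; apply: eq_bigr => p _; rewrite dotC big_distrl/=.
  by apply: eq_bigr => q _; rewrite -mulrA; congr (_ * _); rewrite mulrC.
rewrite -qE (_ : - qform S u0 / 2 = - 2^-1 * qform S u0); last by rewrite !mulNr mulrC.
rewrite -c1.
have ml : measurable_fun [set: l2] (fun u : l2 => dotp u0 u).
  by rewrite -(funext linE); apply: lipf_measurable; exact: lipf_linf.
rewrite (@eq_Rintegral _ _ _ m setT (fun u => cos a * cos (dotp u0 u) -
   sin a * sin (dotp u0 u))); last first.
  by move=> u _; rewrite linE cosD mulrC [sin a * _]mulrC.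
have ic : m.-integrable [set: l2] (EFin \o (fun u : l2 => cos (dotp u0 u))).
  apply: (Rintegrable_le (measurableT_comp measurable_cos ml) (fun u => norm_cos_le1 _)).
  exact: finite_measure_integrable_cst.
have is_ : m.-integrable [set: l2] (EFin \o (fun u : l2 => sin (dotp u0 u))).
  apply: (Rintegrable_le (measurableT_comp measurable_sin ml) (fun u => norm_sin_le1 _)).
  exact: finite_measure_integrable_cst.
rewrite RintegralB//; [|exact: Rintegrable_scale..].
by rewrite !RintegralZl// s1 mulr0 subr0 mulrC.
Qed.

(** The trace bounds the second moment. *)
Lemma gaussian_charfun_integrable (m : probability l2 R) (S : nat -> nat -> R) (C : R) :
  gaussian_charfun m S -> (forall N, \sum_(p < N) S p p <= C) ->
  m.-integrable [set: l2] (EFin \o (fun u : l2 => `|u|)).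
Proof.
move=> gm SC; apply: (@integrable_norm_charfun R m (fun p => S p p) C) => // p t.
have := gm p.+1 (fun q => if q == p then t else 0) 0.
have E (f : nat -> R) : \sum_(q < p.+1) (f q * (if q == p :> nat then t else 0)) = f p * t.
  rewrite big_ord_recr/= eqxx big1 ?add0r// => q _.
  by rewrite ltn_eqF ?mulr0.
rewrite cos0 mul1r => H; rewrite [LHS](_ : _ = \int[m]_u cos
  (linf 0 p.+1 (fun q => if q == p then t else 0) u + 0)).
  rewrite H; congr (expR (- _ / 2)).
  rewrite (eq_bigr (fun q : 'I_p.+1 => (S q p * t) * (if q == p :> nat then t else 0))).
    by rewrite (E (fun q => S q p * t)); ring.
  move=> q _; rewrite (eq_bigr (fun r : 'I_p.+1 => (S q r *
     (if q == p :> nat then t else 0)) * (if r == p :> nat then t else 0))).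
    by rewrite (E (fun r => S q r * _)) mulrAC.
  by move=> r _; rewrite mulrA.
apply: eq_Rintegral => u _; rewrite /linf big_mkord addr0; congr cos.
by rewrite (eq_bigr (fun q : 'I_p.+1 => u q * (if q == p :> nat then t else 0))) ?E 1?mulrC//;
  move=> q _; rewrite mulrC.
Qed.

End characteristic_functions.

Section interpolation_law.
Context {R : realType}.
Local Notation l2 := (ell2 R nat).
Variables (beta : R) (beta_ge0 : 0 <= beta) (beta_lt : beta < 2^-1).
Variables (m : nat) (m_ge1 : (1 <= m)%N).
Variables (x : nat -> l2) (x_basis : orthonormal_basis x).
Variables (e : nat -> R -> R) (e_basis : orthonormal_basis_L2 e).
Context d (Omega : measurableType d) (P : probability Omega R).
Variables (B : R -> Omega -> R) (B_bm : brownian_motion P B).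
Variable nu : probability l2 R.
Hypothesis nu_law : is_law P
  (fun w => J_iso e x beta (interpolation m (fun t => B t w))) nu.

(** By [J_iso_interpolation] a linear form of the interpolation is a linear
    combination of the increments, which are independent and Gaussian. *)
Lemma interpolation_charfun : gaussian_charfun nu (fun p q => S_dag e x beta m (p, q)).
Proof.
have [v [JE SE]] : exists v : nat -> l2,
    (forall b, J_iso e x beta (interpolation m b) = \sum_(i < m)
      (Num.sqrt m%:R * (b (i.+1%:R / m%:R) - b (i%:R / m%:R))) *: v i) /\
    (forall p q, S_dag e x beta m (p, q) = \sum_(i < m) v i p * v i q).
  case: x_basis => xx _; case: e_basis => se ee _.
  exact: J_iso_interpolation.
move=> M eta a.
pose c i : R := Num.sqrt m%:R * linf 0 M eta (v i).
have linJ w : linf 0 M eta (J_iso e x beta (interpolation m (fun t => B t w))) =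
    \sum_(i < m) c i * increment B m i w.
  rewrite JE /linf big_mkord.
  under eq_bigr do rewrite ell2_sumE big_distrr/=.
  rewrite exchange_big/=; apply: eq_bigr => i _.
  rewrite /c /linf big_mkord -mulrA mulr_suml big_distrr/=; apply: eq_bigr => p _.
  rewrite -[LHS]/(eta p * (Num.sqrt m%:R * increment B m i w * v i p)).
  by rewrite -[RHS]/(Num.sqrt m%:R * ((eta p * v i p) * increment B m i w)); ring.
have mJ : measurable_fun [set: Omega] (fun w => linf 0 M eta
    (J_iso e x beta (interpolation m (fun t => B t w))) : measurableTypeR R).
  rewrite (funext linJ); apply: measurable_sum => i; apply: measurable_funM => //.
  by apply: (measurable_increment B_bm) => //; exact: ltn_ord.
rewrite (law_charfun _ nu_law mJ).
rewrite (@eq_Rintegral _ _ _ P setT (fun w => cos (\sum_(i < m) c i * increment B m i w + a))).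
  rewrite increments_charfun//; congr (_ * expR _); rewrite mulNr; congr (- (_ / 2)).
  have m0 : m%:R != 0 :> R by rewrite pnatr_eq0 -lt0n.
  rewrite mulr_suml.
  rewrite (eq_bigr (fun i : 'I_m => \sum_(p < M) \sum_(q < M)
      (v i p * v i q) * (eta p * eta q))); last first.
    move=> i _; rewrite /c exprMn sqr_sqrtr// mulrAC divff// mul1r /linf big_mkord.
    rewrite expr2 mulr_suml; apply: eq_bigr => p _; rewrite mulr_sumr.
    by apply: eq_bigr => q _; ring.
  rewrite exchange_big/=; apply: eq_bigr => p _; rewrite exchange_big/=.
  by apply: eq_bigr => q _; rewrite SE mulr_suml.
by move=> w _; rewrite linJ.
Qed.

End interpolation_law.

(** * Derivatives contracted with finite arrays *)

Section bounded_operators.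
Context {R : realType} (V W : normedModType R).
Implicit Types f : bop V W.

Lemma bop_linear f : linear f.
Proof. by have := bopP f; rewrite inE => -[]. Qed.

Lemma bop_scale f (a : R) v : f (a *: v) = a *: f v.
Proof.
have f0 : f 0 = 0.
  have := bop_linear f 1 0 0; rewrite !scale1r addr0 => /esym/eqP.
  by rewrite -subr_eq0 addrK => /eqP.
by have := bop_linear f a v 0; rewrite !addr0 f0 addr0.
Qed.

Lemma bop_le f v : `|f v| <= `|f| * `|v|.
Proof.
have le1 z : `|z| <= 1 -> `|f z| <= `|f|.
  move=> z1; apply: ub_le_sup; last by exists z.
  have := bopP f; rewrite inE => -[_ [M fM]].
  exists `|M| => _ [v' /= v1 <-]; rewrite (le_trans (fM v'))//.
  rewrite (le_trans (ler_wpM2r (normr_ge0 v') (ler_norm M)))//.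
  by rewrite ler_piMr.
have [->|v0] := eqVneq v 0.
  by rewrite -(scale0r (0 : V)) bop_scale !scale0r normr0 mulr_ge0.
have nv0 : 0 < `|v| by rewrite normr_gt0.
have := le1 (`|v|^-1 *: v).
rewrite bop_scale !normrZ normfV normr_id mulVf ?gt_eqF// => /(_ (lexx _)).
by rewrite mulrC ler_pdivrMr.
Qed.

Lemma bop_sum f n (c : 'I_n -> R) (v : 'I_n -> V) :
  f (\sum_(i < n) c i *: v i) = \sum_(i < n) c i *: f (v i).
Proof.
elim: n c v => [|n IH] c v.
  by rewrite !big_ord0 -(scale0r (0 : V)) bop_scale scale0r.
by rewrite !big_ord_recr/= addrC bop_linear IH addrC.
Qed.

Lemma to_bopE (g : V -> W) x v : differentiable g x -> to_bop ('d g x) v = 'd g x v.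
Proof.
move=> dg; rewrite /to_bop /= insubdK//.
rewrite inE/=; split; first by move=> a u w; rewrite linearP.
have cd : continuous ('d g x) by exact: diff_continuous.
have /linear_boundedP bd := (linear_bounded_continuous _).2 cd.
by have [M _ HM] := pinfty_ex_gt0 bd; exists M.
Qed.

End bounded_operators.

Lemma sum_cauchy_schwarz (R : realType) (I : finType) (a b : I -> R) :
  (\sum_i a i * b i) ^+ 2 <= (\sum_i a i ^+ 2) * (\sum_i b i ^+ 2).
Proof.
apply: quadratic_ge0_discr => c.
rewrite [X in X + _](_ : _ = \sum_i (a i ^+ 2 + 2 * c * (a i * b i))).
  rewrite mulr_sumr -big_split/=; apply: sumr_ge0 => i _.
  by have := sqr_ge0 (a i + c * b i); nra.
by rewrite mulr_sumr -big_split.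
Qed.

Section multilinear_forms.
Context {R : realType}.
Local Notation l2 := (ell2 R nat).

Lemma multilin_app_linear k (a : R) (D E : @multilin R k) s :
  multilin_app (a *: D + E) s = a * multilin_app D s + multilin_app E s.
Proof. by elim: k D E s => [|k IH] D E s //=; exact: IH. Qed.

Lemma multilin_app_bounded k s : exists C, forall D : @multilin R k,
  `|multilin_app D s| <= C * `|D|.
Proof.
elim: k s => [|k IH] s; first by exists 1 => D; rewrite mul1r.
have [C HC] := IH (behead s); exists (`|C| * `|head 0 s|) => D /=.
apply: le_trans (HC _) _; rewrite -mulrA.
apply: le_trans (ler_wpM2r (normr_ge0 _) (ler_norm C)) _.
by rewrite ler_wpM2l// mulrC bop_le.
Qed.

Lemma multilin_app_continuous k s : continuous (fun D : @multilin R k => multilin_app D s).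
Proof.
have [C HC] := multilin_app_bounded k s.
apply: (@lipschitz_fun_continuous _ _ _ _ C) => D E.
have := multilin_app_linear (-1) E D s; rewrite scaleN1r mulN1r addrC => H.
rewrite (_ : _ - _ = multilin_app (D - E) s); last by rewrite addrC H addrC.
exact: HC.
Qed.

Lemma multilin_app0 k s : multilin_app (0 : @multilin R k) s = 0.
Proof.
have := multilin_app_linear 1 (0 : multilin k) 0 s.
by rewrite scale1r addr0 mul1r => /esym/eqP; rewrite -subr_eq0 addrK => /eqP.
Qed.

Lemma multilin_app_sum k n (c : 'I_n -> R) (D : 'I_n -> @multilin R k) s :
  multilin_app (\sum_(i < n) c i *: D i) s = \sum_(i < n) c i * multilin_app (D i) s.
Proof.
elim: n c D => [|n IH] c D.
  rewrite !big_ord0; have := multilin_app_linear 0 (0 : multilin k) 0 s.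
  by rewrite scale0r addr0 mul0r add0r multilin_app0.
by rewrite !big_ord_recr/= addrC multilin_app_linear IH addrC.
Qed.

Lemma multilin_app_head k M (D : @multilin R k.+1) (w : l2) s : proj M w = w ->
  multilin_app D (w :: s) = \sum_(q < M) w q * multilin_app D (delta q :: s).
Proof. by move=> wM; rewrite -{1}wM /= /proj /finvec bop_sum multilin_app_sum. Qed.

Lemma is_derive_frechet (F : l2 -> R) k (x w : l2) (y : R) s :
  differentiable (frechet F k) (x + y *: w) ->
  is_derive y (1 : R) (fun y => multilin_app (frechet F k (x + y *: w)) s)
    (multilin_app (frechet F k.+1 (x + y *: w)) (w :: s)).
Proof.
move=> df /=; rewrite to_bopE//.
set f := frechet F k; set z := x + y *: w.
have D : derivable f z w by exact: diff_derivable.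
have cv : h^-1 *: (multilin_app (f (x + (h *: (1 : R) + y) *: w)) s -
   multilin_app (f z) s) @[h --> 0^'] --> multilin_app ('d f z w) s.
  rewrite -deriveE//.
  have := cvg_comp _ _ D (@multilin_app_continuous k s ('D_w f z)).
  apply: cvg_trans; apply: near_eq_cvg; apply: nearW => h /=.
  have E : h *: w + z = x + (h *: 1 + y) *: w.
    by rewrite /z scalerDl [h *: 1]mulr1 addrCA.
  rewrite E; set p := f _; set q := f z.
  have := multilin_app_linear h^-1 (p - q) 0 s.
  rewrite !addr0 multilin_app0 addr0 => ->.
  have := multilin_app_linear (-1) q p s.
  by rewrite scaleN1r mulN1r addrC => ->; rewrite addrC.
split; first by apply/cvg_ex; exists (multilin_app ('d f z w) s).
by rewrite /derive; apply: (cvg_lim (@norm_hausdorff _ _) cv).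
Qed.

End multilinear_forms.

Section contractions.
Context {R : realType}.
Local Notation l2 := (ell2 R nat).
Variables (F : l2 -> R) (K : nat).
Hypothesis F_Cb : Cb K F.

Let CF := fine (Cb_norm K F).

(** The entries of [nabla] on raw sequences, where indices can be prepended
    without casts. *)
Definition deriv_entry k (x : l2) (s : seq nat) : R :=
  multilin_app (frechet F k x) (map (@delta R) s).

(** Contraction of the k-th derivative, restricted to the first M coordinates,
    with the array a, indexed by sequences so that contraction with one more
    vector just prepends an index. *)
Definition contr M k (a : seq nat -> R) (u : l2) : R :=
  \sum_(t : k.-tuple 'I_M) a (map val t) * deriv_entry k (proj M u) (map val t).

Definition array_sqr M k (a : seq nat -> R) : R := \sum_(t : k.-tuple 'I_M) a (map val t) ^+ 2.

Definition cons_array (w : l2) (a : seq nat -> R) : seq nat -> R :=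
  fun s => w (head 0%N s) * a (behead s).

Lemma sum_tuple_cons M k (f : seq nat -> R) :
  \sum_(t : k.+1.-tuple 'I_M) f (map val t) =
  \sum_(q < M) \sum_(t : k.-tuple 'I_M) f (val q :: map val t).
Proof.
rewrite pair_big/=.
rewrite (reindex (fun p : 'I_M * k.-tuple 'I_M => [tuple of p.1 :: p.2]))//.
exists (fun t : k.+1.-tuple 'I_M => (thead t, [tuple of behead t])) => [[q t] _|t _].
  by congr pair; apply/val_inj.
by rewrite /=; apply/val_inj => /=; case/tupleP: t => q t /=.
Qed.

Lemma array_sqr_cons M k w a :
  array_sqr M k.+1 (cons_array w a) = (\sum_(q < M) w q ^+ 2) * array_sqr M k a.
Proof.
rewrite /array_sqr (sum_tuple_cons M k (fun s => cons_array w a s ^+ 2)) mulr_suml.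
apply: eq_bigr => q _; rewrite mulr_sumr; apply: eq_bigr => t _.
by rewrite /cons_array/= exprMn.
Qed.

Lemma is_derive_sum_seq (I : Type) (r : seq I) (f : I -> R -> R) (df : I -> R) (y : R) :
  (forall i, is_derive y (1 : R) (f i) (df i)) ->
  is_derive y (1 : R) (fun y => \sum_(i <- r) f i y) (\sum_(i <- r) df i).
Proof.
move=> fdf; elim: r => [|i r IH].
  rewrite big_nil (_ : (fun _ => _) = cst 0); first exact: is_derive_cst.
  by apply/funext => z; rewrite big_nil.
rewrite big_cons (_ : (fun _ => _) = f i + (fun z => \sum_(j <- r) f j z)).
  exact: is_deriveD.
by apply/funext => z; rewrite big_cons.
Qed.

Lemma proj_line M (u w : l2) y : proj M w = w -> proj M (u + y *: w) = proj M u + y *: w.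
Proof.
move=> wM; apply/val_inj/funext => q.
rewrite -[RHS]/(proj M u q + y * w q) -[LHS]/(proj M (u + y *: w) q) !projE.
rewrite -[(u + y *: w) q]/(u q + y * w q); case: ifP => // qM.
by rewrite add0r -wM projE qM mulr0.
Qed.

(** Differentiating along w adds one index, contracted with w. *)
Lemma is_derive_contr M k a (u w : l2) (y : R) : (k < K)%N -> proj M w = w ->
  is_derive y (1 : R) (fun y => contr M k a (u + y *: w))
    (contr M k.+1 (cons_array w a) (u + y *: w)).
Proof.
move=> kK wM; have [dF _] := F_Cb.
have -> : contr M k.+1 (cons_array w a) (u + y *: w) =
    \sum_(t : k.-tuple 'I_M) a (map val t) *
      multilin_app (frechet F k.+1 (proj M u + y *: w)) (w :: map (@delta R) (map val t)).
  rewrite /contr (sum_tuple_cons M k (fun s => cons_array w a s *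
    deriv_entry k.+1 (proj M (u + y *: w)) s)) exchange_big.
  apply: eq_bigr => t _; rewrite proj_line//.
  rewrite (multilin_app_head _ _ wM) mulr_sumr; apply: eq_bigr => q _.
  rewrite -[LHS]/(w q * a (map val t) * multilin_app (frechet F k.+1 (proj M u + y *: w))
    (delta q :: map (@delta R) (map val t))).
  by rewrite -mulrA mulrCA.
rewrite (_ : (fun _ => _) = (fun y => \sum_(t : k.-tuple 'I_M) a (map val t) *
   multilin_app (frechet F k (proj M u + y *: w)) (map (@delta R) (map val t)))); last first.
  by apply/funext => z; rewrite /contr proj_line.
apply: is_derive_sum_seq => t; apply: (@is_deriveZ _ _ _ _ (a (map val t)) _ _ _).
by apply: is_derive_frechet; exact: dF.
Qed.

(** The sum is part of the square sum that [Cb_norm] bounds. *)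
Lemma deriv_entry_sqr_le M k x : (1 <= k <= K)%N ->
  \sum_(t : k.-tuple 'I_M) deriv_entry k x (map val t) ^+ 2 <= CF ^+ 2.
Proof.
move=> kK; have [_ CK] := F_Cb.
have C0 : (0 <= Cb_norm K F)%E.
  apply: (@le_trans _ _ (sqsum (nabla k F x) `^ 2^-1)%E); first exact: poweR_ge0.
  by apply: ereal_sup_ubound; exists k, x.
have CFE : Cb_norm K F = CF%:E by rewrite fineK// ge0_fin_numE.
have H : (sqsum (nabla k F x) `^ 2^-1 <= CF%:E)%E.
  by rewrite -CFE; apply: ereal_sup_ubound; exists k, x.
have S0 := sqsum_ge0 (nabla k F x).
have Sfin : sqsum (nabla k F x) \is a fin_num.
  rewrite ge0_fin_numE// ltey; apply/eqP => E; move: H; rewrite E.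
  by rewrite poweRyr ?invr_neq0//.
rewrite -lee_fin; apply: (@le_trans _ _ (sqsum (nabla k F x))).
  pose s := [seq map_tuple val t | t <- index_enum (k.-tuple 'I_M)].
  have us : uniq s.
    rewrite map_inj_uniq ?index_enum_uniq// => t t' /(congr1 (@tval _ _))/= E.
    by apply/val_inj/(inj_map val_inj).
  apply: le_trans (esum_ge_sum (a := fun i => nabla k F x i ^+ 2) (fun i => sqr_ge0 _) us).
  by rewrite big_map.
move: H; rewrite -(fineK Sfin) poweR_EFin !lee_fin.
rewrite powR12_sqrt ?fine_ge0// => H; rewrite -[leLHS]sqr_sqrtr ?fine_ge0//.
by rewrite ler_sqr ?nnegrE ?sqrtr_ge0//; apply: le_trans H; exact: sqrtr_ge0.
Qed.

Lemma fine_Cb_norm_ge0 : (0 < K)%N -> 0 <= CF.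
Proof.
move=> K0; rewrite fine_ge0//; pose a := sqsum (nabla 1 F 0).
apply: (@le_trans _ _ (a `^ 2^-1)%E); first exact: poweR_ge0.
by apply: ereal_sup_ubound; exists 1%N, 0; rewrite K0.
Qed.

Lemma contr_le M k a A u : (1 <= k <= K)%N -> 0 <= A -> array_sqr M k a <= A ^+ 2 ->
  `|contr M k a u| <= A * CF.
Proof.
move=> kK A0 aA; have C0 : 0 <= CF.
  by case/andP: kK => k1 kK; apply: fine_Cb_norm_ge0; exact: leq_trans kK.
rewrite -ler_sqr ?nnegrE ?mulr_ge0// real_normK ?num_real// exprMn.
apply: le_trans (sum_cauchy_schwarz _ _) _; apply: ler_pM => //.
- by apply: sumr_ge0 => t _; exact: sqr_ge0.
- by apply: sumr_ge0 => t _; exact: sqr_ge0.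
- exact: deriv_entry_sqr_le.
Qed.

Lemma proj_id M (w : l2) : proj M (proj M w) = proj M w.
Proof.
apply/val_inj/funext => q; rewrite -[LHS]/(proj M (proj M w) q) -[RHS]/(proj M w q).
by rewrite !projE; case: (q < M)%N.
Qed.

(** On the segment that joins the projections, the derivative is a contraction of
    order k + 1 with an array larger by the factor |w|, hence [contr_le] applies. *)
Lemma contr_lipschitz M k a u v : (k < K)%N ->
  `|contr M k a u - contr M k a v| <= Num.sqrt (array_sqr M k a) * CF * `|u - v|.
Proof.
move=> kK; set A := Num.sqrt (array_sqr M k a).
have A2 : array_sqr M k a = A ^+ 2.
  by rewrite sqr_sqrtr//; apply: sumr_ge0 => t _; exact: sqr_ge0.
have A0 : 0 <= A by exact: sqrtr_ge0.
have C0 : 0 <= CF by apply: fine_Cb_norm_ge0; exact: leq_ltn_trans kK.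
pose w := proj M (u - v).
have wM : proj M w = w by exact: proj_id.
have wn : `|w| <= `|u - v| by exact: norm_proj_le.
have E1 : contr M k a u = contr M k a (v + 1 *: w).
  rewrite /contr (_ : proj M u = proj M (v + 1 *: w))//.
  rewrite proj_line// scale1r; apply/val_inj/funext => q.
  rewrite -[RHS]/(proj M v q + proj M (u - v) q) -[LHS]/(proj M u q) !projE.
  case: ifP => _; last by rewrite addr0.
  by rewrite -[(u - v) q]/(u q - v q) addrC subrK.
have E0 : contr M k a v = contr M k a (v + 0 *: w) by rewrite scale0r addr0.
rewrite E1 E0.
have := @derivative_bound_lipschitz R (fun y => contr M k a (v + y *: w))
  (fun y => contr M k.+1 (cons_array w a) (v + y *: w)) (A * CF * `|u - v|) 1 0
  (fun y => is_derive_contr a v y kK wM).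
rewrite subr0 normr1 mulr1; apply => y.
apply: le_trans (@contr_le M k.+1 _ (`|w| * A) _ _ _ _) _ => //.
- exact: mulr_ge0.
- rewrite array_sqr_cons A2 exprMn ler_wpM2r ?sqr_ge0//.
  by rewrite -(big_mkord xpredT (fun i => w i ^+ 2)); apply: ell2_sum_le; exact: iota_uniq.
- by rewrite [leRHS]mulrC -mulrA ler_wpM2r// mulr_ge0.
Qed.

Lemma contr_lipf M k a : (k < K)%N -> lipf (contr M k a).
Proof.
move=> kK; exists (Num.sqrt (array_sqr M k a) * CF); last by move=> u v; exact: contr_lipschitz.
by rewrite mulr_ge0 ?sqrtr_ge0// fine_Cb_norm_ge0//; exact: leq_ltn_trans kK.
Qed.

Lemma proj_cvg (u : l2) : proj M u @[M --> \oo] --> u.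
Proof.
pose S N := \sum_(p < N) u p ^+ 2.
have key M : `|u - proj M u| ^+ 2 <= dotp u u - S M.
  have [v [-> vE]] : exists v : l2, u - proj M u = v /\
      forall p, v p = if (p < M)%N then 0 else u p.
    exists (u - proj M u); split => // p.
    rewrite -[LHS]/(u p - proj M u p) projE; case: ifP => _; first by rewrite subrr.
    by rewrite subr0.
  rewrite ell2_normE -lee_fin ell2_norm_sqr; apply: sqsum_nat_le => N.
  rewrite lerBrDr; apply: le_trans (sum_sqr_le_dotp u (maxn N M)).
  rewrite [leRHS](bigID (fun p : 'I_(maxn N M) => p < M)%N)/= addrC.
  rewrite /S (big_ord_widen _ (fun p => u p ^+ 2) (leq_maxr N M)) lerD2r.
  rewrite (big_ord_widen _ (fun p => v p ^+ 2) (leq_maxl N M)).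
  rewrite [leRHS]big_mkcond [leLHS]big_mkcond/=; apply: ler_sum => p _.
  rewrite vE; case: (p < M)%N => /=; first by rewrite expr0n; case: ifP.
  by case: ifP => // _; exact: sqr_ge0.
have SD : dotp u u - S N @[N --> \oo] --> 0.
  rewrite -(subrr (dotp u u)); apply: cvgB; first exact: cvg_cst.
  have := @dotp_cvg R u u; rewrite (_ : (fun N => _) = S)//.
apply/cvgrPdist_le => eps eps0.
have /cvgrPdist_le/(_ _ (exprn_gt0 2 eps0)) := SD.
apply: filterS => N; rewrite sub0r normrN => H.
rewrite -ler_sqr ?nnegrE ?(ltW eps0)//; apply: le_trans (key N) _.
exact: le_trans (ler_norm _) H.
Qed.

Lemma Cb_proj_cvg (u : l2) : (0 < K)%N -> F (proj M u) @[M --> \oo] --> F u.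
Proof.
move=> K0; have [dF _] := F_Cb.
have cF : continuous F by move=> z; apply: differentiable_continuous; exact: (dF 0%N).
exact: (continuous_cvg_seq cF (@proj_cvg u)).
Qed.

Lemma contr0 M (a : seq nat -> R) u : contr M 0 a u = a [::] * F (proj M u).
Proof.
rewrite /contr (big_pred1 [tuple]) ?map_tuple0//.
by move=> t; apply/esym/eqP/val_inj; case: t => -[].
Qed.

(** The norm of F bounds its derivatives but not F, which is only Lipschitz; this
    is [contr_lipschitz] at order 0 in the limit of large M. *)
Lemma Cb_lipf : (0 < K)%N -> lipf F.
Proof.
move=> K0; have C0 : 0 <= CF by exact: fine_Cb_norm_ge0.
exists CF => // u v.
apply: (@cvg_le_bound _ (fun M => `|F (proj M u) - F (proj M v)|) _ _ 0).
  by apply: cvg_norm; apply: cvgB; exact: Cb_proj_cvg.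
move=> M _; have := @contr_lipschitz M 0 (fun=> 1) u v K0.
rewrite !contr0 !mul1r /array_sqr (big_pred1 [tuple]) ?expr1n ?sqrtr1 ?mul1r//.
by move=> t; apply/esym/eqP/val_inj; case: t => -[].
Qed.

End contractions.

(** * Taylor estimates *)

Section taylor_estimates.
Context {R : realType}.

(** The mean value theorem would lose the factor 1 / (n + 1), which has to
    survive in [taylor2]. *)
Lemma integrate_derivative_bound (h h' : R -> R) (k : R) n :
  (forall y : R, is_derive y (1 : R) h (h' y)) -> h 0 = 0 ->
  (forall y, `|h' y| <= k * `|y| ^+ n) -> forall y, `|h y| <= k * `|y| ^+ n.+1 / n.+1%:R.
Proof.
have pos (f f' : R -> R) : (forall y : R, is_derive y (1 : R) f (f' y)) -> f 0 = 0 ->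
    (forall y, 0 <= y -> `|f' y| <= k * y ^+ n) ->
    forall y, 0 <= y -> f y <= k * y ^+ n.+1 / n.+1%:R.
  move=> df f0 bf y y0.
  pose g (z : R) := (k / n.+1%:R) * z ^+ n.+1 - f z.
  have dg (z : R) : is_derive z (1 : R) g (k * z ^+ n - f' z).
    have h1 : is_derive z (1 : R) (fun z : R => (k / n.+1%:R) * z ^+ n.+1) (k * z ^+ n).
      have h2 := is_deriveX n.+1 (is_derive_id z (1 : R)).
      have -> : (fun z : R => k / n.+1%:R * z ^+ n.+1) =
          (k / n.+1%:R) \*: ((id : R -> R) ^+ n.+1).
        by apply/funext => v; rewrite /= exprfctE.
      apply: (is_derive_eq (is_deriveZ (k / n.+1%:R) h2)).
      by rewrite /GRing.scale/= mulr1; field; rewrite nat1r pnatr_eq0.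
    exact: (is_deriveB h1 (df z)).
  have [|c c01 E] := @MVT_segment R g (fun z => k * z ^+ n - f' z) 0 y y0.
    apply: continuous_subspaceT => z.
    by apply/differentiable_continuous/derivable1_diffP; apply: ex_derive.
  have c0 : 0 <= c by move: c01; rewrite in_itv/= => /andP[].
  have : 0 <= g y - g 0.
    rewrite E subr0 mulr_ge0// subr_ge0; apply: le_trans (bf c c0); exact: ler_norm.
  by rewrite /g f0 subr0 [0 ^+ _]expr0n/= mulr0 subr0 subr_ge0 mulrAC.
move=> dh h0 bh y.
have neg (f f' : R -> R) : (forall y : R, is_derive y (1 : R) f (f' y)) ->
    forall z : R, is_derive z (1 : R) (fun z => f (- z)) (- f' (- z)).
  move=> df z.
  have h1 : is_derive z (1 : R) (fun z : R => - z) (- 1) by exact: is_deriveN.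
  have h2 := is_derive1_comp (f := f) (g := fun z : R => - z) (df (- z)) h1.
  by apply: (is_derive_eq h2); rewrite mulrN1.
have opp (f f' : R -> R) : (forall y : R, is_derive y (1 : R) f (f' y)) ->
    forall z : R, is_derive z (1 : R) (fun z => - f z) (- f' z).
  by move=> df z; exact: (is_deriveN (df z)).
have [y0|y0] := lerP 0 y.
  rewrite (ger0_norm y0) ler_norml lerNl; apply/andP; split.
    apply: (pos _ _ (opp _ _ dh)) => //; first by rewrite h0 oppr0.
    by move=> z z0; rewrite normrN; have := bh z; rewrite (ger0_norm z0).
  by apply: (pos _ _ dh) => // z z0; have := bh z; rewrite (ger0_norm z0).
have y0' : 0 <= - y by rewrite oppr_ge0 ltW.
rewrite (ltr0_norm y0) ler_norml lerNl; apply/andP; split.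
  have := pos _ _ (neg _ _ (opp _ _ dh)); rewrite oppr0 h0 oppr0 => /(_ erefl).
  move=> /(_ _ (- y) y0'); rewrite opprK; apply => z z0.
  by rewrite opprK; have := bh (- z); rewrite normrN (ger0_norm z0).
have := pos _ _ (neg _ _ dh); rewrite oppr0 h0 => /(_ erefl).
move=> /(_ _ (- y) y0'); rewrite opprK; apply => z z0.
by rewrite normrN; have := bh (- z); rewrite normrN (ger0_norm z0).
Qed.

(** The constant 1/2 is the one that appears once per order in the remainder. *)
Lemma taylor2 (g g1 g2 : R -> R) K : (forall y : R, is_derive y (1 : R) g (g1 y)) ->
  (forall y : R, is_derive y (1 : R) g1 (g2 y)) -> (forall y, `|g2 y| <= K) ->
  forall y, `|g y - g 0 - y * g1 0| <= K / 2 * y ^+ 2.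
Proof.
move=> d1 d2 b2 y.
have H y' : `|g1 y' - g1 0| <= K * `|y'| ^+ 1.
  by rewrite expr1; have := derivative_bound_lipschitz y' 0 d2 b2; rewrite subr0.
have dh (z : R) : is_derive z (1 : R) (fun z => g z - g 0 - z * g1 0) (g1 z - g1 0).
  have h1 : is_derive z (1 : R) (fun z : R => g z - g 0) (g1 z - 0).
    by apply: (is_deriveB (d1 z)); exact: is_derive_cst.
  have h2 : is_derive z (1 : R) (fun z : R => z * g1 0) (g1 0).
    have := is_deriveZ (g1 0) (is_derive_id z (1 : R)).
    have -> : g1 0 \*: id = (fun z : R => z * g1 0) by apply/funext => v; exact: mulrC.
    by move=> h; apply: (is_derive_eq h); exact: mulr1.
  by apply: (is_derive_eq (is_deriveB h1 h2)); rewrite subr0.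
have := integrate_derivative_bound dh _ H y.
rewrite subrr mul0r subr0 => /(_ erefl) h; apply: le_trans h _.
by rewrite real_normK ?num_real// mulrAC.
Qed.

Lemma taylor3 (g g1 g2 g3 : R -> R) K : (forall y : R, is_derive y (1 : R) g (g1 y)) ->
  (forall y : R, is_derive y (1 : R) g1 (g2 y)) ->
  (forall y : R, is_derive y (1 : R) g2 (g3 y)) -> (forall y, `|g3 y| <= K) ->
  forall y, `|g y - g 0 - y * g1 0 - y ^+ 2 / 2 * g2 0| <= K * `|y| ^+ 3.
Proof.
move=> d1 d2 d3 b3 y.
have K0 : 0 <= K by apply: le_trans (b3 0).
have H y' : `|g1 y' - g1 0 - y' * g2 0| <= K / 2 * `|y'| ^+ 2.
  by rewrite real_normK ?num_real//; exact: taylor2 d2 d3 b3 y'.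
have dh (z : R) : is_derive z (1 : R) (fun z => g z - g 0 - z * g1 0 - z ^+ 2 / 2 * g2 0)
    (g1 z - g1 0 - z * g2 0).
  have h1 : is_derive z (1 : R) (fun z : R => g z - g 0) (g1 z - 0).
    by apply: (is_deriveB (d1 z)); exact: is_derive_cst.
  have h2 : is_derive z (1 : R) (fun z : R => z * g1 0) (g1 0).
    have := is_deriveZ (g1 0) (is_derive_id z (1 : R)).
    have -> : g1 0 \*: id = (fun z : R => z * g1 0) by apply/funext => v; exact: mulrC.
    by move=> h; apply: (is_derive_eq h); exact: mulr1.
  have h3 : is_derive z (1 : R) (fun z : R => z ^+ 2 / 2 * g2 0) (z * g2 0).
    have := is_deriveZ (g2 0 / 2) (is_deriveX 2 (is_derive_id z (1 : R))).
    have -> : (g2 0 / 2) \*: (id ^+ 2) = (fun z : R => z ^+ 2 / 2 * g2 0).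
      by apply/funext => v; rewrite -[LHS]/(g2 0 / 2 * (v ^+ 2)); ring.
    by move=> h; apply: (is_derive_eq h); rewrite /GRing.scale/= mulr1 expr1; field.
  by apply: (is_derive_eq (is_deriveB (is_deriveB h1 h2) h3)); rewrite subr0.
have := integrate_derivative_bound dh _ H y.
rewrite subrr expr0n !mul0r !subr0 => /(_ erefl) h.
apply: le_trans h _.
have : 0 <= K * `|y| ^+ 3 by rewrite mulr_ge0.
move: (`|y| ^+ 3) => z; lra.
Qed.

End taylor_estimates.

Section right_differences.
Context {R : realType}.
Implicit Types f g : R -> R.

(** A right derivative with a uniform rate; h^(3/2) is the error left by one
    Gaussian step of variance h when three derivatives are bounded. *)
Definition right_difference f g : Prop := exists2 C, 0 <= C & forall t h : R,
  0 <= t -> 0 <= h -> t + h <= 1 -> `|f (t + h) - f t - h * g t| <= C * (h * Num.sqrt h).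

Lemma right_differenceD f1 g1 f2 g2 : right_difference f1 g1 -> right_difference f2 g2 ->
  right_difference (fun t => f1 t + f2 t) (fun t => g1 t + g2 t).
Proof.
move=> [C1 C10 H1] [C2 C20 H2]; exists (C1 + C2) => [|t h t0 h0 th]; first exact: addr_ge0.
have -> : f1 (t + h) + f2 (t + h) - (f1 t + f2 t) - h * (g1 t + g2 t) =
  (f1 (t + h) - f1 t - h * g1 t) + (f2 (t + h) - f2 t - h * g2 t) by ring.
by apply: le_trans (ler_normD _ _) _; rewrite mulrDl lerD ?H1 ?H2.
Qed.

Lemma right_differenceZ c f g : right_difference f g ->
  right_difference (fun t => c * f t) (fun t => c * g t).
Proof.
move=> [C C0 H]; exists (`|c| * C) => [|t h t0 h0 th]; first exact: mulr_ge0.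
have -> : c * f (t + h) - c * f t - h * (c * g t) = c * (f (t + h) - f t - h * g t) by ring.
by rewrite normrM -mulrA ler_wpM2l ?H.
Qed.

Lemma right_difference_sum n (f g : 'I_n -> R -> R) :
  (forall i, right_difference (f i) (g i)) ->
  right_difference (fun t => \sum_i f i t) (fun t => \sum_i g i t).
Proof.
elim: n f g => [|n IH] f g H.
  by exists 0 => // t h _ _ _; rewrite !big_ord0 subrr mulr0 subrr normr0 mul0r.
have [C C0 HC] := right_differenceD (IH _ _ (fun i => H (widen_ord (leqnSn n) i))) (H ord_max).
by exists C => // t h t0 h0 th; rewrite !big_ord_recr/=; exact: HC.
Qed.

Lemma right_difference_pow k :
  right_difference (fun t => (t - 1) ^+ k.+1) (fun t => k.+1%:R * (t - 1) ^+ k).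
Proof.
have [C C0 H] : exists2 C, 0 <= C & forall y h : R, -1 <= y -> 0 <= h -> y + h <= 0 ->
    `|(y + h) ^+ k.+1 - y ^+ k.+1 - h * (k.+1%:R * y ^+ k)| <= C * h ^+ 2.
  elim: k => [|k [C C0 IH]].
    exists 0 => // y h _ _ _.
    by rewrite !expr1 expr0 mulr1 (_ : _ - _ - _ = 0) ?normr0 ?mul0r//; ring.
  exists (C + k.+1%:R) => [|y h y0 h0 yh]; first by rewrite addr_ge0.
  have -> : (y + h) ^+ k.+2 - y ^+ k.+2 - h * (k.+2%:R * y ^+ k.+1) =
     (y + h) * ((y + h) ^+ k.+1 - y ^+ k.+1 - h * (k.+1%:R * y ^+ k)) +
     h ^+ 2 * (k.+1%:R * y ^+ k).
    by rewrite !exprS -!natr1; ring.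
  apply: le_trans (ler_normD _ _) _; rewrite [leRHS]mulrDl lerD//.
    rewrite normrM -[leRHS]mul1r ler_pM//; last exact: IH.
    by rewrite ler_norml; apply/andP; split; lra.
  rewrite normrM ger0_norm ?sqr_ge0// mulrC ler_wpM2r ?sqr_ge0//.
  rewrite normrM ger0_norm// ler_piMr// normrX exprn_ile1//.
  by rewrite ler_norml; apply/andP; split; lra.
exists C => // t h t0 h0 th.
have -> : t + h - 1 = t - 1 + h by ring.
apply: le_trans (H (t - 1) h _ _ _) _; [lra|lra|lra|].
rewrite ler_wpM2l// expr2 ler_wpM2l//.
rewrite -[leLHS]sqr_sqrtr// expr2 ler_piMl ?sqrtr_ge0//.
by rewrite -sqrtr1 ler_wsqrtr//; lra.
Qed.

(** Telescoping over n^2 steps leaves a total error of order 1 / n. A bound on the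
    increments follows with no regularity of f beyond its right derivative. *)
Lemma right_difference_bound f g (t0 K : R) : right_difference f g -> 0 <= t0 <= 1 ->
  (forall t, t0 <= t <= 1 -> `|g t| <= K) -> `|f 1 - f t0| <= (1 - t0) * K.
Proof.
move=> [C C0 H] /andP[t00 t01] gK.
have K0 : 0 <= K by apply: le_trans (gK 1 _) => //; rewrite t01 lexx.
have step n : (0 < n)%N -> `|f 1 - f t0| <= (1 - t0) * (K + C * n%:R^-1).
  move=> n0; pose N := (n ^ 2)%N.
  have N0 : 0 < N%:R :> R by rewrite ltr0n expn_gt0 n0.
  have n0' : 0 < n%:R :> R by rewrite ltr0n.
  pose h := (1 - t0) / N%:R.
  have h0 : 0 <= h by rewrite divr_ge0 ?subr_ge0// ltW.
  have sh : Num.sqrt h <= n%:R^-1.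
    have -> : n%:R^-1 = Num.sqrt (n%:R^-1 ^+ 2) :> R.
      by rewrite sqrtr_sqr ger0_norm// invr_ge0.
    rewrite ler_wsqrtr// /h /N natrX exprVn ler_piMl ?invr_ge0 ?exprn_ge0//; lra.
  have part k : (k <= N)%N ->
      `|f (t0 + k%:R * h) - f t0| <= k%:R * (h * (K + C * n%:R^-1)).
    elim: k => [|k IH] kN; first by rewrite !mul0r addr0 subrr normr0.
    have kh : (k%:R + 1) * h <= 1 - t0.
      rewrite /h mulrA ler_pdivrMr// mulrC ler_wpM2l ?subr_ge0//.
      by rewrite natr1 ler_nat.
    have kh0 : 0 <= k%:R * h by rewrite mulr_ge0.
    have t1 : t0 + k%:R * h + h <= 1 by move: kh; rewrite mulrDl mul1r; lra.
    have E := H (t0 + k%:R * h) h _ h0 t1.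
    have G : `|g (t0 + k%:R * h)| <= K by apply: gK; apply/andP; split; lra.
    rewrite -natr1 mulrDl mul1r addrA.
    have tri (a b c q : R) : a - c = (b - c) + ((a - b - h * q) + h * q) by ring.
    rewrite (tri _ (f (t0 + k%:R * h)) _ (g (t0 + k%:R * h))).
    apply: le_trans (ler_normD _ _) _; rewrite [leRHS]mulrDl mul1r lerD//; first exact: IH (ltnW kN).
    apply: le_trans (ler_normD _ _) _; rewrite [leRHS]mulrDr [leRHS]addrC lerD//; last first.
      by rewrite normrM ger0_norm// ler_wpM2l.
    apply: le_trans (E _) _; first lra.
    by rewrite mulrCA ler_wpM2l// ler_wpM2l.
  have := part N (leqnn N).
  have -> : t0 + N%:R * h = 1 by rewrite /h; field; rewrite gt_eqF.
  by rewrite mulrA (_ : N%:R * h = 1 - t0)//; rewrite /h; field; rewrite gt_eqF.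
apply: (@cvg_ge_bound R (fun n => (1 - t0) * (K + C * n.+1%:R^-1)) _ _ 0); last first.
  by move=> n _; exact: step.
apply: cvgM; first exact: cvg_cst.
rewrite -[X in _ --> X]addr0; apply: cvgD; first exact: cvg_cst.
rewrite -(mulr0 C); apply: cvgM; [exact: cvg_cst|exact: cvg_harmonic].
Qed.

(** Induction on s: the remainder for phi vanishes at time 1 and its right
    derivative is half the remainder for the shifted family, so
    [right_difference_bound] integrates one more power of (1 - t) / 2. At the last
    order only a Lipschitz bound is required, in place of a right derivative. *)
Lemma right_difference_taylor s (A : R) (phi : nat -> R -> R) :
  (forall j, (j < s)%N -> right_difference (phi j) (fun t => 2^-1 * phi j.+1 t)) ->
  (forall t h, 0 <= t -> 0 <= h -> t + h <= 1 ->
    `|phi s (t + h) - phi s t| <= h / 2 * A) ->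
  forall t, 0 <= t <= 1 ->
  `|phi 0%N t - \sum_(k < s.+1) (2 ^+ k * k`!%:R)^-1 * (t - 1) ^+ k * phi k 1| <=
    A * ((1 - t) / 2) ^+ s.+1.
Proof.
elim: s phi => [|s IH] phi H Hs t t01; have /andP[t0 t1] := t01.
  rewrite big_ord_recr big_ord0/= add0r !expr0 fact0 !mulr1 invr1 mul1r expr1 distrC.
  have := Hs t (1 - t) t0; rewrite subr_ge0 t1 addrC subrK => /(_ isT (lexx _)).
  by rewrite [_ * A]mulrC.
pose r (phi : nat -> R -> R) s (t : R) :=
  phi 0%N t - \sum_(k < s.+1) (2 ^+ k * k`!%:R)^-1 * (t - 1) ^+ k * phi k 1.
have IH' : forall t, 0 <= t <= 1 -> `|r (fun j => phi j.+1) s t| <= A * ((1 - t) / 2) ^+ s.+1.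
  by apply: IH => // j js; exact: H.
have r1 : r phi s.+1 1 = 0.
  rewrite /r subrr big_ord_recl/= !expr0 fact0 !mulr1 invr1 mul1r big1 ?addr0 ?subrr//.
  by move=> i _; rewrite expr0n/= mulr0 mul0r.
have A0 : 0 <= A.
  have := Hs 0 1 (lexx _) ler01; rewrite add0r => /(_ (lexx _)).
  by move=> /(le_trans (normr_ge0 _)); rewrite pmulr_rge0.
have dr : right_difference (r phi s.+1) (fun t => 2^-1 * r (fun j => phi j.+1) s t).
  have := right_differenceD (H 0%N isT) (right_difference_sum (fun i : 'I_s.+1 =>
    right_differenceZ (- ((2 ^+ i.+1 * i.+1`!%:R)^-1 * phi i.+1 1)) (right_difference_pow i))).
  move=> [C C0 HC]; exists C => // u h u0 h0 uh; apply: le_trans (HC u h u0 h0 uh).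
  rewrite le_eqVlt; apply/orP; left; apply/eqP; congr (`| _ |).
  have rE v : r phi s.+1 v = phi 0%N v + (\sum_(i < s.+1)
      - ((2 ^+ i.+1 * i.+1`!%:R)^-1 * phi i.+1 1) * (v - 1) ^+ i.+1) - phi 0%N 1.
    rewrite /r big_ord_recl/= !expr0 fact0 !mulr1 invr1 mul1r opprD addrAC addrA.
    rewrite -addrA addrAC -addrA; congr (_ + _); rewrite addrC; congr (_ - _).
    by rewrite -sumrN; apply: eq_bigr => i _; rewrite /bump/= add1n; ring.
  rewrite !rE /r mulrBr mulr_sumr.
  have -> : \sum_(i < s.+1) - ((2 ^+ i.+1 * i.+1`!%:R)^-1 * phi i.+1 1) *
      (i.+1%:R * (u - 1) ^+ i) =
      - \sum_(i < s.+1) 2^-1 * ((2 ^+ i * i`!%:R)^-1 * (u - 1) ^+ i * phi i.+1 1).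
    rewrite -sumrN; apply: eq_bigr => i _; rewrite factS natrM exprS; field.
    by rewrite pnatr_eq0 -lt0n fact_gt0 expf_neq0//= nat1r pnatr_eq0.
  ring.
have := @right_difference_bound _ _ t (2^-1 * (A * ((1 - t) / 2) ^+ s.+1)) dr t01.
rewrite r1 sub0r normrN => /(_ _)/le_trans; apply; last first.
  by rewrite [in leRHS]exprS le_eqVlt; apply/orP; left; apply/eqP; field.
move=> v /andP[tv v1]; rewrite normrM ger0_norm ?invr_ge0// ler_wpM2l ?invr_ge0//.
apply: le_trans (IH' v _) _; first by rewrite v1 (le_trans t0).
rewrite ler_wpM2l// lerXn2r ?nnegrE ?divr_ge0 ?subr_ge0// ler_pM2r ?invr_gt0//.
lra.
Qed.

End right_differences.

(** * Factorization of the covariance and Gaussian steps *)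

(** Cholesky factorization, by induction on M: subtract the rank-one part that
    carries the last row, and factor the Schur complement that remains. *)
Lemma psd_factorization (R : realType) (M : nat) (T : nat -> nat -> R) :
  (forall p q, T p q = T q p) ->
  (forall c : nat -> R, 0 <= \sum_(p < M) \sum_(q < M) T p q * (c p * c q)) ->
  exists w : nat -> nat -> R, forall p q, (p < M)%N -> (q < M)%N ->
    T p q = \sum_(r < M) w r p * w r q.
Proof.
elim: M T => [|M IH] T symT psdT; first by exists (fun _ _ => 0).
have form (c : nat -> R) : \sum_(p < M.+1) \sum_(q < M.+1) T p q * (c p * c q) =
    \sum_(p < M) \sum_(q < M) T p q * (c p * c q) +
    2 * c M * (\sum_(p < M) T p M * c p) + c M ^+ 2 * T M M.
  have E1 : \sum_(p < M) \sum_(q < M.+1) T p q * (c p * c q) =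
      \sum_(p < M) \sum_(q < M) T p q * (c p * c q) + c M * \sum_(p < M) T p M * c p.
    rewrite mulr_sumr -big_split; apply: eq_bigr => p _; rewrite big_ord_recr/=.
    by congr (_ + _); ring.
  have E2 : \sum_(q < M) T M q * (c M * c q) = c M * \sum_(p < M) T p M * c p.
    by rewrite mulr_sumr; apply: eq_bigr => q _; rewrite (symT M q); ring.
  by rewrite big_ord_recr/= E1 big_ord_recr/= E2; ring.
pose d := T M M; pose e := d^-1; pose b p := T p M.
have d0 : 0 <= d.
  pose c p : R := (p == M)%:R; have := psdT c; rewrite form /c eqxx.
  rewrite big1 => [|p _]; last by apply: big1 => q _; rewrite ltn_eqF// mul0r mulr0.
  rewrite big1 => [|p _]; last by rewrite ltn_eqF// mulr0.
  by rewrite mulr0 !add0r expr1n mul1r.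
have bE p : (p <= M)%N -> b p * (d * e) = b p.
  move=> pM; have [dz|dn] := eqVneq d 0; last by rewrite divff// mulr1.
  rewrite dz mul0r mulr0; apply/esym/eqP; rewrite -sqrf_eq0 eq_le sqr_ge0 andbT.
  move: pM; rewrite leq_eqVlt => /predU1P[->|pM]; first by rewrite /b -/d dz expr0n.
  have := @quadratic_ge0_discr R d (b p) (T p p); rewrite dz mul0r; apply => c.
  (* a zero diagonal entry forces its row to vanish: test with two coordinates *)
  pose c' q := if q == p then c else (q == M)%:R.
  have cp : c' p = c by rewrite /c' eqxx.
  have cM : c' M = 1 by rewrite /c' gtn_eqF// eqxx.
  have c0 (q : 'I_M) : q != Ordinal pM -> c' q = 0.
    by rewrite -val_eqE /c' => /negbTE/= ->; rewrite ltn_eqF.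
  have sumE (f : 'I_M -> R) : (forall q, q != Ordinal pM -> f q = 0) ->
      \sum_q f q = f (Ordinal pM).
    by move=> f0; rewrite (bigD1 (Ordinal pM))//= big1 ?addr0// => q qp; exact: f0.
  have := psdT c'; rewrite form cM mulr1 expr1n mul1r -/d dz addr0.
  rewrite (sumE (fun q => T q M * c' q)); last by move=> q qp; rewrite c0// mulr0.
  rewrite (sumE (fun q => \sum_(r < M) T q r * (c' q * c' r))); last first.
    by move=> q qp; apply: big1 => r _; rewrite c0// mul0r mulr0.
  rewrite (sumE (fun r : 'I_M => T p r * (c' p * c' r))); last by move=> q qp; rewrite (c0 _ qp) !mulr0.
  rewrite /= cp /b => H; apply: le_trans H _; rewrite le_eqVlt.
  by apply/orP; left; apply/eqP; ring.
have ede : e * (d * e) = e.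
  have [dz|dn] := eqVneq d 0; last by rewrite divff// mulr1.
  by rewrite /e dz invr0 mul0r.
have e0 : 0 <= e by rewrite invr_ge0.
have [|c|w wE] := IH (fun p q => T p q - e * (b p * b q)).
- by move=> p q; rewrite symT [b p * _]mulrC.
- pose s := \sum_(p < M) b p * c p.
  pose c' p := if p == M then - e * s else c p.
  have c'E (p : 'I_M) : c' p = c p by rewrite /c' ltn_eqF.
  have E2 : \sum_(p < M) \sum_(q < M) T p q * (c' p * c' q) =
      \sum_(p < M) \sum_(q < M) T p q * (c p * c q).
    by apply: eq_bigr => p _; apply: eq_bigr => q _; rewrite !c'E.
  have E3 : \sum_(p < M) T p M * c' p = s by apply: eq_bigr => p _; rewrite c'E.
  have E4 : \sum_(p < M) \sum_(q < M) (T p q - e * (b p * b q)) * (c p * c q) =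
      \sum_(p < M) \sum_(q < M) T p q * (c p * c q) - e * s * s.
    have -> : e * s * s = \sum_(p < M) \sum_(q < M) e * (b p * b q) * (c p * c q).
      rewrite [e * s * s](_ : _ = \sum_(p < M) (e * (b p * c p)) * s).
        by apply: eq_bigr => p _; rewrite /s mulr_sumr; apply: eq_bigr => q _; ring.
      by rewrite -mulr_suml -mulr_sumr.
    by rewrite -sumrB; apply: eq_bigr => p _; rewrite -sumrB; apply: eq_bigr => q _; ring.
  have cM : c' M = - e * s by rewrite /c' eqxx.
  have := psdT c'; rewrite form E2 E3 cM -/d E4 => H; apply: le_trans H _.
  rewrite le_eqVlt; apply/orP; left; apply/eqP.
  have -> : (- e * s) ^+ 2 * d = (e * (d * e)) * s * s by ring.
  by rewrite ede; ring.
exists (fun r p => if r == M then b p * Num.sqrt e else if (p < M)%N then w r p else 0).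
have se : Num.sqrt e * Num.sqrt e = e by rewrite -expr2 sqr_sqrtr.
move=> p q; rewrite !ltnS => pM qM; rewrite big_ord_recr/= eqxx.
rewrite (eq_bigr (fun r : 'I_M => (if (p < M)%N then w r p else 0) *
  (if (q < M)%N then w r q else 0))); last by move=> r _; rewrite ltn_eqF.
have -> : b p * Num.sqrt e * (b q * Num.sqrt e) = e * (b p * b q).
  by rewrite mulrACA se mulrC.
have bM : b M = d by [].
have edge r : (r <= M)%N -> e * (b r * b M) = T r M.
  move=> rM; transitivity (b r * (d * e)); last exact: bE.
  by rewrite bM mulrC mulrA.
have [qM'|qM'] := ltnP q M; last first.
  have -> : q = M by apply/eqP; rewrite eqn_leq qM qM'.
  rewrite big1; last by move=> r _; exact: mulr0.
  by rewrite add0r edge.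
have [pM'|pM'] := ltnP p M; last first.
  have -> : p = M by apply/eqP; rewrite eqn_leq pM pM'.
  rewrite big1; last by move=> r _; exact: mul0r.
  by rewrite add0r [b M * _]mulrC edge; [exact: symT|].
by rewrite -(wE _ _ pM' qM') subrK.
Qed.

Section gaussian_steps.
Context {R : realType}.
Local Notation l2 := (ell2 R nat).
Local Notation mu := (@lebesgue_measure R).
Local Notation p := (@normal_pdf R 0 1).
Implicit Types (f g : l2 -> R) (w : l2) (ws : seq l2).

Let one0 : (1 : R) != 0. Proof. exact: oner_neq0. Qed.

(** Convolution with the law of x *: w for a standard normal x. *)
Definition avgs ws f : l2 -> R := foldr avg f ws.

Lemma avgs_lipf ws f : lipf f -> lipf (avgs ws f).
Proof. by move=> lf; elim: ws => //= w ws IH; exact: avg_lipf. Qed.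

Lemma expectation_avgs Lam ws : expectation Lam -> expectation (fun f => Lam (avgs ws f)).
Proof.
elim: ws Lam => //= w ws IH Lam E.
exact: (IH (fun f => Lam (avg w f)) (expectation_avg w E)).
Qed.

Lemma cos_linf_lipf n M eta (a : R) : lipf (fun u : l2 => cos (linf n M eta u + a)).
Proof.
apply: (@lipf_comp _ cos 1) => //; first exact: cos_lipschitz.
by apply: lipf_add; [exact: lipf_linf|exact: lipf_cst].
Qed.

Lemma avgs_cos ws n M eta (a : R) :
  avgs ws (fun u => cos (linf n M eta u + a)) =
  (fun u => expR (- (\sum_(w <- ws) linf n M eta w ^+ 2) / 2) * cos (linf n M eta u + a)).
Proof.
elim: ws => [|w ws IH] /=; apply/funext => u.
  by rewrite big_nil oppr0 mul0r expR0 mul1r.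
rewrite IH avgZ ?avg_cos; last exact: cos_linf_lipf.
by rewrite mulrA -expRD big_cons; congr (expR _ * _); ring.
Qed.

Lemma expectation_norm_le Lam f B : expectation Lam -> lipf f -> (forall u, `|f u| <= B) ->
  `|Lam f| <= B.
Proof.
move=> E lf fB; rewrite ler_norml; apply/andP; split.
  rewrite -(expectation_cst E (- B)); apply: (expectation_le E) => //; first exact: lipf_cst.
  by move=> u; have := fB u; rewrite ler_norml => /andP[].
rewrite -[leRHS](expectation_cst E B); apply: (expectation_le E) => //; first exact: lipf_cst.
by move=> u; have := fB u; rewrite ler_norml => /andP[].
Qed.

Lemma lipf_sub f g : lipf f -> lipf g -> lipf (fun u => f u - g u).
Proof.
move=> lf lg; have := lipf_add lf (lipf_scale (-1) lg).
by rewrite (_ : (fun u => f u + _) = (fun u => f u - g u))//; apply/funext => u; rewrite mulN1r.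
Qed.

Lemma expectationB Lam f g : expectation Lam -> lipf f -> lipf g ->
  Lam (fun u => f u - g u) = Lam f - Lam g.
Proof.
move=> E lf lg; rewrite -mulN1r -(expectationZ E _ lg) -(expectationD E) //; last exact: lipf_scale.
by congr Lam; apply/funext => u; rewrite mulN1r.
Qed.

(** Makes the rules for expectations available for averages at a point. *)
Lemma avg_expectation w u : expectation (fun f => avg w f u).
Proof.
split.
- by move=> f g; exact: avgD.
- by move=> c f; exact: avgZ.
- by move=> c; exact: avg_cst.
- by move=> f g; exact: avg_le.
- by move=> fn f C C0 lfn lf fC fnf; have [+ _] := avg_dominated w C0 lfn fC fnf; exact.
Qed.

Definition line_derivative w f f1 : Prop := forall u (y : R),
  is_derive y (1 : R) (fun y => f (u + y *: w)) (f1 (u + y *: w)).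

(** The constant 1/2 is the one that appears once per order in the remainder. *)
Lemma taylor2_line w f f1 f2 K u (c x : R) : line_derivative w f f1 ->
  line_derivative w f1 f2 -> (forall v, `|f2 v| <= K) ->
  `|f (u + x *: (c *: w)) - f u - x * (c * f1 u)| <= c ^+ 2 / 2 * K * x ^+ 2.
Proof.
move=> d1 d2 f2K; rewrite scalerA.
have := taylor2 (d1 u) (d2 u) (fun y => f2K _) (x * c).
rewrite scale0r addr0 mulrA => H; apply: le_trans H _.
by rewrite exprMn le_eqVlt; apply/orP; left; apply/eqP; ring.
Qed.

Lemma taylor3_line w f f1 f2 f3 K u (c x : R) : line_derivative w f f1 ->
  line_derivative w f1 f2 -> line_derivative w f2 f3 -> (forall v, `|f3 v| <= K) ->
  `|f (u + x *: (c *: w)) - f u - x * (c * f1 u) - x ^+ 2 * (c ^+ 2 / 2 * f2 u)| <=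
    K * `|c| ^+ 3 * `|x| ^+ 3.
Proof.
move=> d1 d2 d3 f3K; rewrite scalerA.
have := taylor3 (d1 u) (d2 u) (d3 u) (fun y => f3K _) (x * c).
rewrite scale0r addr0 normrM => H.
have -> : x * (c * f1 u) = x * c * f1 u by ring.
have -> : x ^+ 2 * (c ^+ 2 / 2 * f2 u) = (x * c) ^+ 2 / 2 * f2 u by ring.
have -> : K * `|c| ^+ 3 * `|x| ^+ 3 = K * (`|x| * `|c|) ^+ 3 by ring.
exact: H.
Qed.

Let integrable_moment (h : R -> R) C : measurable_fun [set: R] h ->
  (forall x, `|h x| <= C * (1 + x ^+ 4)) ->
  mu.-integrable [set: R] (EFin \o (fun x => h x * p x)).
Proof. exact: integrable_normal_poly. Qed.

Let integrable_id : mu.-integrable [set: R] (EFin \o (fun x : R => x * p x)).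
Proof. by apply: (@integrable_moment _ 1) => // x; rewrite mul1r; have [] := poly4_ge x. Qed.

Let integrable_sqr : mu.-integrable [set: R] (EFin \o (fun x : R => x ^+ 2 * p x)).
Proof.
apply: (@integrable_moment _ 1) => [|x]; first exact: measurable_funX.
by rewrite mul1r ger0_norm ?sqr_ge0//; have [] := poly4_ge x.
Qed.

Let integrable_cube : mu.-integrable [set: R] (EFin \o (fun x : R => `|x| ^+ 3 * p x)).
Proof.
apply: (@integrable_moment _ 1) => [|x].
  by apply: measurable_funX; exact: normr_measurable.
by rewrite mul1r ger0_norm ?exprn_ge0//; have [] := poly4_ge x.
Qed.

Lemma avg_expansion w f u (a b : R) : lipf f ->
  avg w f u - f u - b = \int[mu]_x ((f (u + x *: w) - f u - x * a - x ^+ 2 * b) * p x) /\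
  mu.-integrable [set: R]
    (EFin \o (fun x => (f (u + x *: w) - f u - x * a - x ^+ 2 * b) * p x)).
Proof.
move=> lf; have i1 := integrable_avg u w lf.
have i2 := Rintegrable_scale (f u) (integrable_normal_pdf 0 (1 : R)).
have i3 := Rintegrable_scale a integrable_id.
have i4 := Rintegrable_scale b integrable_sqr.
have i12 := Rintegrable_sub i1 i2; have i123 := Rintegrable_sub i12 i3.
have E : (fun x => (f (u + x *: w) - f u - x * a - x ^+ 2 * b) * p x) =
   (fun x => f (u + x *: w) * p x - f u * p x - a * (x * p x) - b * (x ^+ 2 * p x)).
  by apply/funext => x; ring.
split; last by rewrite E; exact: Rintegrable_sub.
rewrite E RintegralB// RintegralB// RintegralB//.
rewrite !RintegralZl//; last exact: integrable_normal_pdf.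
by rewrite normal_mass normal_moment1// normal_moment2// expr1n !mulr1 mulr0 subr0.
Qed.

(** The first-order term is odd, so its Gaussian mean vanishes. *)
Lemma avg_second w f f1 f2 (c K : R) u : lipf f -> line_derivative w f f1 ->
  line_derivative w f1 f2 -> (forall v, `|f2 v| <= K) ->
  `|avg (c *: w) f u - f u| <= c ^+ 2 / 2 * K.
Proof.
move=> lf d1 d2 f2K; have [E i] := @avg_expansion (c *: w) f u (c * f1 u) 0 lf.
rewrite -[X in `|X|]subr0 E.
apply: (le_trans (@normr_Rintegral_le _ _ _ mu _
  (fun x => c ^+ 2 / 2 * K * (x ^+ 2 * p x)) i _ _)); last first.
- by rewrite RintegralZl// normal_moment2// expr1n mulr1.
- move=> x; rewrite normrM (ger0_norm (normal_pdf_ge0 _ _ _)) mulrA.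
  by rewrite ler_wpM2r ?normal_pdf_ge0// mulr0 subr0; exact: taylor2_line d1 d2 f2K.
- exact: Rintegrable_scale.
Qed.

(** Only the even terms of the expansion contribute: the mean of x vanishes and
    that of x^2 is 1. *)
Lemma avg_third : exists2 m3 : R, 0 <= m3 & forall w f f1 f2 f3 (c K : R) u,
  lipf f -> line_derivative w f f1 -> line_derivative w f1 f2 -> line_derivative w f2 f3 ->
  (forall v, `|f3 v| <= K) ->
  `|avg (c *: w) f u - f u - c ^+ 2 / 2 * f2 u| <= K * `|c| ^+ 3 * m3.
Proof.
exists (\int[mu]_x (`|x| ^+ 3 * p x)).
  by apply: Rintegral_ge0 => x _; rewrite mulr_ge0 ?exprn_ge0// normal_pdf_ge0.
move=> w f f1 f2 f3 c K u lf d1 d2 d3 f3K.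
have [E i] := @avg_expansion (c *: w) f u (c * f1 u) (c ^+ 2 / 2 * f2 u) lf.
rewrite E -RintegralZl//.
apply: normr_Rintegral_le => //; first exact: Rintegrable_scale.
move=> x; rewrite normrM (ger0_norm (normal_pdf_ge0 _ _ _)) [leRHS]mulrA.
by rewrite ler_wpM2r ?normal_pdf_ge0//; exact: taylor3_line d1 d2 d3 f3K.
Qed.

Lemma avg_first : exists2 m1 : R, 0 <= m1 & forall w f (L : R) u,
  0 <= L -> (forall v v', `|f v - f v'| <= L * `|v - v'|) ->
  `|avg w f u - f u| <= L * `|w| * m1.
Proof.
exists (\int[mu]_x (`|x| * p x)).
  by apply: Rintegral_ge0 => x _; rewrite mulr_ge0// normal_pdf_ge0.
move=> w f L u L0 Lf; have lf : lipf f by exists L.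
have iabs : mu.-integrable [set: R] (EFin \o (fun x : R => `|x| * p x)).
  apply: (@integrable_moment _ 1) => [|x]; first exact: normr_measurable.
  by rewrite mul1r normr_id; have [] := poly4_ge x.
have [E i] := @avg_expansion w f u 0 0 lf.
rewrite -[X in `|X|]subr0 E -RintegralZl//.
apply: normr_Rintegral_le => //; first exact: Rintegrable_scale.
move=> x; rewrite !mulr0 !subr0 normrM (ger0_norm (normal_pdf_ge0 _ _ _)) mulrA.
rewrite ler_wpM2r ?normal_pdf_ge0//; apply: le_trans (Lf _ _) _.
by rewrite addrAC subrr add0r normrZ -mulrA [`|w| * _]mulrC.
Qed.

End gaussian_steps.

(** * The path between two Gaussian laws *)

Lemma avg_dist_le (R : realType) (w : ell2 R nat) f g (B : R) u : lipf f -> lipf g ->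
  (forall v, `|f v - g v| <= B) -> `|avg w f u - avg w g u| <= B.
Proof.
move=> lf lg fgB; have E := avg_expectation w u.
rewrite -(expectationB E lf lg).
by apply: (expectation_norm_le E) => //; exact: lipf_sub.
Qed.

Lemma sum_iota (R : realType) (M : nat) (f : nat -> R) :
  \sum_(r <- iota 0 M) f r = \sum_(r < M) f r.
Proof. by rewrite -(subn0 M) -/(index_iota 0 M) big_mkord subn0. Qed.

Section covariance_path.
Context {R : realType}.
Local Notation l2 := (ell2 R nat).
Variables (F : l2 -> R) (K : nat).
Hypothesis F_Cb : Cb K F.
Variables (M : nat) (T : nat -> nat -> R) (w : nat -> l2).
Hypothesis w_proj : forall r, proj M (w r) = w r.
Hypothesis T_factor : forall p q, (p < M)%N -> (q < M)%N ->
  T p q = \sum_(r < M) w r p * w r q.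

Let CF := fine (Cb_norm K F).
Let tr := \sum_(p < M) T p p.

Let sqr_mass r := \sum_(p < M) w r p ^+ 2.

Lemma trace_factor : \sum_(r < M) sqr_mass r = tr.
Proof.
rewrite /sqr_mass exchange_big/=; apply: eq_bigr => p _.
by rewrite T_factor//; apply: eq_bigr => r _; rewrite expr2.
Qed.

Let tr_ge0 : 0 <= tr.
Proof. by rewrite -trace_factor; do 2 (apply: sumr_ge0 => ? _); exact: sqr_ge0. Qed.

Definition tensor_power (j : nat) (s : seq nat) : R :=
  \prod_(k < j) T (nth 0%N s k.*2) (nth 0%N s k.*2.+1).

Definition cons_pair (a : seq nat -> R) : seq nat -> R :=
  fun s => T (nth 0%N s 0) (nth 0%N s 1) * a (behead (behead s)).

Lemma tensor_powerS j : tensor_power j.+1 = cons_pair (tensor_power j).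
Proof.
apply/funext => s; rewrite /tensor_power big_ord_recl /cons_pair; congr (_ * _).
by apply: eq_bigr => k _; rewrite !lift0 doubleS !nth_behead.
Qed.

Lemma array_sqr_cons_pair k a :
  array_sqr M k.+2 (cons_pair a) = (\sum_(p < M) \sum_(q < M) T p q ^+ 2) * array_sqr M k a.
Proof.
rewrite /array_sqr (sum_tuple_cons M k.+1 (fun s => cons_pair a s ^+ 2)) mulr_suml.
apply: eq_bigr => p _.
rewrite (sum_tuple_cons M k (fun s => cons_pair a (val p :: s) ^+ 2)) mulr_suml.
apply: eq_bigr => q _; rewrite mulr_sumr; apply: eq_bigr => t _.
by rewrite /cons_pair/= exprMn.
Qed.

(** Cauchy-Schwarz on the factors gives T p q ^+ 2 <= T p p * T q q. *)
Lemma sum_sqr_le_trace : \sum_(p < M) \sum_(q < M) T p q ^+ 2 <= tr ^+ 2.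
Proof.
have E p q : (p < M)%N -> (q < M)%N -> T p q ^+ 2 <= T p p * T q q.
  move=> pM qM; rewrite !T_factor//; apply: le_trans (sum_cauchy_schwarz _ _) _.
  by rewrite le_eqVlt; apply/orP; left; apply/eqP; congr (_ * _);
    apply: eq_bigr => r _; rewrite expr2.
rewrite expr2 mulr_suml; apply: ler_sum => p _; rewrite mulr_sumr.
by apply: ler_sum => q _; exact: E.
Qed.

(** The Hilbert-Schmidt norm is multiplicative on tensor powers, and for a
    nonnegative operator it is at most the trace. *)
Lemma array_sqr_tensor_power j : array_sqr M (2 * j) (tensor_power j) <= (tr ^+ j) ^+ 2.
Proof.
elim: j => [|j IH].
  rewrite /array_sqr (big_pred1 [tuple]) ?expr0 ?expr1n.
    by rewrite /tensor_power big_ord0 expr1n.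
  by move=> t; apply/esym/eqP/val_inj; case: t => -[].
rewrite mulnS tensor_powerS array_sqr_cons_pair [tr ^+ j.+1]exprS [leRHS]exprMn.
apply: ler_pM => //; last exact: sum_sqr_le_trace.
  by do 2 (apply: sumr_ge0 => ? _); exact: sqr_ge0.
by apply: sumr_ge0 => ? _; exact: sqr_ge0.
Qed.

(** The operator \sum_r D_(w r)^2 is the contraction of the second derivative with
    T = \sum_r w r (x) w r; hence the heat equation below. *)
Lemma sum_contr_cons k a u :
  \sum_(r < M) contr F M k.+2 (cons_array (w r) (cons_array (w r) a)) u =
  contr F M k.+2 (cons_pair a) u.
Proof.
rewrite /contr exchange_big/=.
set x := proj M u.
rewrite (sum_tuple_cons M k.+1 (fun s => \sum_(r < M)
  cons_array (w r) (cons_array (w r) a) s * deriv_entry F k.+2 x s)).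
rewrite (sum_tuple_cons M k.+1 (fun s => cons_pair a s * deriv_entry F k.+2 x s)).
apply: eq_bigr => p _.
rewrite (sum_tuple_cons M k (fun s => \sum_(r < M)
  cons_array (w r) (cons_array (w r) a) (val p :: s) * deriv_entry F k.+2 x (val p :: s))).
rewrite (sum_tuple_cons M k (fun s => cons_pair a (val p :: s) *
  deriv_entry F k.+2 x (val p :: s))).
apply: eq_bigr => q _; apply: eq_bigr => t _.
rewrite -mulr_suml; congr (_ * _); rewrite /cons_pair /cons_array/= T_factor// mulr_suml.
by apply: eq_bigr => r _; rewrite mulrA.
Qed.

Lemma line_derivative_contr k a r : (k < K)%N ->
  line_derivative (w r) (contr F M k a) (contr F M k.+1 (cons_array (w r) a)).
Proof. by move=> kK u y; exact: (is_derive_contr F_Cb a u y kK (w_proj r)). Qed.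

Definition steps (h : R) (rs : seq nat) : seq l2 := [seq Num.sqrt h *: w r | r <- rs].

(** Uses two derivatives beyond order k and no third one, so it still applies to
    the contraction of order 2 s when F has 2 s + 2 derivatives. *)
Lemma steps_first_order (k : nat) a A h rs u : (k.+1 < K)%N -> 0 <= A ->
  array_sqr M k a <= A ^+ 2 -> 0 <= h ->
  `|avgs (steps h rs) (contr F M k a) u - contr F M k a u| <=
    h / 2 * ((\sum_(r <- rs) sqr_mass r) * A * CF).
Proof.
move=> kK A0 aA h0; have lf := contr_lipf F_Cb M a (ltnW kK).
have C0 : 0 <= CF by apply: fine_Cb_norm_ge0; exact: leq_trans kK.
elim: rs u => [|r rs IH] u /=.
  by rewrite big_nil !mul0r mulr0 subrr normr0.
have E : avg (Num.sqrt h *: w r) (avgs (steps h rs) (contr F M k a)) u - contr F M k a u =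
  (avg (Num.sqrt h *: w r) (avgs (steps h rs) (contr F M k a)) u -
   avg (Num.sqrt h *: w r) (contr F M k a) u) +
  (avg (Num.sqrt h *: w r) (contr F M k a) u - contr F M k a u).
  by rewrite addrA subrK.
rewrite E big_cons !mulrDl mulrDr [leRHS]addrC; apply: le_trans (ler_normD _ _) _.
apply: lerD; first by apply: avg_dist_le => //; exact: avgs_lipf.
rewrite -{2}(sqr_sqrtr h0).
apply: (avg_second _ _ lf (line_derivative_contr a r (ltnW kK))
  (line_derivative_contr (cons_array (w r) a) r kK)) => v.
apply: (contr_le F_Cb) => //.
- by rewrite mulr_ge0//; apply: sumr_ge0 => ? _; exact: sqr_ge0.
- by rewrite !array_sqr_cons -/(sqr_mass r) exprMn expr2 mulrA ler_wpM2l// sqr_ge0.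
Qed.

(** Steps in the directions w r one after the other; the Lipschitz bound of the
    second-order terms accounts for their change along the earlier steps. *)
Lemma steps_second_order (k : nat) a rs : (k.+2 < K)%N ->
  exists2 C : R, 0 <= C & forall h u, 0 <= h <= 1 ->
  `|avgs (steps h rs) (contr F M k a) u - contr F M k a u -
    h / 2 * \sum_(r <- rs) contr F M k.+2 (cons_array (w r) (cons_array (w r) a)) u| <=
  C * (h * Num.sqrt h).
Proof.
move=> kK; have lf := contr_lipf F_Cb M a (ltnW (ltnW kK)).
have [m3 m30 H3] := @avg_third R; have [m1 m10 H1] := @avg_first R.
pose D rs u := \sum_(r <- rs) contr F M k.+2 (cons_array (w r) (cons_array (w r) a)) u.
have lD rs' : lipf (D rs') by apply: lipf_sum => r; exact: (contr_lipf F_Cb).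
elim: rs => [|r rs [C C0 IH]].
  by exists 0 => // h u _; rewrite big_nil mulr0 subr0 subrr normr0 mul0r.
have [L L0 HL] := lD rs.
have [K3 K30 HK3] : exists2 K3 : R, 0 <= K3 & forall v,
    `|contr F M k.+3 (cons_array (w r) (cons_array (w r) (cons_array (w r) a))) v| <= K3.
  set a3 := cons_array _ _; pose A := Num.sqrt (array_sqr M k.+3 a3).
  have a30 : 0 <= array_sqr M k.+3 a3 by apply: sumr_ge0 => ? _; exact: sqr_ge0.
  exists (A * CF) => [|v]; first by rewrite mulr_ge0 ?sqrtr_ge0//;
    apply: fine_Cb_norm_ge0; exact: leq_trans kK.
  by apply: (contr_le F_Cb) => //; [exact: sqrtr_ge0|rewrite sqr_sqrtr].
exists (C + K3 * m3 + 2^-1 * (L * `|w r| * m1)) => [|h u h01].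
  by rewrite !addr_ge0// ?mulr_ge0.
have /andP[h0 h1] := h01; pose c := Num.sqrt h.
have c2 : c ^+ 2 = h by rewrite sqr_sqrtr.
have c0 : 0 <= c by exact: sqrtr_ge0.
rewrite /= -/c big_cons -/(D rs u).
pose f := contr F M k a; pose g := avgs (steps h rs) f.
have lg : lipf g by exact: avgs_lipf.
pose g' v := f v + h / 2 * D rs v.
have lg' : lipf g' by apply: lipf_add => //; exact: lipf_scale.
have t1 : `|avg (c *: w r) g u - avg (c *: w r) g' u| <= C * (h * c).
  apply: avg_dist_le => // v; rewrite /g' opprD addrA; exact: IH.
have Eg' : avg (c *: w r) g' u = avg (c *: w r) f u + h / 2 * avg (c *: w r) (D rs) u.
  by rewrite /g' avgD// ?avgZ//; exact: lipf_scale.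
have t2 := H3 (w r) _ _ _ _ c K3 u lf (line_derivative_contr a r (ltnW (ltnW kK)))
  (line_derivative_contr _ r (ltnW kK)) (line_derivative_contr _ r kK) HK3.
have t3 := H1 (c *: w r) (D rs) L u L0 HL.
move: t1 t2 t3; rewrite Eg' c2 normrZ (ger0_norm c0) exprSr c2 -/f -/g.
set x := avg _ g u; set y := avg _ f u; set z := avg _ (D rs) u.
set q := contr F M k.+2 _ u => t1 t2 t3.
have -> : x - f u - h / 2 * (q + D rs u) = (x - (y + h / 2 * z)) +
  (y - f u - h / 2 * q) + h / 2 * (z - D rs u) by ring.
apply: le_trans (ler_normD _ _) _; rewrite mulrDl lerD//.
  apply: le_trans (ler_normD _ _) _; rewrite mulrDl lerD//.
  by apply: le_trans t2 _; rewrite le_eqVlt; apply/orP; left; apply/eqP; ring.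
rewrite normrM ger0_norm ?divr_ge0//.
apply: le_trans (_ : h / 2 * (L * (c * `|w r|) * m1) <= _).
  by rewrite ler_wpM2l ?divr_ge0.
by rewrite le_eqVlt; apply/orP; left; apply/eqP; ring.
Qed.

(** Convolution with the centered Gaussian law of covariance t T. *)
Definition heat (t : R) (f : l2 -> R) : l2 -> R := avgs (steps t (iota 0 M)) f.

Lemma heat_cos t eta a : 0 <= t -> heat t (fun u => cos (linf 0 M eta u + a)) =
  (fun u => expR (- (t * \sum_(p < M) \sum_(q < M) T p q * (eta p * eta q)) / 2) *
     cos (linf 0 M eta u + a)).
Proof.
move=> t0; rewrite /heat avgs_cos; apply/funext => u; congr (expR (- _ / 2) * _).
rewrite big_map sum_iota.
rewrite (eq_bigr (fun r : 'I_M => t * (\sum_(p < M) \sum_(q < M)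
   (w r p * w r q) * (eta p * eta q)))); last first.
  move=> r _; rewrite linfZ exprMn sqr_sqrtr//; congr (_ * _).
  rewrite /linf big_mkord expr2 mulr_suml; apply: eq_bigr => p _.
  by rewrite mulr_sumr; apply: eq_bigr => q _; ring.
rewrite -mulr_sumr; congr (_ * _); rewrite exchange_big/=; apply: eq_bigr => p _.
rewrite exchange_big/=; apply: eq_bigr => q _.
by rewrite T_factor// mulr_suml.
Qed.

Variables (L0 L1 : (l2 -> R) -> R) (E0 : expectation L0) (E1 : expectation L1).
Hypothesis charfun_shift : forall eta a, L1 (fun u => cos (linf 0 M eta u + a)) =
  expR (- (\sum_(p < M) \sum_(q < M) T p q * (eta p * eta q)) / 2) *
  L0 (fun u => cos (linf 0 M eta u + a)).

Let local (f : l2 -> R) := forall u v : l2, (forall p, (p < M)%N -> u p = v p) -> f u = f v.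

Let local_contr k a : local (contr F M k a).
Proof.
move=> u v uv; rewrite /contr (_ : proj M u = proj M v)//.
by apply/val_inj/funext => q; rewrite -[LHS]/(proj M u q) -[RHS]/(proj M v q) !projE;
  case: ifP => // /uv.
Qed.

(** Both sides are expectations with the same values on cosines. *)
Let semigroup t h f : 0 <= t -> 0 <= h -> lipf f -> local f ->
  L0 (heat (t + h) f) = L0 (heat t (heat h f)).
Proof.
move=> t0 h0 lf locf.
apply: (@expectation_unique R (fun f => L0 (heat (t + h) f)) (fun f => L0 (heat t (heat h f)))
  _ _ M) => //.
- exact: (expectation_avgs _ E0).
- exact: (expectation_avgs _ (expectation_avgs _ E0)).
- move=> eta a; have lc := cos_linf_lipf 0 M eta a.
  rewrite !heat_cos ?addr_ge0// (expectationZ E0)//.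
  have EZ := expectation_avgs (steps t (iota 0 M)) E0.
  rewrite (expectationZ EZ)// -/(heat t _) heat_cos// (expectationZ E0)// mulrA -expRD.
  by congr (expR _ * _); ring.
Qed.

Let heat_end f : lipf f -> local f -> L0 (heat 1 f) = L1 f.
Proof.
move=> lf locf; apply: (@expectation_unique R (fun f => L0 (heat 1 f)) L1 _ _ M) => //.
- exact: (expectation_avgs _ E0).
- move=> eta a; have lc := cos_linf_lipf 0 M eta a.
  by rewrite heat_cos// mul1r (expectationZ E0)// charfun_shift.
Qed.

Let heat_start f : lipf f -> local f -> L0 (heat 0 f) = L0 f.
Proof.
move=> lf locf; apply: (@expectation_unique R (fun f => L0 (heat 0 f)) L0 _ _ M) => //.
- exact: (expectation_avgs _ E0).
- move=> eta a; have lc := cos_linf_lipf 0 M eta a.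
  by rewrite heat_cos// mul0r oppr0 mul0r expR0 (expectationZ E0)// mul1r.
Qed.

(** L0 after [heat t] is the Gaussian law at time t of the path that adds the
    covariance t T to L0. Each contraction with one more factor T is twice the
    right derivative of the previous one, and [right_difference_taylor] expands
    from time 1, where the law is that of L1, back to time 0. *)
Lemma covariance_path_expansion s : (2 * s + 2 <= K)%N ->
  `|L0 (contr F M 0 (fun=> 1)) - \sum_(j < s.+1) (2 ^+ j * j`!%:R)^-1 * (-1) ^+ j *
      L1 (contr F M (2 * j) (tensor_power j))| <= tr ^+ s.+1 * CF / 2 ^+ s.+1.
Proof.
move=> sK; pose f j := contr F M (2 * j) (tensor_power j).
have lf j : (j <= s)%N -> lipf (f j).
  move=> js; apply: (contr_lipf F_Cb); apply: leq_trans sK.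
  by rewrite addn2 ltnS ltnW// ltnS leq_mul2l js orbT.
pose phi j t := L0 (heat t (f j)).
have Et t := expectation_avgs (steps t (iota 0 M)) E0.
have dphi j : (j < s)%N -> right_difference (phi j) (fun t => 2^-1 * phi j.+1 t).
  move=> js; have jK : (((2 * j).+2) < K)%N.
    apply: leq_trans sK; rewrite addn2 ltnS.
    by apply: (@leq_trans (2 * j.+1).+1); [rewrite mulnS|rewrite ltnS leq_mul2l js orbT].
  have [C C0 HC] := @steps_second_order (2 * j) (tensor_power j) (iota 0 M) jK.
  have fS u : \sum_(r <- iota 0 M) contr F M (2 * j).+2
      (cons_array (w r) (cons_array (w r) (tensor_power j))) u = f j.+1 u.
    rewrite sum_iota sum_contr_cons /f mulnS.
    by rewrite tensor_powerS.
  exists C => // t h t0 h0 th.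
  have ljt := lf j (ltnW js); have ljS := lf j.+1 js.
  have lh : lipf (heat h (f j)) by exact: avgs_lipf.
  rewrite /phi semigroup//; last exact: local_contr.
  have -> : L0 (heat t (heat h (f j))) - L0 (heat t (f j)) - h * (2^-1 * L0 (heat t (f j.+1))) =
      L0 (heat t (fun u => heat h (f j) u - f j u - h / 2 * f j.+1 u)).
    rewrite (expectationB (Et t))//; [|exact: lipf_sub|exact: lipf_scale].
    by rewrite (expectationB (Et t))// (expectationZ (Et t))// mulrA.
  apply: (expectation_norm_le (Et t)).
    by apply: lipf_sub; [exact: lipf_sub|exact: lipf_scale].
  move=> u; rewrite -fS; apply: HC; rewrite h0/=; lra.
have lasts t h : 0 <= t -> 0 <= h -> t + h <= 1 ->
    `|phi s (t + h) - phi s t| <= h / 2 * (tr ^+ s.+1 * CF).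
  move=> t0 h0 th; rewrite /phi semigroup//; [|exact: lf|exact: local_contr].
  have lh : lipf (heat h (f s)) by apply: avgs_lipf; exact: lf.
  rewrite -(expectationB (Et t))//; last exact: lf.
  apply: (expectation_norm_le (Et t)); first by apply: lipf_sub => //; exact: lf.
  move=> u; have sK' : ((2 * s).+1 < K)%N by rewrite -addn2.
  have := @steps_first_order (2 * s) (tensor_power s) (tr ^+ s) h (iota 0 M) u sK'
    (exprn_ge0 _ tr_ge0) (array_sqr_tensor_power s) h0.
  by rewrite sum_iota trace_factor exprS.
have := right_difference_taylor dphi lasts (t := 0).
rewrite lexx ler01 => /(_ isT).
rewrite {1}/phi heat_start; [|exact: lf|exact: local_contr].
rewrite !subr0 !mul1r exprVn => H; apply: le_trans H.
rewrite le_eqVlt; apply/orP; left; apply/eqP; congr (`| _ - _|).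
  by congr L0; rewrite /f muln0; congr (contr F M 0); apply/funext => v;
    rewrite /tensor_power big_ord0.
apply: eq_bigr => j _; rewrite sub0r /phi heat_end//; last exact: local_contr.
by apply: lf; rewrite -ltnS.
Qed.

End covariance_path.

(** * Passage to infinite dimension *)

Lemma seq_cauchy_schwarz (R : realType) (I : Type) (s : seq I) (P : pred I) (a b : I -> R) :
  (\sum_(i <- s | P i) a i * b i) ^+ 2 <=
  (\sum_(i <- s | P i) a i ^+ 2) * (\sum_(i <- s) b i ^+ 2).
Proof.
have E (f : I -> R) : \sum_(i <- s) f i = \sum_(k < size s) f (tnth (in_tuple s) k).
  exact: big_tnth.
rewrite [X in X ^+ 2]big_mkcond [X in _ <= X * _]big_mkcond/=.
rewrite (eq_bigr (fun i => (if P i then a i else 0) * b i)); last first.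
  by move=> i _; case: ifP; rewrite ?mul0r.
rewrite [X in _ <= X * _](eq_bigr (fun i => (if P i then a i else 0) ^+ 2)); last first.
  by move=> i _; case: ifP; rewrite ?expr0n.
rewrite !E; exact: sum_cauchy_schwarz.
Qed.

Lemma sum_split_subset (R : realType) (I : eqType) (r s : seq I) (f : I -> R) :
  uniq r -> uniq s -> {subset r <= s} ->
  \sum_(i <- s) f i = \sum_(i <- r) f i + \sum_(i <- s | i \notin r) f i.
Proof.
move=> ur us rs; rewrite (bigID (fun i => i \in r))/=; congr (_ + _).
rewrite -big_filter; apply: perm_big; apply: uniq_perm; rewrite ?filter_uniq//.
by move=> i; rewrite mem_filter andb_idr//; exact: rs.
Qed.

(** A family that tends to zero pointwise while bounded in square norm tends
    to zero weakly: on a fixed finite set the sum is small by pointwise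
    convergence, off that set by the smallness of the tail of a. *)
Lemma weak_cvg_sum (R : realType) (I : eqType) (s : nat -> seq I) (a : I -> R)
    (d : nat -> I -> R) (A D : R) :
  (forall N, uniq (s N)) -> (forall N M, (N <= M)%N -> {subset s N <= s M}) ->
  (forall N, \sum_(i <- s N) a i ^+ 2 <= A) ->
  (forall N, \sum_(i <- s N) d N i ^+ 2 <= D) ->
  (forall i, d M i @[M --> \oo] --> 0) ->
  \sum_(i <- s M) a i * d M i @[M --> \oo] --> 0.
Proof.
move=> us ss aA dD d0.
have split_sum N M (f : I -> R) : (N <= M)%N -> \sum_(i <- s M) f i =
    \sum_(i <- s N) f i + \sum_(i <- s M | i \notin s N) f i.
  by move=> NM; apply: sum_split_subset => //; exact: ss.
pose g N := \sum_(i <- s N) a i ^+ 2.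
have gm : {homo g : n k / (n <= k)%N >-> n <= k}.
  by move=> n k nk; rewrite /g (split_sum _ _ _ nk) lerDl; apply: sumr_ge0 => i _; exact: sqr_ge0.
have D0 : 0 <= D by apply: le_trans (dD 0%N); apply: sumr_ge0 => i _; exact: sqr_ge0.
apply/cvgrPdist_le => eps eps0.
have e20 : 0 < eps / 2 by rewrite divr_gt0.
have [N HN] := nondecreasing_bounded_cauchy gm aA (divr_gt0 (exprn_gt0 2 e20)
  (ltr_wpDl D0 ltr01)).
have : \sum_(i <- s N) a i * d M i @[M --> \oo] --> \sum_(i <- s N) a i * 0.
  by apply: cvg_sum_seq => i; apply: cvgM; [exact: cvg_cst|exact: d0].
rewrite big1 => [|i _]; last by rewrite mulr0.
move=> /cvgrPdist_le/(_ _ e20)[N' _ HN'].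
exists (maxn N N') => // M /=; rewrite geq_max => /andP[NM N'M].
rewrite sub0r normrN (split_sum _ _ _ NM) (splitr eps).
apply: le_trans (ler_normD _ _) _; apply: lerD.
  by have := HN' M N'M; rewrite sub0r normrN.
rewrite -ler_sqr ?nnegrE ?(ltW e20)// real_normK ?num_real//.
apply: le_trans (seq_cauchy_schwarz _ _ _ _) _.
have tail : \sum_(i <- s M | i \notin s N) a i ^+ 2 <= (eps / 2) ^+ 2 / (D + 1).
  apply: le_trans (HN M N NM (leqnn N)); rewrite /g (split_sum _ _ _ NM) addrAC subrr add0r.
  exact: ler_norm.
apply: le_trans (ler_pM _ _ tail (dD M)) _; do ?by apply: sumr_ge0 => i _; exact: sqr_ge0.
rewrite -mulrA ler_piMr ?sqr_ge0// mulrC ler_pdivrMr ?mul1r ?lerDl//.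
exact: ltr_wpDl.
Qed.

Definition box (N k : nat) : seq (k.-tuple nat) :=
  [seq map_tuple val t | t : k.-tuple 'I_N].

Lemma mem_box N k (t : k.-tuple nat) : (t \in box N k) = all (fun q => q < N)%N t.
Proof.
apply/mapP/idP => [[r _ ->]|/allP tN].
  by apply/allP => q /= /mapP[z _ ->]; exact: ltn_ord.
have lt i : (tnth t i < N)%N by apply: tN; exact: mem_tnth.
exists [tuple Ordinal (lt i) | i < k]; first by rewrite mem_enum.
by apply: eq_from_tnth => i; rewrite tnth_map tnth_mktuple.
Qed.

Lemma uniq_box N k : uniq (box N k).
Proof.
rewrite map_inj_uniq ?enum_uniq// => t r /(congr1 val)/= tr.
by apply: val_inj; exact: (inj_map val_inj tr).
Qed.

Lemma sub_box N M k : (N <= M)%N -> {subset box N k <= box M k}.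
Proof.
by move=> NM t; rewrite !mem_box; apply: sub_all => q qN; exact: leq_trans NM.
Qed.

Lemma box_exhausts k (t : k.-tuple nat) : exists N, t \in box N k.
Proof.
exists (\max_(q <- t) q).+1; rewrite mem_box; apply/allP => q qt.
by rewrite ltnS; exact: leq_bigmax_seq.
Qed.

Lemma box_sum (R : realType) N k (f : seq nat -> R) :
  \sum_(t <- box N k) f t = \sum_(t : k.-tuple 'I_N) f (map val t).
Proof. by rewrite big_map big_enum. Qed.

Section contraction_limits.
Context {R : realType}.
Local Notation l2 := (ell2 R nat).
Variables (F : l2 -> R) (K : nat).
Hypothesis F_Cb : Cb K F.
Variables (k : nat) (a : seq nat -> R) (A : R).
Hypotheses (kK : (k < K)%N) (A_ge0 : 0 <= A).
Hypothesis aA : forall M, array_sqr M k a <= A ^+ 2.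

(** For k > 0 the entries are bounded; for k = 0 the entry is F itself, which has
    linear growth. *)
Lemma deriv_entry_sqr_growth : exists2 C : R, 0 <= C & forall M x,
  \sum_(t : k.-tuple 'I_M) deriv_entry F k x (map val t) ^+ 2 <= (C * (1 + `|x|)) ^+ 2.
Proof.
have C0 : 0 <= fine (Cb_norm K F) by apply: fine_Cb_norm_ge0; exact: leq_ltn_trans kK.
have [k0|k0] := posnP k; last first.
  exists (fine (Cb_norm K F)) => // M x.
  apply: le_trans (deriv_entry_sqr_le F_Cb M x _) _; first by rewrite k0 ltnW.
  rewrite ler_sqr ?nnegrE ?mulr_ge0 ?addr_ge0//.
  by rewrite ler_peMr// lerDl.
have [C C0' HC] := lipf_growth (Cb_lipf F_Cb (leq_ltn_trans (leq0n _) kK)).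
exists C => // M x; rewrite k0 (big_pred1 [tuple]); last first.
  by move=> t; apply/esym/eqP/val_inj; case: t => -[].
rewrite -[X in X <= _]real_normK ?num_real// ler_sqr ?nnegrE ?mulr_ge0 ?addr_ge0//.
exact: HC.
Qed.

Lemma contr_growth : exists2 C : R, 0 <= C &
  forall M u, `|contr F M k a u| <= C * (1 + `|u|).
Proof.
have [C C0 HC] := deriv_entry_sqr_growth; exists (A * C) => [|M u]; first exact: mulr_ge0.
have pu := norm_proj_le M u.
rewrite -ler_sqr ?nnegrE ?mulr_ge0 ?addr_ge0// real_normK ?num_real// -mulrA exprMn.
apply: le_trans (sum_cauchy_schwarz _ _) _; apply: ler_pM => //; do ?exact: aA.
- by apply: sumr_ge0 => ? _; exact: sqr_ge0.
- by apply: sumr_ge0 => ? _; exact: sqr_ge0.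
apply: le_trans (HC _ _) _; rewrite ler_sqr ?nnegrE ?mulr_ge0 ?addr_ge0//.
by rewrite ler_wpM2l// lerD2l.
Qed.

(** The entries at proj M u converge to those at u by continuity and stay bounded
    in square norm, so [weak_cvg_sum] replaces the former by the latter. *)
Lemma contr_cvg (u : l2) :
  contr F M k a u @[M --> \oo] --> dotp (nabla k F u) (fun t => a t).
Proof.
have [C C0 HC] := deriv_entry_sqr_growth.
pose B := (C * (1 + `|u|)) ^+ 2.
have pu M := norm_proj_le M u.
have HB M x : `|x| <= `|u| -> \sum_(t <- box M k) deriv_entry F k x t ^+ 2 <= B.
  move=> xu; rewrite (box_sum M k (fun t => deriv_entry F k x t ^+ 2)).
  apply: le_trans (HC _ _) _.
  by rewrite ler_sqr ?nnegrE ?mulr_ge0 ?addr_ge0// ler_wpM2l// lerD2l.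
have HA M : \sum_(t <- box M k) a t ^+ 2 <= A ^+ 2.
  by rewrite (box_sum M k (fun t => a t ^+ 2)); exact: aA.
have cvg_entry (t : k.-tuple nat) :
    deriv_entry F k (proj M u) t @[M --> \oo] --> deriv_entry F k u t.
  have [dF _] := F_Cb.
  apply: (continuous_cvg_seq (f := fun x => deriv_entry F k x t) _ (@proj_cvg R u)).
  move=> x; apply: (@continuous_comp _ _ _ (frechet F k)
    (fun D => multilin_app D (map (@delta R) t))).
    by apply: differentiable_continuous; exact: dF.
  exact: multilin_app_continuous.
have cvg0 : \sum_(t <- box M k) a t * (deriv_entry F k (proj M u) t - deriv_entry F k u t)
    @[M --> \oo] --> 0.
  apply: (@weak_cvg_sum R _ (fun M => box M k) (fun t => a t) _ (A ^+ 2) (4 * B)) => //.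
  - by move=> N; exact: uniq_box.
  - by move=> N M NM; exact: sub_box.
  - move=> N; have h1 := HB N _ (pu N); have h2 := HB N _ (lexx _).
    apply: (@le_trans _ _ (\sum_(t <- box N k) (2 * deriv_entry F k (proj N u) t ^+ 2 +
      2 * deriv_entry F k u t ^+ 2))).
      apply: ler_sum => t _.
      have := sqr_ge0 (deriv_entry F k (proj N u) t + deriv_entry F k u t); nra.
    by rewrite big_split/= -!mulr_sumr; lra.
  - move=> t; rewrite -(subrr (deriv_entry F k u t)); apply: cvgB; first exact: cvg_entry.
    exact: cvg_cst.
have cvg1 : \sum_(t <- box M k) deriv_entry F k u t * a t @[M --> \oo] -->
    dotp (nabla k F u) (fun t => a t).
  apply: (@usum_cvg R _ (fun M => box M k) (fun t => nabla k F u t * a t) (A ^+ 2 + B)).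
  - by move=> N; exact: uniq_box.
  - by move=> N; exact: sub_box.
  - exact: box_exhausts.
  move=> r ur; have [N rN] : exists N, {subset r <= box N k}.
    elim: r {ur} => [|t r [N IH]]; first by exists 0%N.
    have [N' tN'] := box_exhausts t; exists (maxn N N') => q.
    rewrite inE => /predU1P[->|/IH]; [exact: (sub_box (leq_maxr _ _))|].
    exact: (sub_box (leq_maxl _ _)).
  apply: (@le_trans _ _ (\sum_(t <- box N k) `|nabla k F u t * a t|)).
    by apply: (sum_le_subset (a := fun t => `|nabla k F u t * a t|)) => //; exact: uniq_box.
  apply: le_trans (lerD (HA N) (HB N _ (lexx _))); rewrite -big_split/=.
  apply: ler_sum => t _; rewrite -[nabla k F u t]/(deriv_entry F k u t).
  rewrite normrM -[a t ^+ 2]real_normK ?num_real// -[deriv_entry _ _ _ _ ^+ 2]real_normK ?num_real//.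
  have := sqr_ge0 (`|a t| - `|deriv_entry F k u t|).
  have := normr_ge0 (a t); have := normr_ge0 (deriv_entry F k u t); nra.
rewrite (_ : (fun M => contr F M k a u) = (fun M =>
  \sum_(t <- box M k) a t * (deriv_entry F k (proj M u) t - deriv_entry F k u t) +
  \sum_(t <- box M k) deriv_entry F k u t * a t)).
  by rewrite -(add0r (dotp _ _)); exact: (cvgD cvg0 cvg1).
apply/funext => M; rewrite /contr -big_split/=.
rewrite -(box_sum M k (fun t => a t * deriv_entry F k (proj M u) t)).
by apply: eq_bigr => t _; rewrite mulrBr [X in _ + X]mulrC subrK.
Qed.

Lemma integral_contr_cvg (m : probability l2 R) :
  m.-integrable [set: l2] (EFin \o (fun u : l2 => `|u|)) ->
  m.-integrable [set: l2] (EFin \o (fun u => dotp (nabla k F u) (fun t => a t))) /\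
  \int[m]_u contr F M k a u @[M --> \oo] --> \int[m]_u dotp (nabla k F u) (fun t => a t).
Proof.
move=> im; have [C C0 HC] := contr_growth.
apply: (@Rintegral_dominated_cvg R _ l2 m (fun M => contr F M k a) _
  (fun u => C * (1 + `|u|))).
- by move=> M; apply: lipf_measurable; exact: (contr_lipf F_Cb).
- apply: Rintegrable_scale; apply: Rintegrable_add => //.
  exact: (finite_measure_integrable_cst m 1 measurableT).
- by move=> M u; exact: HC.
- exact: contr_cvg.
Qed.

End contraction_limits.

Lemma proj_finvec (R : realType) M (c : nat -> R) : proj M (finvec M c) = finvec M c.
Proof.
apply/val_inj/funext => q; rewrite -[LHS]/(proj M (finvec M c) q) -[RHS]/(finvec M c q).
by rewrite projE !finvecE; case: (q < M)%N.
Qed.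

Section gaussian_comparison.
Context {R : realType}.
Local Notation l2 := (ell2 R nat).
Variables (F : l2 -> R) (K : nat).
Hypothesis F_Cb : Cb K F.
Variables (m0 m1 : probability l2 R) (S0 S1 : nat -> nat -> R) (C gamma : R).
Hypotheses (m0_gauss : gaussian_charfun m0 S0) (m1_gauss : gaussian_charfun m1 S1).
Let T p q := S1 p q - S0 p q.
Hypothesis T_sym : forall p q, T p q = T q p.
Hypothesis T_psd : forall M (c : nat -> R),
  0 <= \sum_(p < M) \sum_(q < M) T p q * (c p * c q).
Hypothesis S1_trace : forall N, \sum_(p < N) S1 p p <= C.
Hypothesis T_trace : forall N, \sum_(p < N) T p p <= gamma.

Let T_factor M : exists w : nat -> l2, (forall r, proj M (w r) = w r) /\
  forall p q, (p < M)%N -> (q < M)%N -> T p q = \sum_(r < M) w r p * w r q.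
Proof.
have [w wT] := psd_factorization T_sym (T_psd M).
exists (fun r => finvec M (w r)); split => [r|p q pM qM]; first exact: proj_finvec.
by rewrite wT//; apply: eq_bigr => r _; rewrite !finvecE pM qM.
Qed.

Let T_trace_ge0 M : 0 <= \sum_(p < M) T p p.
Proof.
have [w [_ wT]] := T_factor M; apply: sumr_ge0 => p _; rewrite wT//.
by apply: sumr_ge0 => r _; rewrite -expr2 sqr_ge0.
Qed.

Let gamma_ge0 : 0 <= gamma.
Proof. by apply: le_trans (T_trace 0); rewrite big_ord0. Qed.

Let integrable1 : m1.-integrable [set: l2] (EFin \o (fun u : l2 => `|u|)).
Proof. exact: (gaussian_charfun_integrable m1_gauss S1_trace). Qed.

Let integrable0 : m0.-integrable [set: l2] (EFin \o (fun u : l2 => `|u|)).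
Proof.
apply: (gaussian_charfun_integrable m0_gauss (C := C)) => N.
apply: le_trans (S1_trace N); rewrite -subr_ge0 -sumrB; exact: T_trace_ge0.
Qed.

Let tensor_power_le M j : array_sqr M (2 * j) (tensor_power T j) <= (gamma ^+ j) ^+ 2.
Proof.
have [w [_ wT]] := T_factor M.
apply: le_trans (array_sqr_tensor_power wT j) _.
rewrite ler_sqr ?nnegrE ?exprn_ge0//.
by apply: lerXn2r; rewrite ?nnegrE//; exact: T_trace_ge0.
Qed.

(** On the first M coordinates this is [covariance_path_expansion], for a
    factorization of the M x M corner of T; the bound is uniform in M, and
    everything converges by domination. *)
Lemma gaussian_comparison_expansion s : (2 * s + 2 <= K)%N ->
  [/\ m0.-integrable [set: l2] (EFin \o F),
    forall j, (j <= s)%N -> m1.-integrable [set: l2]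
      (EFin \o (fun u => dotp (nabla (2 * j) F u) (fun t => tensor_power T j t))) &
    `|\int[m0]_u F u - \sum_(j < s.+1) (2 ^+ j * j`!%:R)^-1 * (-1) ^+ j *
        \int[m1]_u dotp (nabla (2 * j) F u) (fun t => tensor_power T j t)| <=
      gamma ^+ s.+1 * fine (Cb_norm K F) / 2 ^+ s.+1].
Proof.
move=> sK; have K0 : (0 < K)%N by apply: leq_trans sK; rewrite addn2.
have jK j : (j <= s)%N -> (2 * j < K)%N.
  by move=> js; apply: leq_trans sK; rewrite addn2 ltnS ltnW// ltnS leq_mul2l js orbT.
have one M : array_sqr M 0 (fun=> 1 : R) <= 1 ^+ 2.
  rewrite /array_sqr (big_pred1 [tuple]) ?expr1n//.
  by move=> t; apply/esym/eqP/val_inj; case: t => -[].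
have EF : (fun u => dotp (nabla 0 F u) (fun=> 1)) = F.
  apply/funext => u; have h := contr_cvg F_Cb K0 one (u := u).
  rewrite -(cvg_lim (@Rhausdorff R) h); apply/(cvg_lim (@Rhausdorff R)).
  rewrite (_ : (fun M => _) = (fun M => F (proj M u))); first exact: (Cb_proj_cvg F_Cb).
  by apply/funext => M; rewrite contr0 mul1r.
have [iF cF] := integral_contr_cvg F_Cb K0 (@ler01 R) one integrable0.
rewrite EF in iF cF.
have H j (js : (j <= s)%N) := integral_contr_cvg F_Cb (jK j js) (exprn_ge0 j gamma_ge0)
  (fun M => tensor_power_le M j) integrable1.
split => //; first by move=> j js; case: (H j js).
pose L M := \int[m0]_u contr F M 0 (fun=> 1) u - \sum_(j < s.+1) (2 ^+ j * j`!%:R)^-1 *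
  (-1) ^+ j * \int[m1]_u contr F M (2 * j) (tensor_power T j) u.
refine (@cvg_le_bound R (fun M => `|L M|) _ _ 0 _ _).
  apply: cvg_norm; apply: cvgB; first exact: cF.
  apply: cvg_sum_seq => j; apply: cvgM; first exact: cvg_cst.
  by have [] := H j; first by rewrite -ltnS.
move=> M _; have [w [wM wT]] := T_factor M.
have shift eta a : \int[m1]_u cos (linf 0 M eta u + a) =
    expR (- (\sum_(p < M) \sum_(q < M) T p q * (eta p * eta q)) / 2) *
    \int[m0]_u cos (linf 0 M eta u + a).
  rewrite m1_gauss m0_gauss mulrCA -expRD -mulrDl -opprD -big_split/=.
  congr (_ * expR (- _ / 2)); apply: eq_bigr => p _; rewrite -big_split/=.
  by apply: eq_bigr => q _; rewrite -mulrDl /T subrK.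
have := @covariance_path_expansion R F K F_Cb M T w wM wT (fun f => \int[m0]_u f u)
  (fun f => \int[m1]_u f u) (expectation_integral integrable0)
  (expectation_integral integrable1) shift s sK.
move=> H'; apply: le_trans H' _.
rewrite ler_wpM2r ?invr_ge0 ?exprn_ge0// ler_wpM2r ?fine_Cb_norm_ge0//.
by apply: lerXn2r; rewrite ?nnegrE//; exact: T_trace_ge0.
Qed.

End gaussian_comparison.

Lemma usum_sign (R : realType) (I : choiceType) (j : nat) (a : I -> R) :
  usum (fun i => (-1) ^+ j * a i) = (-1) ^+ j * usum a.
Proof.
rewrite -signr_odd; case: (odd j); rewrite /= ?expr1 ?expr0.
  rewrite /usum mulN1r opprB; congr (fine _ - fine _); apply: eq_esum => i _.
    by rewrite mulN1r.
  by rewrite mulN1r opprK.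
by rewrite mul1r; congr usum; apply/funext => i; rewrite mul1r.
Qed.

Theorem theorem4p2 (R : realType)
    (beta : R) (beta_ge0 : 0 <= beta) (beta_lt : beta < 2^-1)
    (m : nat) (m_ge1 : (1 <= m)%N)
    (x : nat -> ell2 R nat) (x_basis : orthonormal_basis x)
    (e : nat -> R -> R) (e_basis : orthonormal_basis_L2 e)
    (d : measure_display) (Omega : measurableType d) (P : probability Omega R)
    (B : R -> Omega -> R) (B_bm : brownian_motion P B)
    (nu : probability (ell2 R nat) R)
    (nu_law : is_law P
       (fun w => J_iso e x beta (interpolation m (fun t => B t w))) nu)
    (m_beta : probability (ell2 R nat) R)
    (m_beta_gauss : centered_gaussian m_beta (S_beta e x beta))
    (s : nat) (F : ell2 R nat -> R) (F_Cb : Cb (2 * s + 2)%N F) :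
  let term (j : nat) (u : ell2 R nat) :=
    dotp (nabla (2 * j)%N F u) (tpow (S_dag e x beta m - S_beta e x beta) j) in
  [/\ nu.-integrable setT (EFin \o F),
      forall j, (j <= s)%N -> m_beta.-integrable setT (EFin \o term j) &
      exists Rem : R,
        \int[nu]_u F u =
          \sum_(j < s.+1) (2 ^+ j * j`!%:R)^-1 * \int[m_beta]_u term j u + Rem /\
        `|Rem| <= gamma_dag e x beta m ^+ s.+1 / 2 ^+ s.+1 *
                  fine (Cb_norm (2 * s + 2)%N F)].
Proof.
case: (x_basis) => xx _; case: (e_basis) => se ee _.
pose S1 (p q : nat) := S_beta e x beta (p, q).
pose S0 (p q : nat) := S_dag e x beta m (p, q).
pose T p q := S1 p q - S0 p q.
have T_sym p q : T p q = T q p.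
  have [v [_ SE]] := J_iso_interpolation beta_ge0 beta_lt m_ge1 xx se ee.
  have S1_sym : S1 p q = S1 q p := S_beta_sym beta_ge0 beta_lt xx se ee p q.
  have S0_sym : S0 p q = S0 q p by rewrite /S0 !SE; apply: eq_bigr => i _; rewrite mulrC.
  by rewrite /T S1_sym S0_sym.
have T_psd M (c : nat -> R) : 0 <= \sum_(p < M) \sum_(q < M) T p q * (c p * c q).
  exact: (S_diff_psd beta_ge0 beta_lt m_ge1 xx se ee).
have T_pp p : 0 <= T p p.
  have := T_psd p.+1 (fun q => (q == p)%:R).
  rewrite big_ord_recr/= big1 => [|q _].
    rewrite add0r big_ord_recr/= big1 => [|q _]; first by rewrite add0r eqxx !mulr1.
    by rewrite (ltn_eqF (ltn_ord q)) !mulr0.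
  by rewrite big1// => r _; rewrite (ltn_eqF (ltn_ord q)) mul0r mulr0.
have [C S1_trace] := S_beta_trace_le beta_ge0 beta_lt xx se ee.
have m1_gauss : gaussian_charfun m_beta S1 by exact: centered_gaussian_charfun.
have m0_gauss : gaussian_charfun nu S0.
  exact: (interpolation_charfun beta_ge0 beta_lt m_ge1 x_basis e_basis B_bm nu_law).
have S0_pp p : 0 <= S0 p p.
  have [v [_ SE]] := J_iso_interpolation beta_ge0 beta_lt m_ge1 xx se ee.
  by rewrite /S0 SE; apply: sumr_ge0 => i _; rewrite -expr2 sqr_ge0.
have T_trace N : \sum_(p < N) T p p <= gamma_dag e x beta m.
  pose tr M := \sum_(p < M) T p p.
  have tr_mono : {homo tr : n k / (n <= k)%N >-> n <= k}.
    apply/nondecreasing_seqP => n.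
    by rewrite /tr big_ord_recr/= lerDl.
  have tr_cvg : cvgn tr.
    apply: nondecreasing_is_cvgn => //; exists C => _ [M _ <-].
    apply: le_trans (S1_trace M); apply: ler_sum => p _.
    by rewrite /T lerBlDr lerDl S0_pp.
  (* the diagonal of S_dag - S_beta is that of - T, whence the absolute value *)
  have -> : gamma_dag e x beta m = `|limn tr|.
    rewrite /gamma_dag /trace (_ : series _ = - tr) ?limN ?normrN//.
    apply/funext => M; rewrite /series/= big_mkord -[RHS]/(- tr M) /tr -sumrN.
    by apply: eq_bigr => p _; rewrite opprB.
  apply: le_trans (ler_norm _); exact: (nondecreasing_cvgn_le tr_mono tr_cvg).
have [iF iterm bound] := gaussian_comparison_expansion F_Cb m0_gauss m1_gauss T_sym T_psd
  S1_trace T_trace (leqnn (2 * s + 2)).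
move=> term.
(* S_dag - S_beta = - T, so that each tensor power picks up a sign *)
have termE j : term j =
    (fun u => (-1) ^+ j * dotp (nabla (2 * j) F u) (fun t => tensor_power T j t)).
  apply/funext => u; rewrite /term /dotp -usum_sign; congr usum; apply/funext => t.
  rewrite mulrCA; congr (_ * _); rewrite /tpow /tensor_power.
  rewrite (eq_bigr (fun k : 'I_j => -1 * T (nth 0%N t k.*2) (nth 0%N t k.*2.+1))).
    by rewrite big_split/= prodr_const card_ord.
  by move=> k _; rewrite mulN1r /T opprB.
clear T_sym T_psd T_pp S1_trace S0_pp T_trace m0_gauss m1_gauss.
split; [exact: iF|by move=> j /iterm ij; rewrite termE; exact: Rintegrable_scale|].
exists (\int[nu]_u F u - \sum_(j < s.+1) (2 ^+ j * j`!%:R)^-1 * \int[m_beta]_u term j u).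
split; first by rewrite addrC subrK.
rewrite [leRHS]mulrAC (eq_bigr (fun j : 'I_s.+1 => (2 ^+ j * j`!%:R)^-1 * (-1) ^+ j *
  \int[m_beta]_u dotp (nabla (2 * j) F u) (fun t => tensor_power T j t))).
  exact: bound.
move=> j _; rewrite -mulrA; congr (_ * _); rewrite termE; apply: RintegralZl => //.
by apply: iterm; rewrite -ltnS.
Qed.
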